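(* Let $\varepsilon>0$ and $\mu\in[0,1]$. The linear maps $\tilde\Pi^R_{\varepsilon,\mu}$ and $\Pi^{R\times}_{\varepsilon,\mu}$ satisfy the commutation relations $$\partial_\mu\tilde\Pi^R_{\varepsilon,\mu}=\tilde\Pi^R_{\varepsilon,\mu}\uparrow_\mu,$$ and, on the multiplicative evaluation map, $$\partial_\mu\Pi^{R\times}_{\varepsilon,\mu}=\Pi^{R\times}_{\varepsilon,\mu}\uparrow_\mu$$ (on $\mathcal T_0$, where $\uparrow_\mu$ is defined).
   Context: **Trees.** Fix $d\ge1$; $0\in\mathbb N$. A decorated tree is a finite non-planar rooted tree. Each node carries a decoration $X^kY^{\mathfrak v}$, $k\in\mathbb N^{d+1}$, $\mathfrak v\in\{0,1\}$ ($X^0=\mathbf 1$). Each edge is of one of the types $\mathcal I_a$, $\mathcal I'_a$, grey $\bar{\mathcal I}_a$ ($a\in\mathbb N^{d+1}$), noise $\Xi$, grey noise $\bar\Xi$. At most one noise-type edge leaves a node; grey edges $\bar{\mathcal I}_a$ are terminal with top node decorated by some $X^k$, written $\bar{\mathcal I}_a(X^k)$. The product of trees identifies the roots and adds their decorations. $\mathcal I_a(\tau)$ (resp. $\mathcal I_a'(\tau)$) attaches the root of $\tau$ to a new root by an edge of that type. Put $\zeta_0=\mathbf 1$, $\zeta_1=\Xi$. A tree is $\zeta_lX^kY^{\mathfrak v}\prod_i\mathcal I_{a_i}(\tau_i)\prod_j\mathcal I'_{b_j}(\tau'_j)\prod_q\bar{\mathcal I}_{c_q}(X^{k_q})$ (empty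 products allowed), possibly with a factor $\bar\Xi$. Standing convention: $\mathcal I_a(Y^{\mathfrak v})=\mathcal I'_a(Y^{\mathfrak v})=0$, and $\mathcal I_a(\tau)=\mathcal I'_a(\tau)=0$ if $\tau$ is composed only of grey symbols or contains at least one $\bar\Xi$. $T_0$: trees with only $\mathcal I$ and $\Xi$ edges and no polynomials. $T_1$: same with at most one $\mathcal I'$ edge. $T_0^X$: as $T_0$ with polynomial decorations. A superscript $\mathfrak g$ allows grey decorations. $\mathcal T$ with the same indices denotes the linear span. Infinite sums over multi-indices are formal (in practice finite). **Degree.** Parabolic scaling $|k|_{\mathfrak s}=2k_1+\sum_{i\ge2}k_i$; fixed $\alpha\in(0,1]$, small $\kappa>0$. $\deg\Xi=-2+\alpha-\kappa$, $\deg X^k=|k|_{\mathfrak s}$, $\deg(\sigma\tau)=\deg\sigma+\deg\tau$, $\deg\mathcal I_a(\tau)=\deg\tau+2-|a|_{\mathfrak s}$, $\deg\mathcal I'_a(\tau)=\deg\mathcal I_a(\tau)-1$, grey edges have degree $0$. **Abstract derivative.** $\uparrow_\mu:\mathcal T_0\to\mathcal T_1$, $\uparrow_\mu\big(\zeta_lY^{\mathfrak v}\prod_{i=1}^n\mathcal I_{a_i}(\tau_i)\big)=\zeta_lY^{\mathfrak v}\sum_{i=1}^n(\mathcal I'_{a_i}(\tau_i)+\mathcal I_{a_i}(\uparrow_\mu\tau_i))\prod_{j\ne i}\mathcal I_{a_j}(\tau_j)$; in particular it is $0$ if $n=0$. **Root extraction.** $\Delta_r:\mathcal T_1\to\mathcal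 T_0^{\mathfrak g}\otimes\mathcal T_1$ is multiplicative with $\Delta_rY^{\mathfrak v}=Y^{\mathfrak v}\otimes\mathbf 1$, $\Delta_r\Xi=\bar\Xi\otimes\Xi+\Xi\otimes\mathbf 1$, $\Delta_r\mathcal I_a(\tau)=(\mathcal I_a\otimes\mathrm{id})\Delta_r\tau+\sum_k\frac1{k!}\bar{\mathcal I}_a(X^k)\otimes\mathcal I_{a+k}(\tau)$, $\Delta_r\mathcal I'_a(\tau)=\sum_k\frac1{k!}\bar{\mathcal I}_a(X^k)\otimes\mathcal I'_{a+k}(\tau)$, sums over $k\in\mathbb N^{d+1}$. **Localisation.** $M_{\rm loc}\big(\zeta_lY^{\mathfrak v}\prod_i\mathcal I_{a_i}(\tau_i)\big)=\sum_{k\in\mathbb N^{d+1}}\frac{X^k}{k!}\zeta_lY^{\mathfrak v}\prod_i\mathcal I_{a_i}(M_{\rm loc}\tau_i)$; factors $\bar\Xi$ and $\bar{\mathcal I}_b(X^j)$ are left untouched. **Elementary differentials.** Let $\Upsilon^0=g$, $\Upsilon^1=f$ be the smooth nonlinearities of the subcritical equation $(\partial_t-\Delta)\psi=g(\psi,\dots,\nabla^q\psi)+f(\psi,\dots,\nabla^p\psi)\xi$ ($p,q<2$), seen as functions of variables $Z=(Z_a)_{a\in\mathbb N^{d+1}}$ representing $\partial^a\phi$; let $\tilde Z_a$ represent $\partial^a\tilde\phi$. $D_a=\partial_{Z_a}$, $\tilde D_a=\partial_{\tilde Z_a}$; $\partial^{e_i}=\sum_aZ_{a+e_i}D_a$ ($e_i$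 the canonical basis of $\mathbb N^{d+1}$), $\partial^k=\prod_i(\partial^{e_i})^{k_i}$, and $\tilde\partial^k$ similarly. $\tilde\Upsilon[\zeta_lY^{\mathfrak v}]=\mathfrak v\Upsilon^l(Z)+(1-\mathfrak v)\Upsilon^l(\tilde Z)$. For $\tau=X^kY^{\mathfrak v}\zeta_l\prod_{i=1}^n\mathcal I_{a_i}(\tau_i)\prod_{j=1}^m\bar{\mathcal I}_{b_j}(X^{k_j})$: if $\mathfrak v=1$, $\tilde\Upsilon[\tau]=(\partial^kD_{a_1}\cdots D_{a_n}D_{b_1}\cdots D_{b_m}\tilde\Upsilon[\zeta_lY^1])\prod_i\tilde\Upsilon[\tau_i]$; if $\mathfrak v=0$, the same with $\tilde\partial,\tilde D$ and $\tilde\Upsilon[\zeta_lY^0]$ at the root. If $\bar\Xi$ is present at a node, $\Upsilon^1$ is used there. The map $\downarrow$ removes $\bar\Xi$, and removes each $\bar{\mathcal I}_b(X^j)$ while multiplying its base node by $X^j$. $\ell:\mathcal T_0^X\to\mathbb R$ is a character, independent of $\mathfrak v$, with $\ell(\mathbf 1)=1$ and vanishing on all other trees of non-negative degree. $\ell\tilde\Upsilon[\tau]:=\ell(\downarrow\tau)\tilde\Upsilon[\tau]$. **Evaluation.** $G$ is the Green kernel of $\partial_t-\Delta$ on $[0,1]\times\mathbb T^d$, $G_\mu(t,x)=\chi(t/\mu^2)G(t,x)$, $G_0=G$, with $\chi$ smooth non-decreasing, $\chi=0$ on $[0,1]$, $\chi=1$ on $[2,\infty)$; $\dot G_\mu=\partial_\mu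 G_\mu$; $\xi_\varepsilon$ is a mollified noise. The following are functionals of $(\phi,\tilde\phi)$. $\Pi^{R\times}_{\varepsilon,\mu}\mathbf 1=1$, $\Pi^{R\times}_{\varepsilon,\mu}\Xi=\xi_\varepsilon$, $\Pi^{R\times}_{\varepsilon,\mu}$ is multiplicative, $\Pi^{R\times}_{\varepsilon,\mu}\mathcal I_a(\tau)=\partial^a(G-G_\mu)*\tilde\Pi^R_{\varepsilon,\mu}\tau$, $\Pi^{R\times}_{\varepsilon,\mu}\mathcal I'_a(\tau)=-\partial^a\dot G_\mu*\tilde\Pi^R_{\varepsilon,\mu}\tau$, and $\tilde\Pi^R_{\varepsilon,\mu}\tau=(\ell\tilde\Upsilon\otimes\Pi^{R\times}_{\varepsilon,\mu})(M_{\rm loc}\otimes\mathrm{id})\Delta_r\tau$ (product of the two factors). *)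

(* Defs.v *)
From HB Require Import structures.
From mathcomp Require Import all_boot all_order all_algebra.
From mathcomp Require Import all_classical all_reals all_analysis.

Set Implicit Arguments.
Unset Strict Implicit.
Unset Printing Implicit Defensive.

Import Order.TTheory GRing.Theory Num.Theory.
Import numFieldNormedType.Exports.

Local Open Scope ring_scope.

(* Elements of N^{d+1}; the coordinate [ord0] is time. *)
Definition mi (d : nat) := {ffun 'I_d.+1 -> nat}.

Definition mi_unit d (i : 'I_d.+1) : mi d := [ffun j => (j == i : nat)].

Definition mi_len d (k : mi d) : nat := (\sum_i k i)%N.

Definition mi_scaled d (k : mi d) : nat :=
  (2 * k ord0 + \sum_(i < d) k (lift ord0 i))%N.

Definition mi_fact d (k : mi d) : nat := (\prod_i (k i)`!)%N.

Definition mi_box d (N : nat) : seq (mi d) :=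
  [seq [ffun i => nat_of_ord (k i)] | k : {ffun 'I_d.+1 -> 'I_N}].

(* At most one noise-type edge leaves a node, so it is a node label. *)
Inductive noise := NoNoise | Xi | GreyXi.

Inductive edge := EI | EI'.

(* [Node s k v ch gr] has root noise [s], root decoration [X^k Y^v], one
   branch [I_a(sigma)] or [I'_a(sigma)] per entry [(e, a, sigma)] of [ch], and
   one grey branch [barI_b(X^j)] per entry [(b, j)] of [gr].
   The two lists are an ordered representative of a non-planar tree, see
   [tree_iso]. *)
Inductive tree (d : nat) :=
  Node of noise & mi d & bool & seq (edge * mi d * tree d) & seq (mi d * mi d).

Fixpoint tree_nested_ind d (P : tree d -> Prop)
    (H : forall s k v ch gr,
      foldr (fun c Q => P c.2 /\ Q) True ch -> P (Node s k v ch gr))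
    (t : tree d) : P t :=
  let: Node s k v ch gr := t in
  H s k v ch gr
    ((fix go (l : seq (edge * mi d * tree d)) :
        foldr (fun c Q => P c.2 /\ Q) True l :=
        match l with
        | [::] => I
        | c :: l' => conj (tree_nested_ind H c.2) (go l')
        end) ch).

(* Equality of the underlying non-planar trees. *)
Inductive tree_iso (d : nat) : tree d -> tree d -> Prop :=
| iso_refl t : tree_iso t t
| iso_sym t u : tree_iso t u -> tree_iso u t
| iso_trans t u w : tree_iso t u -> tree_iso u w -> tree_iso t w
| iso_swap s k v l1 b c l2 gr :
    tree_iso (Node s k v (l1 ++ b :: c :: l2) gr)
             (Node s k v (l1 ++ c :: b :: l2) gr)
| iso_swap_grey s k v ch l1 b c l2 :
    tree_iso (Node s k v ch (l1 ++ b :: c :: l2))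
             (Node s k v ch (l1 ++ c :: b :: l2))
| iso_branch s k v l1 e a t u l2 gr : tree_iso t u ->
    tree_iso (Node s k v (l1 ++ (e, a, t) :: l2) gr)
             (Node s k v (l1 ++ (e, a, u) :: l2) gr).

Definition tree_one d : tree d := Node NoNoise 0 false [::] [::].

Definition planted d (e : edge) (a : mi d) (t : tree d) : tree d :=
  Node NoNoise 0 false [:: (e, a, t)] [::].

Definition grey_planted d (b j : mi d) : tree d :=
  Node NoNoise 0 false [::] [:: (b, j)].

Definition noise_mul (s1 s2 : noise) : noise :=
  if s1 is NoNoise then s2 else s1.

(* Meaningful only if [tree_mul_ok]: no node carries two noise-type edges, nor
   a decoration [Y^2]. *)
Definition tree_mul d (t1 t2 : tree d) : tree d :=
  let: Node s1 k1 v1 ch1 gr1 := t1 in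
  let: Node s2 k2 v2 ch2 gr2 := t2 in
  Node (noise_mul s1 s2) (k1 + k2) (v1 || v2) (ch1 ++ ch2) (gr1 ++ gr2).

Definition tree_mul_ok d (t1 t2 : tree d) : bool :=
  let: Node s1 _ v1 _ _ := t1 in
  let: Node s2 _ v2 _ _ := t2 in
  ((if s1 is NoNoise then true else false) ||
   (if s2 is NoNoise then true else false)) && ~~ (v1 && v2).

Fixpoint height d (t : tree d) : nat :=
  let: Node _ _ _ ch _ := t in
  foldr (fun c n => maxn (height c.2).+1 n) 0%N ch.

Fixpoint has_greyXi d (t : tree d) : bool :=
  let: Node s _ _ ch _ := t in
  (if s is GreyXi then true else false) || has (fun c => has_greyXi c.2) ch.

(* Covers [Y^v]: no [Xi], no power of [X] at the root and only grey edges. *)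
Definition only_grey d (t : tree d) : bool :=
  let: Node s k _ ch _ := t in
  [&& (if s is Xi then false else true), k == 0 & nilp ch].

(* The standing convention under which [I_a(t) = I'_a(t) = 0]. *)
Definition planted_zero d (t : tree d) : bool := only_grey t || has_greyXi t.

(* Trees (not equal to 0 by convention) with only [I] and [Xi] edges and
   arbitrary decorations [X^k Y^v]. *)
Fixpoint is_T0X d (t : tree d) : bool :=
  let: Node s _ _ ch gr := t in
  [&& (if s is GreyXi then false else true), nilp gr &
    all (fun c => [&& (if c.1.1 is EI then true else false),
                      ~~ planted_zero c.2 & is_T0X c.2]) ch].

Fixpoint no_poly d (t : tree d) : bool :=
  let: Node _ k _ ch _ := t in (k == 0) && all (fun c => no_poly c.2) ch.

Definition is_T0 d (t : tree d) : bool := is_T0X t && no_poly t.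

Fixpoint forget_Y d (t : tree d) : tree d :=
  let: Node s k _ ch gr := t in
  Node s k false [seq (c.1, forget_Y c.2) | c <- ch] gr.

(* Each grey noise is erased and each [barI_b(X^j)] becomes a factor [X^j] of
   its base node. *)
Fixpoint down d (t : tree d) : tree d :=
  let: Node s k v ch gr := t in
  Node (if s is GreyXi then NoNoise else s) (k + \sum_(bj <- gr) bj.2) v
    [seq (c.1, down c.2) | c <- ch] [::].

(* On [T0]: the sum, as a list of its terms, over all the edges [I_a] of the
   tree turned into [I'_a]. *)
Fixpoint up d (t : tree d) : seq (tree d) :=
  let: Node s k v ch gr := t in
  let fix up_branches (l : seq (edge * mi d * tree d)) :=
    match l with
    | [::] => [::]
    | (e, a, t') :: l' =>
        ((EI', a, t') :: l') ::
        [seq (EI, a, t'') :: l' | t'' <- up t'] ++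
        [seq (e, a, t') :: l'' | l'' <- up_branches l']
    end in
  [seq Node s k v ch' gr | ch' <- up_branches ch].

Section Coefficients.
Variables (R : realType) (d : nat).

(* A presentation of the linear span: a list of (coefficient, tree); linear
   maps are applied through [lin_ext]. *)
Definition lincomb := seq (R * tree d).

Definition in_span_T0 (x : lincomb) : bool := all (fun c => is_T0 c.2) x.

Definition up_lin (x : lincomb) : lincomb :=
  flatten [seq [seq (c.1, t) | t <- up c.2] | c <- x].

Fixpoint deg (alpha kappa : R) (t : tree d) : R :=
  let: Node s k _ ch _ := t in
  (if s is Xi then - 2 + alpha - kappa else 0) + (mi_scaled k)%:R +
  foldr (fun c acc =>
    deg alpha kappa c.2 + 2 - (mi_scaled c.1.2)%:R
      - (if c.1.1 is EI' then 1 else 0) + acc) 0 ch.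

Definition is_character (alpha kappa : R) (ell : tree d -> R) : Prop :=
  [/\ {in @is_T0X d &, forall t u, tree_iso t u -> ell t = ell u},
      {in @is_T0X d, forall t, ell (forget_Y t) = ell t},
      {in @is_T0X d &, forall t u, tree_mul_ok t u ->
         ell (tree_mul t u) = ell t * ell u},
      ell (tree_one d) = 1 &
      {in @is_T0X d, forall t, forget_Y t <> tree_one d ->
         0 <= deg alpha kappa t -> ell t = 0}].

(* The formal sums over [k : N^{d+1}] are truncated to [k] in [mi_box d N];
   the truncation is removed in [Pi_tilde_of]. Sums are lists of their terms. *)

Definition tens_mul (x y : seq (R * tree d * tree d)) :
    seq (R * tree d * tree d) :=
  [seq (p.1.1 * q.1.1, tree_mul p.1.2 q.1.2, tree_mul p.2 q.2)
  | p <- x, q <- y].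

Definition Delta_noise (s : noise) : seq (R * tree d * tree d) :=
  let n s' := Node s' 0 false [::] [::] in
  if s is Xi then [:: (1, n GreyXi, n Xi); (1, n Xi, tree_one d)]
  else [:: (1, n s, tree_one d)].

Fixpoint Delta_r (N : nat) (t : tree d) : seq (R * tree d * tree d) :=
  let: Node s k v ch gr := t in
  foldr (fun c acc =>
    let: (e, a, t') := c in
    tens_mul
      ((if e is EI then
          [seq (p.1.1, planted EI a p.1.2, p.2)
          | p <- Delta_r N t' & ~~ planted_zero p.1.2]
        else [::]) ++
       [seq ((mi_fact j)%:R^-1, grey_planted a j, planted e (a + j) t')
       | j <- mi_box d N])
      acc)
    (tens_mul [:: (1, Node NoNoise k v [::] gr, tree_one d)] (Delta_noise s))
    ch.

Fixpoint M_loc (N : nat) (t : tree d) : seq (R * tree d) :=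
  let: Node s k v ch gr := t in
  let branches :=
    foldr (fun c acc =>
      [seq (p.1 * q.1, (c.1, p.2) :: q.2) | p <- M_loc N c.2, q <- acc])
      [:: (1, [::])] ch in
  [seq ((mi_fact j)%:R^-1 * q.1, Node s (k + j) v q.2 gr)
  | j <- mi_box d N, q <- branches].

Definition jet := mi d -> R.

Definition jet_upd (Z : jet) (a : mi d) (r : R) : jet :=
  fun b => if b == a then r else Z b.

Definition jetD (a : mi d) (F : jet -> R) : jet -> R :=
  fun Z => derive1 (fun r => F (jet_upd Z a r)) (Z a).

Definition jet_del (i : 'I_d.+1) (F : jet -> R) : jet -> R :=
  fun Z => \sum_(a \in [set: mi d]) Z (a + mi_unit i) * jetD a F Z.

Definition jet_delk (k : mi d) (F : jet -> R) : jet -> R :=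
  foldr (fun i H => iter (k i) (jet_del i) H) F (enum 'I_d.+1).

(* Smooth function of [(psi, ..., nabla^p psi)], seen as a function of all the
   [Z_a]. Only finitely many variables matter, so continuity for the product
   topology is continuity in these. *)
Definition smooth_nonlinearity (p : nat) (F : jet -> R) : Prop :=
  (forall Z Z' : jet,
     (forall a : mi d, a ord0 = 0%N -> (mi_len a <= p)%N -> Z a = Z' a) ->
     F Z = F Z') /\
  (forall s : seq (mi d),
     let H := foldr jetD F s in
     continuous (H : {ptws mi d -> R} -> R) /\
     forall a Z, derivable (fun r => H (jet_upd Z a r)) (Z a) 1).

Variables f g : jet -> R.

Definition Upsilon (l : bool) : jet -> R := if l then f else g.

Definition is_noisy (s : noise) : bool := if s is NoNoise then false else true.

(* First argument [Z], second argument [Z~]. *)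
Definition Ups_base (l v : bool) (Z Zt : jet) : R :=
  v%:R * Upsilon l Z + (1 - v%:R) * Upsilon l Zt.

Fixpoint Ups_tilde (t : tree d) (Z Zt : jet) : R :=
  let: Node s k v ch gr := t in
  let diff (F : jet -> R) :=
    jet_delk k (foldr jetD F ([seq c.1.2 | c <- ch] ++ [seq bj.1 | bj <- gr])) in
  (if v then diff (fun W => Ups_base (is_noisy s) v W Zt) Z
   else diff (fun W => Ups_base (is_noisy s) v Z W) Zt) *
  foldr (fun c acc => Ups_tilde c.2 Z Zt * acc) 1 ch.

(* [T^d = (R/Z)^d]: functions on space-time are functions of
   [(t, x) : R x R^d], 1-periodic in the components of [x]. *)
Definition spacetime := 'rV[R]_d.+1.

Definition pd (i : 'I_d.+1) (F : spacetime -> R) : spacetime -> R :=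
  fun z => 'D_(delta_mx ord0 i : spacetime) F z.

Definition pdk (a : mi d) (F : spacetime -> R) : spacetime -> R :=
  foldr (fun i H => iter (a i) (pd i) H) F (enum 'I_d.+1).

Definition smooth_periodic (F : spacetime -> R) : Prop :=
  (forall z (i : 'I_d),
     F (z + (delta_mx ord0 (lift ord0 i) : spacetime)) = F z) /\
  (forall s : seq 'I_d.+1,
     let H := foldr pd F s in
     continuous H /\
     forall i z, derivable H z (delta_mx ord0 i : spacetime)).

Definition jet_at (F : spacetime -> R) (z : spacetime) : jet :=
  fun a => pdk a F z.

Definition gauss (t x : R) : R :=
  (Num.sqrt (4 * pi * t))^-1 * expR (- (x ^+ 2 / (4 * t))).

(* The sum over [n : Z] of [gauss t (x + n)]. *)
Definition theta (t x : R) : R :=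
  gauss t x +
  limn (series (fun n => gauss t (x + n.+1%:R) + gauss t (x - n.+1%:R))).

(* Green kernel of [d_t - Delta] on the torus: the periodised Gaussian for
   positive times and 0 otherwise. *)
Definition Green (w : spacetime) : R :=
  if 0 < w ord0 ord0
  then \prod_(i < d) theta (w ord0 ord0) (w ord0 (lift ord0 i)) else 0.

Definition is_cutoff (chi : R -> R) : Prop :=
  [/\ (forall n x, derivable (derive1n n chi) x 1),
      (forall x y, 0 <= x -> x <= y -> chi x <= chi y),
      (forall x, 0 <= x <= 1 -> chi x = 0) &
      (forall x, 2 <= x -> chi x = 1)].

Definition row_upd (w : spacetime) (i : 'I_d.+1) (r : R) : spacetime :=
  \row_j (if j == i then r else w ord0 j).

(* Iterated integral over [0,1] x [0,1]^d, with the time integral outermost. *)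
Definition box_int (F : spacetime -> R) : R :=
  foldr (fun i (H : spacetime -> R) w =>
    (\int[lebesgue_measure]_(r in `[0%R, 1%R]%classic) H (row_upd w i r))%R)
    F (enum 'I_d.+1) 0.

(* [d^a K * F] for a kernel [K] on [0,1] x T^d. For large [a] the function
   [d^a K] is not integrable, and [d^a K] is the distributional derivative of
   [K]; it is paired here with the test function [w |-> F (z - w)]. *)
Definition dconv (a : mi d) (K F : spacetime -> R) (z : spacetime) : R :=
  (-1) ^+ mi_len a *
  box_int (fun w => K w * pdk a (fun w' => F (z - w')) w).

Variable chi : R -> R.

Definition Green_mu (mu : R) (w : spacetime) : R :=
  if mu == 0 then Green w else chi (w ord0 ord0 / mu ^+ 2) * Green w.

Definition Green_dot (mu : R) (w : spacetime) : R :=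
  derive1 (fun m => Green_mu m w) mu.

Definition edge_kernel (e : edge) (mu : R) (w : spacetime) : R :=
  match e with
  | EI => Green w - Green_mu mu w
  | EI' => - Green_dot mu w
  end.

Variables (ell : tree d -> R) (xi_eps : spacetime -> R).

Definition functional :=
  (spacetime -> R) -> (spacetime -> R) -> spacetime -> R.

Definition ell_Ups (t : tree d) : functional := fun phi phit z =>
  ell (down t) * Ups_tilde t (jet_at phi z) (jet_at phit z).

(* [(ell Ups (x) P) (M_loc (x) id) Delta_r t]. All but finitely many terms of
   the formal sum vanish, because [ell] vanishes in positive degree, so that
   the sequence of truncations is eventually constant. *)
Definition Pi_tilde_of (P : tree d -> functional) (t : tree d) : functional :=
  fun phi phit z =>
  limn (fun N : nat =>
    \sum_(p <- Delta_r N t)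
      p.1.1 * (\sum_(q <- M_loc N p.1.2) q.1 * ell_Ups q.2 phi phit z) *
      P p.2 phi phit z).

(* [Pi_times] and [Pi_tilde] are mutually recursive, and the recursion is on the
   height rather than structural; see [Pi_timesE]. The right factors of
   [Delta_r] carry no decoration [X^k Y^v] at the root; [Y^v] is evaluated
   to 1. *)
Fixpoint Pi_times_rec (n : nat) (mu : R) (t : tree d) : functional :=
  fun phi phit z =>
  if n is n'.+1 then
    let: Node s _ _ ch _ := t in
    (if s is Xi then xi_eps z else 1) *
    \prod_(c <- ch)
      dconv c.1.2 (edge_kernel c.1.1 mu)
        (Pi_tilde_of (Pi_times_rec n' mu) c.2 phi phit) z
  else 0.

Definition Pi_times (mu : R) (t : tree d) : functional :=
  Pi_times_rec (height t).+1 mu t.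

Definition Pi_tilde (mu : R) (t : tree d) : functional :=
  Pi_tilde_of (Pi_times mu) t.

Definition lin_ext (P : tree d -> functional) (x : lincomb) : functional :=
  fun phi phit z => \sum_(c <- x) c.1 * P c.2 phi phit z.

Lemma height_tree_mul (t u : tree d) :
  height (tree_mul t u) = maxn (height t) (height u).
Proof.
case: t => ? ? ? ch ?; case: u => ? ? ? ch' ? /=.
by elim: ch => [|c ch IH] /=; rewrite ?max0n // IH maxnA.
Qed.

Lemma height_tens_mul n (x y : seq (R * tree d * tree d)) :
  all (fun p => height p.2 <= n)%N x -> all (fun p => height p.2 <= n)%N y ->
  all (fun p => height p.2 <= n)%N (tens_mul x y).
Proof.
move=> hx hy; elim: x hx => [//|p x IH] /= /andP[hp /IH hx].
rewrite all_cat hx andbT all_map; apply: sub_all hy => q /= hq.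
by rewrite height_tree_mul geq_max hp.
Qed.

Lemma height_Delta_r N (t : tree d) :
  all (fun p => height p.2 <= height t)%N (Delta_r N t).
Proof.
elim/tree_nested_ind: t => s k v ch gr /=.
elim: ch => [_|[[e a] t] ch IH] /=; first by case: s.
case=> ht /IH {}IH; apply: height_tens_mul; last first.
  by apply: sub_all IH => p hp; rewrite leq_max hp orbT.
rewrite all_cat; apply/andP; split; last first.
  rewrite all_map; elim: (mi_box d N) => //= j l ->.
  by rewrite maxn0 leq_max leqnn.
case: e => //; rewrite all_map; elim: (Delta_r N t) ht => //= p l IHl.
case/andP=> hp /IHl {}IHl; case: ifP => //= _; rewrite IHl andbT.
by rewrite leq_max (leq_trans hp) // leqnSn.
Qed.

Lemma eq_Pi_tilde_of (P Q : tree d -> functional) t :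
  (forall u, (height u <= height t)%N -> P u = Q u) ->
  Pi_tilde_of P t = Pi_tilde_of Q t.
Proof.
move=> PQ; apply/funext => phi; apply/funext => phit; apply/funext => z.
rewrite /Pi_tilde_of; congr (limn _); apply/funext => N.
elim: (Delta_r N t) (height_Delta_r N t) => [|p l IH] /=.
  by rewrite !big_nil.
by case/andP=> hp /IH {}IH; rewrite !big_cons IH PQ.
Qed.

Lemma Pi_times_rec_stable mu n m t : (height t < n)%N -> (height t < m)%N ->
  Pi_times_rec n mu t = Pi_times_rec m mu t.
Proof.
elim: n m t => [//|n IH] [//|m] [s k v ch gr] hn hm.
apply/funext => phi; apply/funext => phit; apply/funext => z /=.
congr (_ * _); elim: ch hn hm => [|c ch IHch] hn hm; first by rewrite !big_nil.
have [/= hn1 hn2] : (height c.2 < n /\ height (Node s k v ch gr) < n.+1)%N.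
  by move: hn => /=; rewrite ltnS geq_max => /andP[].
have [/= hm1 hm2] : (height c.2 < m /\ height (Node s k v ch gr) < m.+1)%N.
  by move: hm => /=; rewrite ltnS geq_max => /andP[].
rewrite 2!big_cons (IHch hn2 hm2); congr (_ * _); congr (dconv _ _ _ _).
rewrite (@eq_Pi_tilde_of _ (Pi_times_rec m mu)) // => u hu.
by apply: IH; apply: leq_ltn_trans hu _.
Qed.

Lemma Pi_timesE mu s k v ch gr phi phit z :
  Pi_times mu (Node s k v ch gr) phi phit z =
  (if s is Xi then xi_eps z else 1) *
  \prod_(c <- ch)
    dconv c.1.2 (edge_kernel c.1.1 mu) (Pi_tilde mu c.2 phi phit) z.
Proof.
rewrite /Pi_times [LHS]/=; congr (_ * _).
set n := foldr _ _ _; have hn : (height (Node s k v ch gr) <= n)%N by [].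
clearbody n; elim: ch n hn => [|c ch IH] m hm; first by rewrite !big_nil.
have [/= hm1 hm2] : (height c.2 < m /\ height (Node s k v ch gr) <= m)%N.
  by move: hm => /=; rewrite geq_max => /andP[].
have E : Pi_tilde_of (Pi_times_rec m mu) c.2 = Pi_tilde mu c.2.
  rewrite /Pi_tilde; apply: eq_Pi_tilde_of => u hu; rewrite /Pi_times.
  by apply: Pi_times_rec_stable; [apply: leq_ltn_trans hu hm1 | apply: ltnSn].
by rewrite [LHS]big_cons [RHS]big_cons E (IH m hm2).
Qed.

Lemma Pi_times_mul mu t u phi phit z : tree_mul_ok t u ->
  Pi_times mu (tree_mul t u) phi phit z =
  Pi_times mu t phi phit z * Pi_times mu u phi phit z.
Proof.
case: t u => [s k v ch gr] [s' k' v' ch' gr'] /= ok.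
rewrite !Pi_timesE big_cat mulrACA; congr (_ * _).
by case: s ok => //; case: s' => //=; rewrite ?mul1r ?mulr1.
Qed.

End Coefficients.

(* Main.v *)
Require Import Defs.
From mathcomp Require Import all_boot all_order all_algebra.
From mathcomp Require Import all_classical all_reals all_analysis.
From mathcomp Require Import measurable_realfun ring lra zify.

(** The scale [mu] enters the two evaluations only through the kernels of the
    edges: [G - G_mu] for an edge [I], and its [mu]-derivative [- dot G_mu] for
    an edge [I']. By the product rule, differentiating [Pi_times] of a tree in
    [T0] sums over all its edges the evaluation in which the kernel of that
    edge is differentiated, and this is the evaluation of the trees listed by
    [up]. Three things stand behind this sentence.

    Algebra. The value of [Pi_tilde] at a tree is a pairing of [Delta_r] with
    coefficients that depend on the left factors alone, hence not on [mu].
    So the product rule for [Pi_times] passes to [Pi_tilde] as soon as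
    [(id (x) up) Delta_r = Delta_r up], which is [pairing_Delta_r_up].

    Finiteness. The sums over multi-indices are really finite, uniformly in
    [mu] and in the space-time point: each power of [X] adds at least 1 to the
    degree of a left factor, whereas its noises and derivatives lower the degree
    by a bounded amount, so that the character vanishes on all terms with many
    powers of [X] ([Pi_tilde_of_trunc]).

    Analysis. The kernels have the form [c(mu, t) * G(t, x)] with a scalar
    weight [c], so every convolution is the pairing [heat h] of the Green kernel
    with a continuous function [h] of the point and the parameters. That pairing
    is linear, and it is bounded by the supremum of [h] because [G(t, .)] has
    bounded mass, uniformly in [t]. These two properties alone allow one to
    differentiate under the integral, difference quotients being uniformly
    close to derivatives on the compact box. At [mu = 0] the weight is not
    continuous, but it lives on times [t <= 2 mu^2], where the kernel has mass
    [O(mu^2)]: the convolution is [O(mu^2)] and its derivative at 0 is 0, as is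
    the value of the differentiated kernel. To iterate, one needs classes of
    families of functions that are stable under the convolutions, the products
    and space-time derivatives: these are [smooth] and [smooth_deriv]. The
    coefficients belong to them by the chain rule for functions of finitely
    many jet variables ([smooth_jet]). *)

Set Implicit Arguments.
Unset Strict Implicit.
Unset Printing Implicit Defensive.

Import Order.TTheory GRing.Theory Num.Theory.
Import numFieldNormedType.Exports.

Local Open Scope ring_scope.

Local Open Scope classical_set_scope.

(** * Continuity and integration over the unit interval *)

Lemma continuous_pair_comp (T U V W : topologicalType) (f : T -> U)
    (g : T -> V) (h : U * V -> W) (x : T) :
  {for x, continuous f} -> {for x, continuous g} ->
  {for (f x, g x), continuous h} -> {for x, continuous (fun t => h (f t, g t))}.
Proof.
move=> cf cg ch; apply: (@cvg_comp _ _ _ (fun t => (f t, g t)) h _ (nbhs (f x, g x))) => //.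
exact: cvg_pair.
Qed.

Lemma continuous_for_comp (T U V : topologicalType) (f : T -> U) (g : U -> V)
    (x : T) :
  {for x, continuous f} -> {for (f x), continuous g} ->
  {for x, continuous (fun t => g (f t))}.
Proof. exact: continuous_comp. Qed.

Lemma continuous_fst (T U : topologicalType) : continuous (@fst T U).
Proof.
move=> [x y] A /= Ax; exists (A, setT) => //=; last by move=> z [].
by split=> //; exact: filterT.
Qed.

Lemma continuous_snd (T U : topologicalType) : continuous (@snd T U).
Proof.
move=> [x y] A /= Ax; exists (setT, A) => //=; last by move=> z [].
by split=> //; exact: filterT.
Qed.

Lemma continuous_forP (R : realType) (T : topologicalType) (f : T -> R) (x : T) :
  {for x, continuous f} <->
  forall e, 0 < e -> \forall y \near x, `|f x - f y| <= e.
Proof. exact: (@cvgrPdist_le _ _ _ (nbhs x)). Qed.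

Lemma compact_near (T U : topologicalType) (K : set U) (x : T)
    (P : T -> U -> Prop) : compact K ->
  (forall k, K k -> \forall p \near (k, x), P p.2 p.1) ->
  \forall t \near x, forall k, K k -> P t k.
Proof.
by move=> /compact_near_coveringP cK HP; apply: (cK T (nbhs x) P) => k /HP.
Qed.

Lemma continuous_forZ (R : realType) (T : topologicalType) (a : R)
    (f : T -> R) (x : T) :
  {for x, continuous f} -> {for x, continuous (fun t => a * f t)}.
Proof. by move=> cf; apply: cvgM => //; exact: cvg_cst. Qed.

Lemma continuous_forD (R : realType) (T : topologicalType) (f g : T -> R) (x : T) :
  {for x, continuous f} -> {for x, continuous g} ->
  {for x, continuous (fun t => f t + g t)}.
Proof. by move=> cf cg; apply: cvgD. Qed.

Lemma continuous_forB (R : realType) (T : topologicalType) (f g : T -> R) (x : T) :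
  {for x, continuous f} -> {for x, continuous g} ->
  {for x, continuous (fun t => f t - g t)}.
Proof. by move=> cf cg; apply: cvgB. Qed.

Lemma continuous_forM (R : realType) (T : topologicalType) (f g : T -> R) (x : T) :
  {for x, continuous f} -> {for x, continuous g} ->
  {for x, continuous (fun t => f t * g t)}.
Proof. by move=> cf cg; apply: cvgM. Qed.

Lemma continuous_for_sum (R : realType) (T : topologicalType) (I : Type)
    (r : seq I) (F : I -> T -> R) (x : T) :
  (forall i, {for x, continuous (F i)}) ->
  {for x, continuous (fun t => \sum_(i <- r) F i t)}.
Proof.
move=> cF; elim: r => [|i r IH].
  rewrite (_ : (fun t => _) = fun=> 0); first exact: cst_continuous.
  by apply/funext => t; rewrite big_nil.
rewrite (_ : (fun t => _) = fun t => F i t + \sum_(j <- r) F j t).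
  by apply: cvgD => //; exact: cF.
by apply/funext => t; rewrite big_cons.
Qed.

Lemma continuous_for_prod (R : realType) (T : topologicalType) (I : Type)
    (r : seq I) (F : I -> T -> R) (x : T) :
  (forall i, {for x, continuous (F i)}) ->
  {for x, continuous (fun t => \prod_(i <- r) F i t)}.
Proof.
move=> cF; elim: r => [|i r IH].
  rewrite (_ : (fun t => _) = fun=> 1); first exact: cst_continuous.
  by apply/funext => t; rewrite big_nil.
rewrite (_ : (fun t => _) = fun t => F i t * \prod_(j <- r) F j t).
  by apply: cvgM => //; exact: cF.
by apply/funext => t; rewrite big_cons.
Qed.

(** Heine-Cantor with a parameter: joint continuity along a compact fibre is
    uniform over the fibre. All the passages to the limit under an integral
    rest on this. *)
Lemma compact_uniform_close (R : realType) (T U : topologicalType) (K : set U)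
    (x : T) (h : T -> U -> R) : compact K ->
  (forall k, K k -> {for (x, k), continuous (fun p : T * U => h p.1 p.2)}) ->
  forall e, 0 < e -> \forall t \near x, forall k, K k -> `|h x k - h t k| <= e.
Proof.
move=> cK ch e e0; apply: compact_near => // k Kk.
have e2 : 0 < e / 2 by rewrite divr_gt0.
have c1 : {for (k, x), continuous (fun p : U * T => h p.2 p.1)}.
  apply: (@continuous_pair_comp _ _ _ _ snd fst (fun p : T * U => h p.1 p.2)).
  - exact: continuous_snd.
  - exact: continuous_fst.
  - exact: ch.
have c2 : {for (k, x), continuous (fun p : U * T => h x p.1)}.
  apply: (@continuous_pair_comp _ _ _ _ (fun=> x) fst
            (fun p : T * U => h p.1 p.2)).
  - exact: cst_continuous.
  - exact: continuous_fst.
  - exact: ch.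
move/continuous_forP : c1 => /(_ _ e2) c1; move/continuous_forP : c2 => /(_ _ e2).
apply: filterS2 c1 => -[k' t] /= c1 c2.
rewrite (splitr e) -[X in X - _](subrK (h x k)) -addrA.
by rewrite (le_trans (ler_normD _ _))// lerD// distrC.
Qed.

Section UnitInterval.
Variable R : realType.

Definition int01 (f : R -> R) : R :=
  (\int[lebesgue_measure]_(r in `[0%R, 1%R]) f r)%R.

Definition integrable01 (f : R -> R) :=
  (@lebesgue_measure R).-integrable `[0%R, 1%R] (EFin \o f).

Lemma continuous_integrable01 (f : R -> R) :
  (forall r, 0 <= r <= 1 -> {for r, continuous f}) -> integrable01 f.
Proof.
move=> cf; apply: continuous_compact_integrable; first exact: segment_compact.
by apply: continuous_in_subspaceT => r; rewrite inE/= in_itv/= => /cf.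
Qed.

Lemma eq_int01 (f g : R -> R) : (forall r, 0 <= r <= 1 -> f r = g r) ->
  int01 f = int01 g.
Proof. by move=> fg; apply: eq_Rintegral => r; rewrite inE/= in_itv/= => /fg. Qed.

Lemma int01D (f g : R -> R) : integrable01 f -> integrable01 g ->
  int01 (fun r => f r + g r) = int01 f + int01 g.
Proof. by move=> fi gi; rewrite /int01 RintegralD. Qed.

Lemma int01Z (a : R) (f : R -> R) : integrable01 f ->
  int01 (fun r => a * f r) = a * int01 f.
Proof. by move=> fi; rewrite /int01 RintegralZl. Qed.

Lemma integrable01D (f g : R -> R) : integrable01 f -> integrable01 g ->
  integrable01 (fun r => f r + g r).
Proof.
move=> fi gi; rewrite /integrable01.
rewrite (_ : _ \o _ = (EFin \o f) \+ (EFin \o g))%E; first exact: integrableD.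
by apply/funext.
Qed.

Lemma integrable01Z (a : R) (f : R -> R) : integrable01 f ->
  integrable01 (fun r => a * f r).
Proof.
move=> fi; have := integrableZl _ a fi; rewrite /= => /(_ (measurable_itv _)).
exact: eq_integrable.
Qed.

Lemma int01_le (f g : R -> R) : integrable01 f -> integrable01 g ->
  (forall r, 0 <= r <= 1 -> `|f r| <= g r) -> `|int01 f| <= int01 g.
Proof.
move=> fi gi fg; apply: le_trans (le_normr_Rintegral _ _) _ => //.
apply: le_Rintegral => //; first by apply: integrable_norm.
Qed.

Lemma int01_cst (c : R) : int01 (fun=> c) = c.
Proof.
rewrite /int01 Rintegral_cst//= lebesgue_measure_itv/= lte_fin ltr01/=.
by rewrite oppr0 addr0 mulr1.
Qed.

Lemma integrable01_cst (c : R) : integrable01 (fun=> c).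
Proof. by apply: continuous_integrable01 => r _; exact: cvg_cst. Qed.

Lemma int01_close (f g : R -> R) e : integrable01 f -> integrable01 g ->
  (forall r, 0 <= r <= 1 -> `|f r - g r| <= e) -> `|int01 f - int01 g| <= e.
Proof.
move=> fi gi fg; have gi' := integrable01Z (-1) gi.
have -> : int01 f - int01 g = int01 (fun r => f r + -1 * g r).
  by rewrite int01D// int01Z// mulN1r.
rewrite -[leRHS](int01_cst e).
apply: int01_le; [exact: integrable01D|exact: integrable01_cst|].
by move=> r /fg; rewrite mulN1r.
Qed.

End UnitInterval.

Section Iterated.
Variables (R : realType) (d : nat).
Notation st := (spacetime R d).

Lemma row_updE (w : st) i r :
  row_upd w i r = w + (r - w ord0 i) *: delta_mx ord0 i.
Proof.
apply/matrixP => a j; rewrite !mxE (ord1 a) /=.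
by case: eqP => [->|_] /=; rewrite ?mulr1 ?mulr0 ?addr0// addrC subrK.
Qed.

Lemma row_upd_continuous i : continuous (fun p : st * R => row_upd p.1 i p.2).
Proof.
move=> [w r]; rewrite (_ : (fun p => _) = fun p : st * R =>
  p.1 + (p.2 - p.1 ord0 i) *: (delta_mx ord0 i : st)); last first.
  by apply/funext => p; rewrite row_updE.
apply: cvgD; first exact: continuous_fst.
apply: cvgZr_tmp; apply: cvgB; first exact: continuous_snd.
apply: (@continuous_for_comp _ _ _ fst (fun w : st => w ord0 i)).
  exact: continuous_fst.
exact: coord_continuous.
Qed.

(** The successive integrals of [box_int], at an arbitrary stage. *)
Definition iter_int01 (l : seq 'I_d.+1) (F : st -> R) : st -> R :=
  foldr (fun i H w => int01 (fun r => H (row_upd w i r))) F l.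

(** The Green kernel is singular at time zero only, and the integrals over the
    spatial coordinates are taken at a fixed positive time. *)
Definition continuous_pos (F : st -> R) :=
  forall w : st, 0 < w ord0 ord0 -> {for w, continuous F}.

Lemma row_upd_time (w : st) i r : i != ord0 -> (row_upd w i r) ord0 ord0 = w ord0 ord0.
Proof. by rewrite mxE eq_sym => /negbTE ->. Qed.

Lemma continuous_pos_slice F (w : st) i : i != ord0 -> continuous_pos F ->
  0 < w ord0 ord0 -> forall r, {for r, continuous (fun r => F (row_upd w i r))}.
Proof.
move=> i0 cF w0 r.
apply: (@continuous_for_comp _ _ _ (fun r : R => row_upd w i r) F); last first.
  by apply: cF; rewrite row_upd_time ?i0.
apply: (@continuous_pair_comp _ _ _ _ (fun=> w) id
  (fun p : st * R => row_upd p.1 i p.2)); last exact: row_upd_continuous.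
- exact: cvg_cst.
- exact: cvg_id.
Qed.

Lemma continuous_pos_int01 i F : i != ord0 -> continuous_pos F ->
  continuous_pos (fun w => int01 (fun r => F (row_upd w i r))).
Proof.
move=> i0 cF w w0; apply/continuous_forP => e e0.
have cj r : `[0, 1]%classic r ->
    {for (w, r), continuous (fun p : st * R => F (row_upd p.1 i p.2))}.
  move=> _; apply: (@continuous_for_comp _ _ _ (fun p => row_upd p.1 i p.2) F).
    exact: row_upd_continuous.
  by apply: cF; rewrite row_upd_time ?i0.
have Uw0 : nbhs w (fun w' : st => 0 < w' ord0 ord0).
  have := @coord_continuous _ _ _ ord0 (ord0 : 'I_d.+1) w.
  by move/(_ _ (lt_nbhsr w0)).
have := compact_uniform_close (h := fun w r => F (row_upd w i r))
    (@segment_compact R 0 1) cj e0.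
apply: filterS2 Uw0 => w' w'0 HU.
apply: int01_close.
- by apply: continuous_integrable01 => r _; exact: continuous_pos_slice.
- by apply: continuous_integrable01 => r _; exact: continuous_pos_slice.
- by move=> r r01; apply: HU; rewrite /= in_itv.
Qed.

End Iterated.

(** * The periodised Gaussian *)

Section DominatedSeries.
Variable R : realType.

(** Comparable with the inverse squares, but with explicit partial sums since
    it telescopes. *)
Definition invn2 (n : nat) : R := (n.+1%:R)^-1 - (n.+2%:R)^-1.

Lemma invn2E n : invn2 n = (n.+1%:R * n.+2%:R)^-1.
Proof.
have := ltr0Sn R n; rewrite /invn2 -[n.+2%:R]natr1; move: n.+1%:R => a a0.
by field; rewrite !gt_eqF// addr_gt0.
Qed.

Lemma invn2_ge0 n : 0 <= invn2 n.
Proof. by rewrite invn2E invr_ge0 mulr_ge0. Qed.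

Lemma series_invn2 n : series invn2 n = 1 - (n.+1%:R)^-1.
Proof.
elim: n => [|n IH]; first by rewrite /series/= big_geq// invr1 subrr.
by rewrite seriesSr IH /invn2 addrA subrK.
Qed.

Lemma cvg_series_invn2 : cvgn (series invn2).
Proof.
apply: nondecreasing_is_cvgn; first exact: nondecreasing_series (fun n _ _ => invn2_ge0 n).
by exists 1 => _ [n _ <-]; rewrite series_invn2 gerBl invr_ge0.
Qed.

Lemma dominated_series_cvg (u : nat -> R) C N :
  (forall n, (N <= n)%N -> `|u n| <= C * invn2 n) -> cvgn (series u).
Proof.
move=> uC.
have C0 : 0 <= C.
  have := le_trans (normr_ge0 _) (uC _ (leqnn N)).
  by rewrite pmulr_lge0// invn2E invr_gt0 mulr_gt0.
rewrite -(is_cvg_series_restrict N).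
pose u' n := if (n < N)%N then 0 else u n.
have -> : [sequence \sum_(N <= k < n) u k]_n = [sequence \sum_(N <= k < n) u' k]_n.
  apply/funext => n /=; rewrite big_nat [RHS]big_nat; apply: eq_bigr => k /andP[Nk _].
  by rewrite /u' ltnNge Nk.
rewrite is_cvg_series_restrict; apply: normed_cvg => /=.
apply: (@series_le_cvg _ _ (fun n => C * invn2 n)) => //.
- by move=> n; exact: normr_ge0.
- by move=> n; apply: mulr_ge0 => //; exact: invn2_ge0.
- move=> n /=; rewrite /u'; case: ltnP => [_|/uC//].
  by rewrite normr0 mulr_ge0// invn2_ge0.
- rewrite (_ : series _ = fun n => C * series invn2 n); last first.
    by apply/funext => n; rewrite /series/= mulr_sumr.
  apply: is_cvgMl_tmp; exact: cvg_series_invn2.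
Qed.

(** The bound only concerns the terms from [N] on: for the periodised Gaussian on
    the unit interval, the image of the origin at 1 has no bound that is uniform
    in small times. *)
Lemma dominated_series_tail (u : nat -> R) C N :
  (forall n, (N <= n)%N -> `|u n| <= C * invn2 n) ->
  `|limn (series u) - series u N| <= C / N.+1%:R.
Proof.
move=> uC; have cu := dominated_series_cvg uC.
have C0 : 0 <= C.
  have := le_trans (normr_ge0 _) (uC _ (leqnn N)).
  by rewrite pmulr_lge0// invn2E invr_gt0 mulr_gt0.
have tail M : `|series u (N + M)%N - series u N|
    <= C * ((N.+1%:R)^-1 - ((N + M).+1%:R)^-1).
  elim: M => [|M IH]; first by rewrite addn0 !subrr normr0 mulr0.
  rewrite addnS seriesSr -addrAC (le_trans (ler_normD _ _))//.
  apply: le_trans (lerD IH (uC _ (leq_addr _ _))) _.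
  by rewrite -mulrDr /invn2 addrA subrK.
have cu' : (fun M => `|series u M - series u N|) @ \oo --> `|limn (series u) - series u N|.
  by apply: cvg_norm; apply: cvgB => //; exact: cvg_cst.
rewrite -(cvg_lim _ cu')//; apply: limr_le; first exact: cvgP cu'.
exists N => // M /= NM; rewrite -(subnKC NM); apply: le_trans (tail _) _.
by rewrite ler_wpM2l// gerBl invr_ge0.
Qed.

(** A locally uniform limit of continuous partial sums. *)
Lemma dominated_series_continuous (T : topologicalType) (u : nat -> T -> R) x C :
  (\forall t \near x, forall n, `|u n t| <= C * invn2 n) ->
  (forall n, {for x, continuous (u n)}) ->
  {for x, continuous (fun t => limn (series (u ^~ t)))}.
Proof.
move=> uC cu; apply/continuous_forP => e e0.
have ux := nbhs_singleton uC.
have C0 : 0 <= C.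
  have := le_trans (normr_ge0 _) (ux 0%N).
  by rewrite pmulr_lge0// invn2E invr_gt0 mulr_gt0.
have [N HN] : exists N : nat, C / N.+1%:R <= e / 3.
  exists (Num.trunc (C / (e / 3))).
  rewrite ler_pdivrMr// mulrC -ler_pdivrMr ?divr_gt0//.
  by apply/ltW/truncnS_gt.
have cS : {for x, continuous (fun t => series (u ^~ t) N)}.
  exact: continuous_for_sum.
have e3 : 0 < e / 3 by rewrite divr_gt0.
move/continuous_forP : cS => /(_ _ e3); apply: filterS2 uC => t ut cS.
have h1 := le_trans (dominated_series_tail (N := N) (fun n _ => ux n)) HN.
have h2 := le_trans (dominated_series_tail (N := N) (fun n _ => ut n)) HN.
move: h1 h2 cS; move: (limn _) (limn _) (series _ _) (series _ _) => a b c a'.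
rewrite !ler_norml; lra.
Qed.

End DominatedSeries.

Section Theta.
Variable R : realType.
Implicit Types t x y : R.

(** The only decay of the exponential that is used: all the series below need
    just inverse squares. *)
Lemma expRN_le (u : R) : 0 < u -> expR (- u) <= u^-1.
Proof.
move=> u0; rewrite expRN lef_pV2 ?posrE ?expR_gt0//.
by apply: le_trans (expR_ge1Dx u); rewrite lerDr.
Qed.

Lemma gauss_ge0 t x : 0 <= gauss t x.
Proof. by rewrite mulr_ge0 ?expR_ge0// invr_ge0. Qed.

Lemma heat_norm_gt0 t : 0 < t -> 0 < Num.sqrt (4 * pi * t).
Proof. by move=> t0; rewrite sqrtr_gt0 !mulr_gt0// pi_gt0. Qed.

Lemma gauss_le t y : 0 < t <= 1 -> y != 0 -> gauss t y <= 4 / y ^+ 2.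
Proof.
move=> /andP[t0 t1] y0; have y2 : 0 < y ^+ 2 by rewrite exprn_even_gt0.
rewrite /gauss.
have h : expR (- (y ^+ 2 / (4 * t))) <= (4 * t) / y ^+ 2.
  by rewrite -[leRHS]invf_div; apply: expRN_le; rewrite divr_gt0// mulr_gt0.
apply: le_trans (ler_wpM2l _ h) _; first by rewrite invr_ge0.
rewrite mulrA ler_wpM2r ?invr_ge0 ?(ltW y2)//.
rewrite mulrC ler_pdivrMr ?heat_norm_gt0//.
rewrite ler_pM2l// -[leLHS]gtr0_norm// -sqrtr_sqr ler_sqrt; last first.
  by rewrite !mulr_ge0 ?pi_ge0 ?ltW.
rewrite expr2 ler_pM2r//; have := pi_ge2 R; lra.
Qed.

Definition theta_term t x n : R := gauss t (x + n.+1%:R) + gauss t (x - n.+1%:R).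

(** Half of the square of the shift controls the Gaussian, the rest of the
    exponent is bounded by the position [x]. The bound is locally uniform in
    [t > 0] and [x], which suffices for continuity but not for small times. *)
Lemma gauss_shift_le t x y n : 0 < t -> n.+1%:R ^+ 2 <= 2 * y ^+ 2 + 2 * x ^+ 2 ->
  gauss t y <= (Num.sqrt (4 * pi * t))^-1 * expR (x ^+ 2 / (4 * t)) * (16 * t) * invn2 R n.
Proof.
move=> t0 hn; rewrite /gauss -[leRHS]mulrA -[leRHS]mulrA ler_wpM2l ?invr_ge0//.
set N := n.+1%:R in hn *; have N1 : 1 <= N by rewrite ler1n.
have h : expR (- (y ^+ 2 / (4 * t))) <=
    expR (x ^+ 2 / (4 * t)) * expR (- (N ^+ 2 / (8 * t))).
  rewrite -expRD ler_expR lerNl opprD opprK addrC.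
  have -> : N ^+ 2 / (8 * t) - x ^+ 2 / (4 * t) = (N ^+ 2 - 2 * x ^+ 2) / (8 * t).
    by field; rewrite gt_eqF.
  have -> : y ^+ 2 / (4 * t) = (2 * y ^+ 2) / (8 * t) by field; rewrite gt_eqF.
  rewrite ler_pM2r ?invr_gt0 ?mulr_gt0//; lra.
apply: le_trans h _; rewrite ler_wpM2l ?expR_ge0//.
have N2 : 0 < N ^+ 2 by rewrite exprn_gt0// (lt_le_trans _ N1).
apply: (@le_trans _ _ ((8 * t) / N ^+ 2)).
  by rewrite -[leRHS]invf_div; apply: expRN_le; rewrite divr_gt0// mulr_gt0.
rewrite invn2E -[n.+2%:R]natr1 -/N.
have N0 : 0 < N by rewrite (lt_le_trans _ N1).
have NN : 0 < N * (N + 1) by rewrite mulr_gt0 ?addr_gt0.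
rewrite ler_pdivrMr// mulrAC ler_pdivlMr//.
rewrite -subr_ge0.
have -> : 16 * t * N ^+ 2 - 8 * t * (N * (N + 1)) = 8 * t * (N * (N - 1)) by ring.
by rewrite !mulr_ge0 ?subr_ge0 ?(ltW t0) ?(ltW N0).
Qed.

Lemma theta_term_le t x n : 0 < t -> `|theta_term t x n| <=
  2 * ((Num.sqrt (4 * pi * t))^-1 * expR (x ^+ 2 / (4 * t)) * (16 * t)) * invn2 R n.
Proof.
move=> t0; rewrite ger0_norm ?addr_ge0 ?gauss_ge0//.
rewrite -mulrA mulrDl mul1r lerD// gauss_shift_le//.
  (* For y = x + n + 1, 2 y^2 + 2 x^2 - (n + 1)^2 is the square of 2 x + n + 1. *)
  have := sqr_ge0 (2 * x + n.+1%:R); nra.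
have := sqr_ge0 (2 * x - n.+1%:R); nra.
Qed.

Lemma gauss_continuous t x : 0 < t -> {for (t, x), continuous (fun p : R * R =>
    gauss p.1 p.2)}.
Proof.
move=> t0; have cf := @continuous_fst R R (t, x); have cs := @continuous_snd R R (t, x).
apply: cvgM.
  apply: (@continuousV _ _ (fun p : R * R => Num.sqrt (4 * pi * p.1))).
    by rewrite gt_eqF//= heat_norm_gt0.
  apply: (@continuous_for_comp _ _ _ (fun p : R * R => 4 * pi * p.1) Num.sqrt);
    last exact: sqrt_continuous.
  by apply: cvgM => //; exact: cvg_cst.
apply: (@continuous_for_comp _ _ _ (fun p : R * R => - (p.2 ^+ 2 / (4 * p.1))) expR);
  last exact: continuous_expR.
apply: cvgN; apply: cvgM; first by rewrite /= expr2; apply: cvgM.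
apply: (@continuousV _ _ (fun p : R * R => 4 * p.1)).
  by rewrite gt_eqF//= mulr_gt0.
by apply: cvgM => //; exact: cvg_cst.
Qed.

Lemma thetaE t x : theta t x = gauss t x + limn (series (theta_term t x)).
Proof. by []. Qed.

Lemma theta_continuous t x : 0 < t ->
  {for (t, x), continuous (fun p : R * R => theta p.1 p.2)}.
Proof.
move=> t0; have cf := @continuous_fst R R (t, x); have cs := @continuous_snd R R (t, x).
apply: cvgD; first exact: gauss_continuous.
pose B (p : R * R) :=
  2 * ((Num.sqrt (4 * pi * p.1))^-1 * expR (p.2 ^+ 2 / (4 * p.1)) * (16 * p.1)).
have cB : {for (t, x), continuous B}.
  apply: cvgM; first exact: cvg_cst.
  apply: cvgM; last by apply: cvgM => //; exact: cvg_cst.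
  apply: cvgM.
    apply: (@continuousV _ _ (fun p : R * R => Num.sqrt (4 * pi * p.1))).
      by rewrite gt_eqF//= heat_norm_gt0.
    apply: (@continuous_for_comp _ _ _ (fun p : R * R => 4 * pi * p.1) Num.sqrt);
      last exact: sqrt_continuous.
    by apply: cvgM => //; exact: cvg_cst.
  apply: (@continuous_for_comp _ _ _ (fun p : R * R => p.2 ^+ 2 / (4 * p.1)) expR);
    last exact: continuous_expR.
  apply: cvgM; first by rewrite /= expr2; apply: cvgM.
  apply: (@continuousV _ _ (fun p : R * R => 4 * p.1)).
    by rewrite gt_eqF//= mulr_gt0.
  by apply: cvgM => //; exact: cvg_cst.
apply: (@dominated_series_continuous _ _ (fun n (p : R * R) => theta_term p.1 p.2 n)
  (t, x) (B (t, x) + 1)).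
  have tpos : \forall p \near (t, x), 0 < p.1 := cf _ (lt_nbhsr t0).
  have Bx : B (t, x) < B (t, x) + 1 by rewrite ltrDl.
  have Bnear : \forall p \near (t, x), B p <= B (t, x) + 1.
    exact: (@cvgr_le _ _ _ _ _ _ cB _ Bx).
  apply: filterS2 tpos Bnear => p p0 pB n.
  apply: le_trans (theta_term_le _ _ p0) _.
  by rewrite ler_wpM2r ?invn2_ge0.
have c1 k : {for (t, x), continuous (fun p : R * R => gauss p.1 (p.2 + k))}.
  have ck : {for (t, x), continuous (fun p : R * R => p.2 + k)}.
    by apply: cvgD => //; exact: cvg_cst.
  have cg := @gauss_continuous t (x + k) t0.
  exact: (continuous_pair_comp cf ck cg).
by move=> n; apply: (cvgD (c1 n.+1%:R) (c1 (- n.+1%:R))).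
Qed.

(** Uniform in time: the images of the origin other than 0 and 1 stay at
    distance at least 1 from the unit interval. *)
Lemma theta_le t x : 0 < t <= 1 -> 0 <= x <= 1 ->
  `|theta t x| <= gauss t x + gauss t (x - 1) + 28.
Proof.
move=> t01 /andP[x0 x1]; have /andP[t0 t1] := t01.
have tail n : (1 <= n)%N -> `|theta_term t x n| <= 48 * invn2 R n.
  move=> n1; rewrite /theta_term ger0_norm ?addr_ge0 ?gauss_ge0//.
  have N1 : 1 <= n%:R :> R by rewrite ler1n.
  have N0 : 0 < n%:R :> R by rewrite (lt_le_trans _ N1).
  have gn y : n%:R <= `|y| -> gauss t y <= 4 / n%:R ^+ 2.
    move=> ny; have y0 : y != 0 by rewrite -normr_gt0 (lt_le_trans _ ny).
    apply: le_trans (gauss_le t01 y0) _.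
    rewrite ler_wpM2l// lef_pV2 ?posrE ?exprn_even_gt0// ?gt_eqF//.
    by rewrite -[leRHS]real_normK ?num_real// ler_pXn2r// nnegrE ltW.
  apply: (@le_trans _ _ (4 / n%:R ^+ 2 + 4 / n%:R ^+ 2)).
    apply: lerD; apply: gn; rewrite -[n.+1%:R]natr1.
      rewrite ger0_norm; lra.
    rewrite ler0_norm; lra.
  rewrite invn2E -[n.+2%:R]natr1 -[n.+1%:R]natr1 -mulrDl.
  have NN : 0 < (n%:R + 1) * (n%:R + 1 + 1) :> R by rewrite mulr_gt0// !addr_gt0.
  rewrite ler_pdivlMr// mulrAC ler_pdivrMr ?exprn_gt0//; nra.
(* The term n = 0 contains the second Gaussian near [0, 1], hence the tail
   starts at 1; 28 = 4 + 48 / 2. *)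
have := dominated_series_tail tail.
rewrite /series/= big_nat1 thetaE /theta_term.
have g1 : gauss t (x + 1) <= 4.
  have x10 : x + 1 != 0 by rewrite gt_eqF// ltr_wpDl.
  apply: le_trans (gauss_le t01 x10) _.
  rewrite ler_pdivrMr ?exprn_gt0 ?ltr_wpDl//; nra.
have := gauss_ge0 t x; have := gauss_ge0 t (x - 1); have := gauss_ge0 t (x + 1).
move: (limn _) => L; rewrite !ler_norml; lra.
Qed.

Lemma gauss_normal_pdf t x m : 0 < t ->
  gauss t (x - m) = normal_pdf m (Num.sqrt (2 * t)) x.
Proof.
move=> t0; have t2 : 0 <= 2 * t by rewrite mulr_ge0// ltW.
have s0 : Num.sqrt (2 * t) != 0 by rewrite gt_eqF// sqrtr_gt0 mulr_gt0.
rewrite normal_pdfE// /gauss /normal_peak /normal_fun sqr_sqrtr//.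
congr ((Num.sqrt _)^-1 * expR _); first by ring.
by rewrite mulNr; congr (- (_ / _)); ring.
Qed.

Lemma gauss_slice_continuous t m x : 0 < t ->
  {for x, continuous (fun y => gauss t (y - m))}.
Proof.
move=> t0; under [X in {for _, continuous X}]eq_fun do rewrite gauss_normal_pdf//.
by apply: continuous_normal_pdf; rewrite gt_eqF// sqrtr_gt0 mulr_gt0.
Qed.

Lemma int01_gauss_le t m : 0 < t -> int01 (fun x => gauss t (x - m)) <= 1.
Proof.
move=> t0; rewrite -lee_fin /int01 /Rintegral fineK; last first.
  apply: integrable_fin_num => //.
  by apply: continuous_integrable01 => r _; exact: gauss_slice_continuous.
rewrite -(integral_normal_pdf m (Num.sqrt (2 * t))).
under eq_integral do rewrite gauss_normal_pdf//.
apply: ge0_subset_integral => //.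
  by apply/measurable_EFinP; exact: measurable_normal_pdf.
by move=> x _; rewrite lee_fin normal_pdf_ge0.
Qed.

Lemma theta_slice_continuous t x : 0 < t -> {for x, continuous (theta t)}.
Proof.
move=> t0; apply: (@continuous_pair_comp _ _ _ _ (fun=> t) id
  (fun p : R * R => theta p.1 p.2)); last exact: theta_continuous.
- exact: cst_continuous.
- exact: cvg_id.
Qed.

(** Each of the two Gaussians that see the unit interval has mass at most 1,
    and 30 = 1 + 1 + 28. *)
Lemma int01_theta_le t : 0 < t <= 1 -> int01 (fun x => `|theta t x|) <= 30.
Proof.
move=> t01; have /andP[t0 _] := t01.
have ig m : integrable01 (fun x => gauss t (x - m)).
  by apply: continuous_integrable01 => r _; exact: gauss_slice_continuous.
have ith : integrable01 (fun x => `|theta t x|).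
  apply: continuous_integrable01 => r _; apply: cvg_norm.
  exact: theta_slice_continuous.
apply: (@le_trans _ _ (int01 (fun x => (gauss t (x - 0) + gauss t (x - 1)) + 28))).
  apply: le_trans (ler_norm _) _; apply: int01_le => //.
    by apply: integrable01D; [exact: integrable01D|exact: integrable01_cst].
  by move=> r r01; rewrite normr_id subr0; exact: theta_le.
rewrite int01D; [|exact: integrable01D|exact: integrable01_cst].
rewrite int01D// int01_cst; have := int01_gauss_le 0 t0; have := int01_gauss_le 1 t0; lra.
Qed.

End Theta.

(** * The Green kernel as a functional on continuous functions *)

Section HeatFunctional.
Variables (R : realType) (d : nat).
Notation st := (spacetime R d).
Implicit Types (F G h : st -> R) (w : st).

Definition box : set st := [set w | forall i, 0 <= w ord0 i <= 1].

Lemma box_compact : compact box.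
Proof.
rewrite (_ : box = [set w : 'rV[R]_d.+1 | forall i, `[0, 1]%classic (w ord0 i)]).
  exact: (@rV_compact R d.+1 (fun=> `[0, 1]%classic) (fun=> @segment_compact R 0 1)).
by apply/seteqP; split => w /= wb i; have := wb i; rewrite /= in_itv.
Qed.

Lemma box_row_upd w i r : box w -> 0 <= r <= 1 -> box (row_upd w i r).
Proof. by move=> wb r01 j; rewrite mxE; case: eqP => // _; exact: wb. Qed.

Lemma continuous_pos_iter_int01 l F : ord0 \notin l -> continuous_pos F ->
    continuous_pos (iter_int01 l F).
Proof.
move=> + cF; elim: l => [//|i l IH]; rewrite inE negb_or eq_sym => /andP[i0 /IH].
exact: continuous_pos_int01.
Qed.

Lemma iter_int01_integrable l F w i : ord0 \notin i :: l -> continuous_pos F ->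
  0 < w ord0 ord0 -> integrable01 (fun r => iter_int01 l F (row_upd w i r)).
Proof.
rewrite inE negb_or eq_sym => /andP[i0 l0] cF w0.
by apply: continuous_integrable01 => r _; apply: continuous_pos_slice => //;
    exact: continuous_pos_iter_int01.
Qed.

Lemma eq_iter_int01 l F G w : ord0 \notin l -> box w ->
  (forall w', box w' -> w' ord0 ord0 = w ord0 ord0 -> F w' = G w') ->
  iter_int01 l F w = iter_int01 l G w.
Proof.
elim: l w => [|i l IH] w; first by move=> _ wb; apply.
rewrite inE negb_or eq_sym => /andP[i0 l0] wb FG /=.
apply: eq_int01 => r r01; apply: IH => //; first exact: box_row_upd.
by move=> w' w'b e; apply: FG => //; rewrite e row_upd_time.
Qed.

Lemma iter_int01D l F G w : ord0 \notin l -> continuous_pos F -> continuous_pos G ->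
  0 < w ord0 ord0 -> iter_int01 l (fun w => F w + G w) w = iter_int01 l F w +
      iter_int01 l G w.
Proof.
elim: l w => [//|i l IH] w il cF cG w0.
rewrite /= -int01D; [|exact: iter_int01_integrable..].
move: il; rewrite inE negb_or eq_sym => /andP[i0 l0].
by apply: eq_int01 => r _; apply: IH => //; rewrite row_upd_time.
Qed.

Lemma iter_int01Z l a F w : ord0 \notin l -> continuous_pos F ->
  0 < w ord0 ord0 -> iter_int01 l (fun w => a * F w) w = a * iter_int01 l F w.
Proof.
elim: l w => [//|i l IH] w il cF w0.
rewrite /= -int01Z; last exact: iter_int01_integrable.
move: il; rewrite inE negb_or eq_sym => /andP[i0 l0].
by apply: eq_int01 => r _; apply: IH => //; rewrite row_upd_time.
Qed.

(** Each spatial integration trades one factor [theta] for its total mass. *)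
Lemma iter_int01_theta_le l F t M w : uniq l -> ord0 \notin l -> continuous_pos F ->
  0 < t <= 1 -> 0 <= M ->
  (forall w', box w' -> w' ord0 ord0 = t ->
     `|F w'| <= M * \prod_(i | i != ord0) `|theta t (w' ord0 i)|) ->
  box w -> w ord0 ord0 = t ->
  `|iter_int01 l F w| <= 30 ^+ size l * M *
     \prod_(i | (i != ord0) && (i \notin l)) `|theta t (w ord0 i)|.
Proof.
move=> + + cF t01 M0 FM; elim: l w => [|i l IH] w /=.
  move=> _ _ wb wt; rewrite mul1r (eq_bigl (fun i => i != ord0)).
    exact: FM.
  by move=> i; rewrite andbT.
move=> /andP[il ul] /[dup] i0l; rewrite inE negb_or eq_sym => /andP[i0 l0] wb wt.
have t0 : 0 < t by case/andP: t01.
set P := \prod_(_ | _) _.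
have P0 : 0 <= P by apply: prodr_ge0.
have ith : integrable01 (fun r => `|theta t r|).
  by apply: continuous_integrable01 => r _; apply: cvg_norm; exact: theta_slice_continuous.
have bnd r : 0 <= r <= 1 ->
    `|iter_int01 l F (row_upd w i r)| <= 30 ^+ size l * M * P * `|theta t r|.
  move=> r01; apply: le_trans (IH _ ul l0 _ _) _; first exact: box_row_upd.
    by rewrite row_upd_time.
  rewrite -[leRHS]mulrA ler_wpM2l ?mulr_ge0 ?exprn_ge0//.
  rewrite (bigD1 i) ?i0//= mxE eqxx mulrC ler_wpM2r//.
  rewrite le_eqVlt; apply/orP; left; apply/eqP; apply: eq_big => [j|j].
    by rewrite inE negb_or -andbA; congr (_ && _); rewrite andbC.
  by case/andP => _ /negbTE ji; rewrite mxE ji.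
apply: (@le_trans _ _ (int01 (fun r => 30 ^+ size l * M * P * `|theta t r|))).
  apply: int01_le => //; first by apply: iter_int01_integrable => //; rewrite wt.
  exact: integrable01Z.
rewrite int01Z//; apply: le_trans (ler_wpM2l _ (int01_theta_le t01)) _.
  by rewrite !mulr_ge0 ?exprn_ge0.
by rewrite exprS le_eqVlt; apply/orP; left; apply/eqP; ring.
Qed.

Lemma Green_continuous_pos : continuous_pos (@Green R d).
Proof.
move=> w w0.
have cw i : {for w, continuous (fun w : st => w ord0 i)} by exact: coord_continuous.
have cp : {for w, continuous (fun w : st =>
    \prod_(i < d) theta (w ord0 ord0) (w ord0 (lift ord0 i)))}.
  apply: continuous_for_prod => i.
  apply: (@continuous_pair_comp _ _ _ _ (fun w : st => w ord0 ord0)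
    (fun w : st => w ord0 (lift ord0 i)) (fun p : R * R => theta p.1 p.2)) => //.
  exact: theta_continuous.
have near0 : nbhs w (fun w' : st => 0 < w' ord0 ord0) by exact: (cw _ _ (lt_nbhsr w0)).
apply/continuous_forP => e e0; move/continuous_forP : cp => /(_ e e0).
by apply: filterS2 near0 => w' w'0; rewrite /Green w0 w'0.
Qed.

Lemma Green_nonpos w : w ord0 ord0 <= 0 -> Green w = 0.
Proof. by rewrite /Green ltNge => ->. Qed.

(** The only singular integral that occurs: cut-offs in time and convolved
    functions are put into [h]. *)
Definition heat (h : st -> R) : R := box_int (fun w => Green w * h w).

Let space : seq 'I_d.+1 := map (lift ord0) (enum 'I_d).

Let ord0_space : ord0 \notin space.
Proof. by apply/mapP => -[i _ /eqP]; rewrite (negbTE (neq_lift _ _)). Qed.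

Let space_uniq : uniq space.
Proof. by rewrite map_inj_uniq ?enum_uniq//; exact: lift_inj. Qed.

(** The integral over the torus at time [t]; it is bounded up to time 0, though
    the kernel is not. *)
Definition heat_slice (h : st -> R) (t : R) : R :=
  iter_int01 space (fun w => Green w * h w) (row_upd 0 ord0 t).

Lemma heatE h : heat h = int01 (heat_slice h).
Proof. by rewrite /heat /box_int enum_ordSl. Qed.

Let continuous_posM h : continuous h -> continuous_pos (fun w => Green w * h w).
Proof. by move=> ch w w0; apply: (cvgM (Green_continuous_pos w0) (ch w)). Qed.

Let row_upd0 t : (row_upd (0 : st) ord0 t) ord0 ord0 = t.
Proof. by rewrite mxE eqxx. Qed.

Let box_row_upd0 t : 0 <= t <= 1 -> box (row_upd (0 : st) ord0 t).
Proof. by move=> t01; apply: box_row_upd => // i; rewrite mxE lexx ler01. Qed.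

Lemma heat_slice0 h : heat_slice h 0 = 0.
Proof.
rewrite /heat_slice (@eq_iter_int01 _ _ (fun=> 0)) //.
- elim: space (row_upd _ _ _) => //= i l IH w.
  by under eq_int01 do rewrite IH; rewrite int01_cst.
- by apply: box_row_upd0; rewrite lexx ler01.
- by move=> w' _; rewrite row_upd0 => w'0; rewrite Green_nonpos ?mul0r ?w'0.
Qed.

Lemma heat_slice_le h t M : continuous h -> 0 <= t <= 1 -> 0 <= M ->
  (forall w, box w -> w ord0 ord0 = t -> `|h w| <= M) ->
  `|heat_slice h t| <= 30 ^+ d * M.
Proof.
move=> ch /andP[]; rewrite le_eqVlt => /predU1P[<- _|t0 t1] M0 hM.
  by rewrite heat_slice0 normr0 mulr_ge0 ?exprn_ge0.
have t01 : 0 < t <= 1 by rewrite t0 t1.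
apply: le_trans (@iter_int01_theta_le space (fun w => Green w * h w) t M
  (row_upd 0 ord0 t) space_uniq ord0_space (continuous_posM ch) t01 M0 _ _ _) _.
- move=> w' w'b w't; rewrite normrM mulrC /Green w't t0 ler_pM//; first exact: hM.
  (* Re-index the product over the nonzero coordinates by [lift ord0]. *)
  rewrite normr_prod [leRHS]big_mkcond big_ord_recl/= mul1r.
  by rewrite le_eqVlt; apply/orP; left; apply/eqP; apply: eq_bigr.
- by apply: box_row_upd0; rewrite t1 ltW.
- by rewrite row_upd0.
rewrite size_map size_enum_ord big_pred0 ?mulr1//.
move=> i; case: (unliftP ord0 i) => [j ->|->]; last by rewrite eqxx.
by rewrite map_f ?mem_enum// andbF.
Qed.

Lemma box_bounded h : continuous h -> exists2 M, 0 <= M & forall w, box w -> `|h w| <= M.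
Proof.
move=> ch.
have /compact_bounded [M [_ HM]] : compact (h @` box).
  by apply: continuous_compact box_compact; exact: continuous_subspaceT.
exists (`|M| + 1) => [|w wb]; first by rewrite addr_ge0.
apply: (HM (`|M| + 1)); last by exists w.
by rewrite (le_lt_trans (ler_norm M))// ltrDl.
Qed.

Lemma heat_slice_integrable h : continuous h -> integrable01 (heat_slice h).
Proof.
move=> ch; have [M M0 hM] := box_bounded ch.
apply: measurable_bounded_integrable => //.
- by rewrite /= lebesgue_measure_itv/= lte_fin ltr01 -EFinD ltry.
- apply: (@measurable_fun_itv_cc _ _ _ false true).
  apply: open_continuous_measurable_fun; first exact: interval_open.
  move=> t; rewrite inE/= in_itv/= => /andP[t0 _].
  apply: (@continuous_for_comp _ _ _ (fun t : R => row_upd (0 : st) ord0 t)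
            (iter_int01 space (fun w => Green w * h w))).
    apply: (@continuous_pair_comp _ _ _ _ (fun=> 0 : st) id
      (fun p : st * R => row_upd p.1 ord0 p.2)); last exact: row_upd_continuous.
    - exact: cst_continuous.
    - exact: cvg_id.
  by apply: continuous_pos_iter_int01 => //; [exact: continuous_posM|rewrite row_upd0].
- exists (30 ^+ d * M); split; first exact: num_real.
  move=> x Mx t /=; rewrite in_itv/= => t01.
  by apply: le_trans (ltW Mx); apply: heat_slice_le => // w wb _; exact: hM.
Qed.

Lemma heatD h k : continuous h -> continuous k ->
  heat (fun w => h w + k w) = heat h + heat k.
Proof.
move=> ch ck; rewrite !heatE -int01D; [|exact: heat_slice_integrable..].
apply: eq_int01 => t /andP[]; rewrite le_eqVlt => /predU1P[<- _|t0 _].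
  by rewrite !heat_slice0 addr0.
rewrite /heat_slice -iter_int01D ?row_upd0//; [|exact: continuous_posM..].
by congr (iter_int01 _ _ _); apply/funext => w; rewrite mulrDr.
Qed.

Lemma heatZ a h : continuous h -> heat (fun w => a * h w) = a * heat h.
Proof.
move=> ch; rewrite !heatE -int01Z; last exact: heat_slice_integrable.
apply: eq_int01 => t /andP[]; rewrite le_eqVlt => /predU1P[<- _|t0 _].
  by rewrite !heat_slice0 mulr0.
rewrite /heat_slice -iter_int01Z ?row_upd0//; last exact: continuous_posM.
by congr (iter_int01 _ _ _); apply/funext => w; rewrite mulrCA.
Qed.

(** The kernel has mass at most [30 ^+ d] at each time, hence a function that
    lives on times at most [delta] is integrated to [O(delta)]. *)
Lemma heat_le h M delta : continuous h -> 0 <= M -> 0 <= delta ->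
  (forall w, box w -> `|h w| <= M * (w ord0 ord0 <= delta)%R%:R) ->
  `|heat h| <= 30 ^+ d * M * delta.
Proof.
move=> ch M0 delta0 hM; pose J t : R := \1_`[0, delta] t.
have iJ : integrable01 J.
  apply: measurable_bounded_integrable => //.
  - by rewrite /= lebesgue_measure_itv/= lte_fin ltr01 -EFinD ltry.
  - by exact: measurable_indic.
  - exists 1; split; first exact: num_real.
    move=> x x1 t _; apply: le_trans (ltW x1).
    by rewrite /J /indic; case: (_ \in _); rewrite ?normr1 ?normr0.
have iJle : int01 J <= delta.
  have [d1|d1] := lerP delta 1; last first.
    apply: le_trans (ltW d1); rewrite -[leRHS](int01_cst 1).
    apply: le_trans (ler_norm _) _; apply: int01_le => //.
      exact: integrable01_cst.
    by move=> r _; rewrite /J /indic; case: (_ \in _); rewrite ?normr1 ?normr0.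
  rewrite (_ : int01 J = int01 ((fun=> 1 : R) \_ `[0, delta])); last first.
    by apply: eq_int01 => r _; rewrite /J patchE /indic; case: (_ \in _).
  rewrite /int01.
  (* The indicator restricts the domain of integration to [0, delta]. *)
  rewrite -Rintegral_mkcondr setIidr; last first.
    by move=> r /=; rewrite !in_itv/= => /andP[-> /le_trans ->].
  rewrite Rintegral_cst//= mul1r lebesgue_measure_itv/=.
  by case: ifP => //= _; rewrite subr0.
rewrite heatE; apply: (@le_trans _ _ (int01 (fun t => 30 ^+ d * M * J t))).
  apply: int01_le; [exact: heat_slice_integrable|exact: integrable01Z|].
  move=> t /[dup] t01 /andP[t0 t1].
  have Jt : J t = (t <= delta)%R%:R.
    rewrite /J /indic; congr (_%:R); congr nat_of_bool; apply/idP/idP.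
      by rewrite inE/= in_itv/= t0.
    by move=> td; rewrite inE/= in_itv/= t0.
  rewrite -mulrA Jt; apply: heat_slice_le => //; first exact: mulr_ge0.
  by move=> w wb wt; rewrite -wt; exact: hM.
by rewrite int01Z// ler_wpM2l// mulr_ge0// exprn_ge0.
Qed.

Lemma heat_bounded h M : continuous h -> 0 <= M ->
  (forall w, box w -> `|h w| <= M) -> `|heat h| <= 30 ^+ d * M.
Proof.
move=> ch M0 hM; rewrite -[leRHS]mulr1; apply: heat_le => // w wb.
by have /andP[_ ->] := wb ord0; rewrite mulr1; exact: hM.
Qed.

End HeatFunctional.

(** * Parameters and time cut-offs *)

Section PointwiseRules.
Variables (R : realType) (V : normedModType R).
Implicit Types (f g : V -> R) (x v : V) (a b : R).

Lemma is_deriveM_fun f g x v a b : is_derive x v f a -> is_derive x v g b ->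
  is_derive x v (fun y => f y * g y) (a * g x + f x * b).
Proof.
move=> df dg; apply: (is_derive_eq (is_deriveM df dg)).
by rewrite /GRing.scale/= addrC mulrC.
Qed.

Lemma is_deriveD_fun f g x v a b : is_derive x v f a -> is_derive x v g b ->
  is_derive x v (fun y => f y + g y) (a + b).
Proof. exact: is_deriveD. Qed.

Lemma is_deriveZ_fun k f x v a : is_derive x v f a ->
  is_derive x v (fun y => k * f y) (k * a).
Proof. exact: is_deriveZ. Qed.

Lemma eq_is_derive f g x v a : f =1 g -> is_derive x v f a -> is_derive x v g a.
Proof. by move=> /funext ->. Qed.

Lemma is_derive_cst_fun k x v : is_derive x v (fun=> k : R) 0.
Proof. exact: is_derive_cst. Qed.

End PointwiseRules.

Section Increments.
Variable R : realType.

(** Increments that are linear up to [o(s)]; unlike difference quotients they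
    behave well under the functional [heat]. *)
Lemma is_derive_increment (f : R -> R) (r0 l : R) :
  (forall e, 0 < e -> \forall s \near (0 : R), `|f (s + r0) - f r0 - s * l| <= e * `|s|) ->
  is_derive r0 1 f l.
Proof.
move=> fl.
have cv : (fun h => h^-1 *: ((f \o shift r0) (h *: 1) - f r0)) @ 0^' --> l.
  apply/cvgrPdist_le => e e0; move: (fl e e0); rewrite /dnbhs/= => fe.
  apply: filterS fe => s fs s0.
  have -> : l - s^-1 *: ((f \o shift r0) (s *: 1) - f r0) =
      s^-1 * - (f (s + r0) - f r0 - s * l).
    by rewrite /= /GRing.scale/= mulr1 mulrN [_ * (_ - s * l)]mulrBr mulKf// opprB.
  by rewrite normrM normfV normrN ler_pdivrMl ?normr_gt0// [leRHS]mulrC.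
by split; [exact: cvgP cv|exact: cvg_lim cv].
Qed.

(** The mean value theorem, in the form of a bound on the error of the linear
    approximation by the oscillation of the derivative. *)
Lemma increment_le (f df : R -> R) (r0 s l e : R) :
  (forall r, `|r - r0| <= `|s| -> is_derive r 1 f (df r)) ->
  (forall r, `|r - r0| <= `|s| -> `|df r - l| <= e) ->
  `|f (s + r0) - f r0 - s * l| <= e * `|s|.
Proof.
move=> dfr dfl.
have cf r : `|r - r0| <= `|s| -> {for r, continuous f}.
  move=> /dfr [df1 _]; apply: differentiable_continuous; exact/derivable1_diffP.
have main a b : a <= b -> (forall r, a <= r <= b -> `|r - r0| <= `|s|) ->
    exists2 c, `|c - r0| <= `|s| & f b - f a = df c * (b - a).
  move=> ab abs; have [||c] := @MVT_segment R f df a b ab.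
  - by move=> x; rewrite in_itv/= => /andP[ax xb]; apply: dfr; apply: abs; rewrite !ltW.
  - by apply: continuous_in_subspaceT => x; rewrite inE/= in_itv/= => /abs/cf.
  - by rewrite in_itv/= => /abs cs fE; exists c.
have [s0|s0] := lerP 0 s.
  have [||c cs] := main r0 (s + r0); first by rewrite lerDr.
    by move=> r /andP[r1 r2]; rewrite !ger0_norm// ?subr_ge0// lerBlDr.
  rewrite addrK => ->; rewrite mulrC -mulrBr normrM mulrC ler_wpM2r//.
  exact: dfl.
have [||c cs] := main (s + r0) r0; first by rewrite gerDr ltW.
  by move=> r /andP[r1 r2]; rewrite (ltr0_norm s0) ler_norml; lra.
move=> fE; have -> : f (s + r0) - f r0 - s * l = s * (df c - l).
  by rewrite -(opprB (f r0)) fE; ring.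
by rewrite normrM mulrC ler_wpM2r//; exact: dfl.
Qed.

End Increments.

Section HeatParameter.
Variables (R : realType) (d : nat).
Notation st := (spacetime R d).

Lemma heatB (h k : st -> R) : continuous h -> continuous k ->
  heat h - heat k = heat (fun w => h w - k w).
Proof.
move=> ch ck; rewrite -mulN1r -heatZ// -heatD//.
  by congr heat; apply/funext => w; rewrite mulN1r.
by move=> w; apply: continuous_forZ; exact: ck.
Qed.

Lemma heat_close (h k : st -> R) e : continuous h -> continuous k -> 0 <= e ->
  (forall w, box w -> `|h w - k w| <= e) -> `|heat h - heat k| <= 30 ^+ d * e.
Proof.
move=> ch ck e0 hk; rewrite heatB//; apply: heat_bounded => // w.
by apply: continuous_forB; [exact: ch|exact: ck].
Qed.

Lemma heat_continuous_param (T : topologicalType) (h : T -> st -> R) (t0 : T) :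
  (forall t, continuous (h t)) ->
  (forall w, box w -> {for (t0, w), continuous (fun p : T * st => h p.1 p.2)}) ->
  {for t0, continuous (fun t => heat (h t))}.
Proof.
move=> ch cj; apply/continuous_forP => e e0.
have C0 : 0 < 30 ^+ d :> R by exact: exprn_gt0.
have e' : 0 < e / 30 ^+ d by rewrite divr_gt0.
have := compact_uniform_close (@box_compact R d) cj e'.
apply: filterS => t ht; apply: le_trans (heat_close _ _ (ltW e') ht) _ => //.
by rewrite mulrC divfK// gt_eqF.
Qed.

(** Differentiation under the integral sign. The increments of [h] are uniformly
    close to their linear parts on the box, and [heat] is linear and bounded. *)
Lemma heat_is_derive (h dh : R -> st -> R) (r0 : R) :
  (forall r, continuous (h r)) -> continuous (dh r0) ->
  (forall w, box w -> {for (r0, w), continuous (fun p : R * st => dh p.1 p.2)}) ->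
  nbhs r0 (fun r : R => forall w, box w -> is_derive r 1 (h^~ w) (dh r w)) ->
  is_derive r0 1 (fun r => heat (h r)) (heat (dh r0)).
Proof.
move=> ch cdh cj hdh; apply: is_derive_increment => e e0.
have C0 : 0 < 30 ^+ d :> R by exact: exprn_gt0.
have e' : 0 < e / 30 ^+ d by rewrite divr_gt0.
have cl := compact_uniform_close (@box_compact R d) cj e'.
have [r /= rpos Hr] : nbhs r0 (fun r : R =>
    (forall w, box w -> is_derive r 1 (h^~ w) (dh r w)) /\
    (forall w, box w -> `|dh r0 w - dh r w| <= e / 30 ^+ d)) by exact: filterI.
exists r => // s; rewrite /= sub0r normrN => sr.
have Hs (r1 : R) (h1 : `|r1 - r0| <= `|s|) := Hr r1 (le_lt_trans
  (eq_ind_r (fun x => x <= `|s|) h1 (distrC r0 r1)) sr).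
have cs : continuous (fun w => s * dh r0 w).
  by move=> w; apply: continuous_forZ; exact: cdh.
have cb : continuous (fun w => h (s + r0) w - h r0 w).
  by move=> w; apply: continuous_forB; exact: ch.
rewrite -heatZ// heatB// heatB//.
have -> : e * `|s| = 30 ^+ d * (e / 30 ^+ d * `|s|).
  by field; rewrite gt_eqF.
apply: heat_bounded; last 1 first.
- move=> w wb; apply: (@increment_le _ (h^~ w) (dh^~ w)) => r1 /Hs[h1 h2].
    exact: h1.
  by rewrite distrC; exact: h2.
- by move=> w; exact: (continuous_forB (cb w) (cs w)).
- by rewrite mulr_ge0// ltW.
Qed.

End HeatParameter.

Lemma nbhs_neq0 (R : realType) (m : R) : m != 0 -> nbhs m (fun x : R => x != 0).
Proof. by move=> m0; exact: (@cvgr_neq0 _ _ _ (nbhs m) _ id m). Qed.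

Section TimeWeights.
Variables (R : realType) (chi : R -> R).
Hypothesis hchi : is_cutoff chi.

(** The kernel of an edge is [ctime] times the Green kernel, see
    [edge_kernelE]. At scale 0 both kernels vanish: [G - G_0 = 0], and at each
    positive time [G_mu] does not depend on small [mu]. *)
Definition ctime (e : edge) (m t : R) : R :=
  if m == 0 then 0 else
  match e with
  | EI => 1 - chi (t / m ^+ 2)
  | EI' => 2 * t / m ^+ 3 * derive1 chi (t / m ^+ 2)
  end.

Let dchi x : derivable chi x 1.
Proof. by case: hchi => /(_ 0%N x). Qed.

Let cchi : continuous chi.
Proof. by move=> x; apply: differentiable_continuous; exact/derivable1_diffP. Qed.

Let cdchi : continuous (derive1 chi).
Proof.
move=> x; apply: differentiable_continuous; apply/derivable1_diffP.
by case: hchi => /(_ 1%N x).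
Qed.

Lemma ctime0 e t : ctime e 0 t = 0.
Proof. by rewrite /ctime eqxx. Qed.

Let near_neq0 (m : R) (t : R) : m != 0 -> \forall p \near (m, t), p.1 != 0.
Proof.
by move=> m0; have := (@continuous_fst R R (m, t)) _ (nbhs_neq0 m0).
Qed.

Lemma ctime_continuous e m t : m != 0 ->
  {for (m, t), continuous (fun p : R * R => ctime e p.1 p.2)}.
Proof.
move=> m0.
have cf := @continuous_fst R R (m, t); have cs := @continuous_snd R R (m, t).
have cq n : {for (m, t), continuous (fun p : R * R => (p.1 ^+ n)^-1)}.
  apply: (@continuousV _ _ (fun p : R * R => p.1 ^+ n)); first by rewrite expf_neq0.
  by apply: (@continuous_for_comp _ _ _ fst (fun x : R => x ^+ n)) => //;
      exact: exprn_continuous.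
have cq2 : {for (m, t), continuous (fun p : R * R => p.2 / p.1 ^+ 2)}.
  exact: (cvgM cs (cq 2%N)).
suff : {for (m, t), continuous (fun p : R * R =>
    match e with
    | EI => 1 - chi (p.2 / p.1 ^+ 2)
    | EI' => 2 * p.2 / p.1 ^+ 3 * derive1 chi (p.2 / p.1 ^+ 2)
    end)}.
  move=> /continuous_forP H; apply/continuous_forP => e1 /H.
  apply: filterS2 (near_neq0 t m0) => p p0.
  by rewrite /ctime/= (negbTE p0) (negbTE m0).
case: e.
  have c1 : {for (m, t), continuous (fun p : R * R => chi (p.2 / p.1 ^+ 2))}.
    exact: (continuous_for_comp cq2 (@cchi _)).
  by apply: cvgB; [exact: cvg_cst|exact: c1].
have c1 : {for (m, t), continuous (fun p : R * R => derive1 chi (p.2 / p.1 ^+ 2))}.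
  exact: (continuous_for_comp cq2 (@cdchi _)).
have c2 : {for (m, t), continuous (fun p : R * R => 2 * p.2 / p.1 ^+ 3)}.
  apply: (@continuousM _ _ (fun p : R * R => 2 * p.2)); last exact: cq.
  by apply: cvgM => //; exact: cvg_cst.
exact: (cvgM c2 c1).
Qed.

Lemma ctime_slice_continuous e m : continuous (ctime e m).
Proof.
move=> t; have [->|m0] := eqVneq m 0.
  rewrite (_ : ctime e 0 = fun=> 0); first exact: cst_continuous.
  by apply/funext => ?; rewrite ctime0.
apply: (@continuous_pair_comp _ _ _ _ (fun=> m) id (fun p : R * R => ctime e p.1 p.2)).
- exact: cst_continuous.
- exact: cvg_id.
- exact: ctime_continuous.
Qed.

Let is_derive_time_ratio (m t : R) : m != 0 -> is_derive m 1 (fun m => t / m ^+ 2)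
    (- (2 * t / m ^+ 3)).
Proof.
move=> m0.
have d2 : is_derive m 1 (fun m : R => m ^+ 2) (2 * m).
  rewrite (_ : (fun m => _) = fun m : R => m * m); last first.
    by apply/funext => ?; rewrite expr2.
  apply: (is_derive_eq (is_deriveM_fun (is_derive_id m 1) (is_derive_id m 1))).
  by rewrite mul1r mulr1 mulr_natl.
have := is_deriveZ_fun t (@is_deriveV _ (fun m => m ^+ 2) m _ 1 (expf_neq0 2 m0) d2).
move=> H; apply: (is_derive_eq H); rewrite /GRing.scale/=; field.
by rewrite m0.
Qed.

Lemma ctime_is_derive (m t : R) : m != 0 ->
  is_derive m 1 (fun m : R => ctime EI m t) (ctime EI' m t).
Proof.
move=> m0.
have dc : is_derive m 1 (fun m => chi (t / m ^+ 2))
    (derive1 chi (t / m ^+ 2) * (- (2 * t / m ^+ 3))).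
  apply: (@is_derive1_comp _ chi (fun m => t / m ^+ 2)); last exact: is_derive_time_ratio.
  by rewrite derive1E; apply: derivableP.
have d1 := is_deriveD_fun (is_derive_cst_fun 1 m 1) (is_deriveZ_fun (-1) dc).
have d2 := is_derive_eq d1 (_ : _ = ctime EI' m t).
apply: near_eq_is_derive (d2 _).
  apply: filterS (nbhs_neq0 m0) => m' m'0.
  by rewrite /ctime (negbTE m'0) mulN1r.
by rewrite /ctime (negbTE m0); ring.
Qed.

Let chi01 x : 0 <= x -> 0 <= chi x <= 1.
Proof.
case: hchi => _ mono c0 c2 x0; apply/andP; split.
  by rewrite -(c0 0) ?lexx ?ler01//; apply: mono.
have [x2|x2] := lerP 2 x; first by rewrite c2.
by rewrite -(c2 2)//; apply: mono => //; exact: ltW.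
Qed.

Let time_le2 (m t : R) : m != 0 -> (t <= 2 * m ^+ 2) = (t / m ^+ 2 <= 2).
Proof. by move=> m0; rewrite ler_pdivrMr// exprn_even_gt0. Qed.

Lemma ctime_EI_le m t : 0 <= t -> `|ctime EI m t| <= 1 * (t <= 2 * m ^+ 2)%R%:R.
Proof.
move=> t0; rewrite mul1r /ctime; case: eqVneq => [_|m0]; first by rewrite normr0.
have x0 : 0 <= t / m ^+ 2 by rewrite divr_ge0// exprn_even_ge0.
rewrite time_le2//; case: (leP (t / m ^+ 2) 2) => x2.
  by have := chi01 x0; rewrite /= ler_norml; lra.
by case: hchi => _ _ _ ->; rewrite ?subrr ?normr0// ltW.
Qed.

(** Near scale 0 the weights may blow up like the inverse of the scale, but on a
    set of times of length [O(m^2)]. *)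
Lemma ctime_le e : exists2 C, 0 <= C & forall m t, m != 0 -> `|m| <= 1 -> 0 <= t ->
  `|ctime e m t| <= C / `|m| * (t <= 2 * m ^+ 2)%R%:R.
Proof.
case: e.
  exists 1 => // m t m0 m1 t0; apply: le_trans (ctime_EI_le _ t0) _.
  by rewrite ler_wpM2r// mul1r invf_ge1// normr_gt0.
have /compact_bounded [M [_ HM]] : compact (derive1 chi @` `[0, 2]).
  apply: continuous_compact (@segment_compact R 0 2).
  by apply: continuous_subspaceT; exact: cdchi.
pose C := `|M| + 1; have C0 : 0 <= C by rewrite addr_ge0.
have HC x : 0 <= x <= 2 -> `|derive1 chi x| <= C.
  move=> x02; apply: (HM C); first by rewrite (le_lt_trans (ler_norm M))// ltrDl.
  by exists x => //=; rewrite in_itv.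
exists (4 * C) => [|m t m0 m1 t0]; first by rewrite mulr_ge0.
rewrite /ctime (negbTE m0) time_le2//.
have x0 : 0 <= t / m ^+ 2 by rewrite divr_ge0// exprn_even_ge0.
have -> : 2 * t / m ^+ 3 = 2 * (t / m ^+ 2) * m^-1 by field.
move: (t / m ^+ 2) x0 => q x0; case: (leP q 2) => x2; rewrite /= ?mulr1 ?mulr0; last first.
  rewrite (_ : derive1 chi _ = 0) ?mulr0 ?normr0//.
  rewrite derive1E (@near_eq_derive _ _ _ chi (fun=> 1 : R)); last first.
    case: hchi => _ _ _ c2; apply: filterS (lt_nbhsr x2) => y y2.
    by rewrite c2// ltW.
  by have := is_derive_cst_fun (V := R) 1 q 1 => -[].
rewrite !normrM normfV (ger0_norm x0) [`|2|]ger0_norm//.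
rewrite [leLHS]mulrAC ler_wpM2r ?invr_ge0//.
have hq : `|derive1 chi q| <= C by apply: HC; rewrite x0.
have -> : 4 * C = 2 * 2 * C by lra.
by rewrite ler_pM// ?mulr_ge0// ler_pM2l.
Qed.

End TimeWeights.

(** * Families of smooth functions indexed by a scale *)

Section Families.
Variables (R : realType) (d : nat).
Notation st := (spacetime R d).
Notation "'e_ i" := (delta_mx ord0 i : st) (at level 8, i at level 2, format "''e_' i").

(** The first argument is the scale. *)
Definition scale_family := R -> st -> R.
Implicit Types A B : scale_family.

Definition jcont A := continuous (fun p : R * st => A p.1 p.2).

Definition fpd i A : scale_family := fun m => pd i (A m).

(** Regularity up to order [n] in space-time. The recursion is on the order
    because the derivatives of a product are sums of products: the closure
    properties are proved order by order. *)
Fixpoint reg n A : Prop :=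
  jcont A /\
  if n is n'.+1 then
    forall i, (forall m z, derivable (A m) z 'e_i) /\ reg n' (fpd i A)
  else True.

(** Differentiation in the scale commutes with the first [n] derivatives in
    space-time. *)
Fixpoint dreg n A B : Prop :=
  (forall (m : R) (z : st), is_derive m 1 (A^~ z) (B m z)) /\
  if n is n'.+1 then forall i, dreg n' (fpd i A) (fpd i B) else True.

Definition smooth A := forall n, reg n A.

(** Stable under products, derivatives and convolutions, which mere
    differentiability in the scale would not be: the derivative of a
    convolution is evaluated on space-time derivatives of its argument. *)
Definition smooth_deriv A B := [/\ smooth A, smooth B & forall n, dreg n A B].

Lemma jcont_slice A m : jcont A -> continuous (A m).
Proof.
move=> cA z; apply: (@continuous_pair_comp _ _ _ _ (fun=> m) id
  (fun p : R * st => A p.1 p.2)); [exact: cst_continuous|exact: cvg_id|exact: cA].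
Qed.

Lemma regW n A : reg n.+1 A -> reg n A.
Proof.
elim: n A => [|n IH] A [cA dA]; split => // i.
by have [h1 h2] := dA i; split => //; exact: IH.
Qed.

Lemma dregW n A B : dreg n.+1 A B -> dreg n A B.
Proof. by elim: n A B => [|n IH] A B [cA dA]; split => // i; exact/IH/dA. Qed.

Lemma smooth_jcont A : smooth A -> jcont A.
Proof. by move=> /(_ 0%N) []. Qed.

Lemma smooth_derivable A i m z : smooth A -> derivable (A m) z 'e_i.
Proof. by move=> /(_ 1%N) [_ /(_ i)[]]. Qed.

Lemma smooth_fpd A i : smooth A -> smooth (fpd i A).
Proof. by move=> sA n; have [_ /(_ i)[]] := sA n.+1. Qed.

Lemma is_derive_pd A i m z : derivable (A m) z 'e_i ->
  is_derive z 'e_i (A m) (pd i (A m) z).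
Proof. exact: derivableP. Qed.

Lemma reg_cst n (c : R) : reg n (fun _ _ => c).
Proof.
elim: n c => [|n IH] c /=; split => //; try exact: cst_continuous.
move=> i; split; first by move=> m z; have [] := is_derive_cst_fun c z ('e_i).
rewrite (_ : fpd i _ = fun _ _ => 0); first exact: IH.
apply/funext => m; apply/funext => z.
by have [_] := is_derive_cst_fun c z ('e_i).
Qed.

Lemma regD n A B : reg n A -> reg n B -> reg n (fun m z => A m z + B m z).
Proof.
elim: n A B => [|n IH] A B [cA dA] [cB dB].
  by split=> // p; apply: continuous_forD; [exact: cA|exact: cB].
split; first by move=> p; apply: continuous_forD; [exact: cA|exact: cB].
move=> i; have [dA1 dA2] := dA i; have [dB1 dB2] := dB i.
have dAB m z := is_deriveD_fun (is_derive_pd (dA1 m z)) (is_derive_pd (dB1 m z)).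
split; first by move=> m z; case: (dAB m z).
rewrite (_ : fpd i _ = fun m z => fpd i A m z + fpd i B m z); first exact: IH.
by apply/funext => m; apply/funext => z; case: (dAB m z).
Qed.

Lemma regM n A B : reg n A -> reg n B -> reg n (fun m z => A m z * B m z).
Proof.
elim: n A B => [|n IH] A B /[dup] rA [cA dA] /[dup] rB [cB dB].
  by split=> // p; apply: continuous_forM; [exact: cA|exact: cB].
split; first by move=> p; apply: continuous_forM; [exact: cA|exact: cB].
move=> i; have [dA1 dA2] := dA i; have [dB1 dB2] := dB i.
have dAB m z := is_deriveM_fun (is_derive_pd (dA1 m z)) (is_derive_pd (dB1 m z)).
split; first by move=> m z; case: (dAB m z).
rewrite (_ : fpd i _ = fun m z => fpd i A m z * B m z + A m z * fpd i B m z).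
  by apply: regD; apply: IH => //; exact: regW.
by apply/funext => m; apply/funext => z; case: (dAB m z).
Qed.

Lemma reg_eq n A B : (forall m z, A m z = B m z) -> reg n A -> reg n B.
Proof. by move=> AB; suff -> : A = B by []; apply/funext => m; apply/funext. Qed.

Lemma dregD n A A' B B' : reg n A -> reg n A' -> reg n B -> reg n B' ->
  dreg n A A' -> dreg n B B' ->
  dreg n (fun m z => A m z + B m z) (fun m z => A' m z + B' m z).
Proof.
elim: n A A' B B' => [|n IH] A A' B B' [_ rA] [_ rA'] [_ rB] [_ rB'] [dA nA] [dB nB].
  by split=> // m z; apply: is_deriveD_fun.
split=> [m z|i]; first exact: is_deriveD_fun.
have [dA1 rA1] := rA i; have [dA'1 rA'1] := rA' i.
have [dB1 rB1] := rB i; have [dB'1 rB'1] := rB' i.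
have E1 (C D : scale_family) : (forall m z, derivable (C m) z 'e_i) ->
    (forall m z, derivable (D m) z 'e_i) ->
    fpd i (fun m z => C m z + D m z) = fun m z => fpd i C m z + fpd i D m z.
  move=> dC dD; apply/funext => m; apply/funext => z.
  by case: (is_deriveD_fun (is_derive_pd (dC m z)) (is_derive_pd (dD m z))).
by rewrite !E1//; apply: IH => //; [exact: nA|exact: nB].
Qed.

Lemma dregM n A A' B B' : reg n A -> reg n A' -> reg n B -> reg n B' ->
  dreg n A A' -> dreg n B B' ->
  dreg n (fun m z => A m z * B m z) (fun m z => A' m z * B m z + A m z * B' m z).
Proof.
elim: n A A' B B' => [|n IH] A A' B B' /[dup] RA [_ rA] /[dup] RA' [_ rA']
    /[dup] RB [_ rB] /[dup] RB' [_ rB'] [dA nA] [dB nB].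
  by split=> // m z; apply: is_deriveM_fun.
split=> [m z|i]; first exact: is_deriveM_fun.
have [dA1 rA1] := rA i; have [dA'1 rA'1] := rA' i.
have [dB1 rB1] := rB i; have [dB'1 rB'1] := rB' i.
have EM (C D : scale_family) : (forall m z, derivable (C m) z 'e_i) ->
    (forall m z, derivable (D m) z 'e_i) ->
    forall (m : R) (z : st), is_derive z 'e_i (fun z => C m z * D m z)
        (fpd i C m z * D m z + C m z * fpd i D m z).
  by move=> dC dD m z; exact: (is_deriveM_fun (is_derive_pd (dC m z))
      (is_derive_pd (dD m z))).
rewrite (_ : fpd i _ = fun m z => fpd i A m z * B m z + A m z * fpd i B m z); last first.
  by apply/funext => m; apply/funext => z; case: (EM A B dA1 dB1 m z).
rewrite (_ : fpd i (fun m z => A' m z * B m z + A m z * B' m z) =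
  fun m z => (fpd i A' m z * B m z + fpd i A m z * B' m z) +
             (A' m z * fpd i B m z + A m z * fpd i B' m z)); last first.
  apply/funext => m; apply/funext => z.
  case: (is_deriveD_fun (EM A' B dA'1 dB1 m z) (EM A B' dA1 dB'1 m z)) => _ h.
  by rewrite [LHS]h; ring.
have [wA wA' wB wB'] := And4 (regW RA) (regW RA') (regW RB) (regW RB').
apply: dregD.
- exact: regM.
- by apply: regD; exact: regM.
- exact: regM.
- by apply: regD; exact: regM.
- by apply: IH => //; [exact: nA|apply: dregW; split].
- by apply: IH => //; [apply: dregW; split|exact: nB].
Qed.

Lemma smooth_deriv_eq A A' B B' : (forall m z, A m z = B m z) ->
  (forall m z, A' m z = B' m z) -> smooth_deriv A A' -> smooth_deriv B B'.
Proof.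
by move=> AB AB'; suff [-> ->] : A = B /\ A' = B' by []; split;
  apply/funext => m; apply/funext.
Qed.

Lemma smooth_cst c : smooth (fun _ _ => c).
Proof. by move=> n; exact: reg_cst. Qed.

Lemma smoothD A B : smooth A -> smooth B -> smooth (fun m z => A m z + B m z).
Proof. by move=> sA sB n; exact: regD. Qed.

Lemma smoothM A B : smooth A -> smooth B -> smooth (fun m z => A m z * B m z).
Proof. by move=> sA sB n; exact: regM. Qed.

Lemma smooth_eq A B : (forall m z, A m z = B m z) -> smooth A -> smooth B.
Proof. by move=> AB sA n; exact: reg_eq (sA n). Qed.

Lemma smooth_sum (I : Type) (r : seq I) (F : I -> scale_family) :
  (forall i, smooth (F i)) -> smooth (fun m z => \sum_(i <- r) F i m z).
Proof.
move=> sF; elim: r => [|i r IH].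
  by apply: smooth_eq (smooth_cst 0) => m z; rewrite big_nil.
by apply: smooth_eq (smoothD (sF i) IH) => m z; rewrite big_cons.
Qed.

Lemma smooth_derivD A A' B B' : smooth_deriv A A' -> smooth_deriv B B' ->
  smooth_deriv (fun m z => A m z + B m z) (fun m z => A' m z + B' m z).
Proof.
move=> [sA sA' dA] [sB sB' dB]; split; [exact: smoothD..|].
by move=> n; exact: dregD.
Qed.

Lemma smooth_derivM A A' B B' : smooth_deriv A A' -> smooth_deriv B B' ->
  smooth_deriv (fun m z => A m z * B m z)
    (fun m z => A' m z * B m z + A m z * B' m z).
Proof.
move=> [sA sA' dA] [sB sB' dB].
by split; [exact: smoothM|apply: smoothD; exact: smoothM|move=> n; exact: dregM].
Qed.

(** The coefficients of the expansion and the noise do not depend on the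
    scale. *)
Lemma smooth_deriv_static (F : st -> R) :
  smooth (fun=> F) -> smooth_deriv (fun=> F) (fun _ _ => 0).
Proof.
move=> sF; split => //; first exact: smooth_cst.
move=> n; elim: n F sF => [|n IH] F sF; split => //;
  try by move=> m z; exact: is_derive_cst_fun.
move=> i; rewrite (_ : fpd i (fun _ _ => 0) = fun _ _ => 0).
  by apply: IH; exact: (@smooth_fpd (fun=> F) i sF).
apply/funext => m; apply/funext => z.
by have [_] := is_derive_cst_fun 0 z ('e_i).
Qed.

Lemma smooth_deriv_cst c : smooth_deriv (fun _ _ => c) (fun _ _ => 0).
Proof. by apply: smooth_deriv_static; exact: smooth_cst. Qed.

Lemma smooth_deriv_fpd A A' i : smooth_deriv A A' -> smooth_deriv (fpd i A) (fpd i A').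
Proof.
move=> [sA sA' dA]; split; [exact: smooth_fpd..|].
by move=> n; have [_ /(_ i)] := dA n.+1.
Qed.

Definition fpdk a A : scale_family := fun m => pdk a (A m).

Lemma fpdk_ind (P : scale_family -> Prop) a A :
  (forall B i, P B -> P (fpd i B)) -> P A -> P (fpdk a A).
Proof.
move=> Ppd PA; rewrite /fpdk /pdk.
elim: (enum _) => [//|i s IH] /=.
elim: (a i) => [//|n IHn]; exact: Ppd IHn.
Qed.

Lemma smooth_fpdk a A : smooth A -> smooth (fpdk a A).
Proof. by apply: fpdk_ind => B i; exact: smooth_fpd. Qed.

Lemma smooth_deriv_fpdk a A A' : smooth_deriv A A' -> smooth_deriv (fpdk a A) (fpdk a A').
Proof.
move=> dA; rewrite /fpdk /pdk; elim: (enum _) => [//|i s IH] /=.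
elim: (a i) => [//|n IHn]; exact: smooth_deriv_fpd IHn.
Qed.

End Families.

(** * Convolution with the kernel of an edge *)

Section EdgeConvolution.
Variables (R : realType) (d : nat) (chi : R -> R).
Hypothesis hchi : is_cutoff chi.
Notation st := (spacetime R d).
Notation "'e_ i" := (delta_mx ord0 i : st) (at level 8, i at level 2, format "''e_' i").
Implicit Types A B : scale_family R d.

(** Reduces directional derivatives to derivatives of functions of one real
    variable. *)
Lemma is_derive_line (F : st -> R) (z v : st) (l : R) :
  is_derive z v F l <-> is_derive (0 : R) 1 (fun r : R => F (r *: v + z)) l.
Proof.
suff E : (fun h : R => h^-1 *: ((F \o shift z) (h *: v) - F z)) =
  (fun h : R => h^-1 *: (((fun r : R => F (r *: v + z)) \o shift 0)
      (h *: 1) - F (0 *: v + z))).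
  split=> -[h1 h2]; split; move: h1 h2; rewrite /derivable /derive -?E// E => h1 h2.
by apply/funext => h /=; rewrite addr0 scale0r add0r [_ *: 1]mulr1.
Qed.

Lemma pd_reflect (F : st -> R) i (z w : st) : derivable F (z - w) 'e_i ->
  is_derive w 'e_i (fun w => F (z - w)) (- pd i F (z - w)).
Proof.
move=> dF; apply/is_derive_line.
have /is_derive_line dF' := derivableP dF.
have dN : is_derive (0 : R) 1 (fun r : R => - r) (-1).
  have dZ := is_deriveZ_fun (-1) (is_derive_id (0 : R) (1 : R)).
  rewrite mulr1 in dZ; apply: eq_is_derive dZ => r; exact: mulN1r.
have := @is_derive1_comp _ (fun r : R => F (r *: 'e_i + (z - w))) (fun r => - r) 0 _ (-1).
rewrite oppr0 => /(_ _ dF' dN); rewrite mulrN1 => dc.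
by apply: eq_is_derive dc => r /=; rewrite scaleNr opprD addrCA.
Qed.

(** The sign cancels the one in the definition of [dconv]. *)
Lemma pdk_reflect A m a (z w : st) : smooth A ->
  pdk a (fun w => A m (z - w)) w = (-1) ^+ mi_len a * fpdk a A m (z - w).
Proof.
move=> sA; rewrite /fpdk /pdk.
have -> : mi_len a = (\sum_(i <- enum 'I_d.+1) a i)%N.
  by rewrite /mi_len enumT.
suff [_ ->] : smooth (fun m => foldr (fun i H => iter (a i) (pd i) H) (A m)
    (enum 'I_d.+1)) /\
  foldr (fun i H => iter (a i) (pd i) H) (fun w => A m (z - w)) (enum 'I_d.+1) =
  fun w => (-1) ^+ (\sum_(i <- enum 'I_d.+1) a i)%N *
    foldr (fun i H => iter (a i) (pd i) H) (A m) (enum 'I_d.+1) (z - w) by [].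
elim: (enum _) => [|i s [sIH IH]] /=.
  by split=> //; apply/funext => w'; rewrite big_nil expr0 mul1r.
rewrite big_cons {}IH; move: (\sum_(_ <- _) _)%N => k.
elim: (a i) => [//|n [sn IHn]] /=; split; first exact: smooth_fpd sn.
apply/funext => w'; rewrite IHn addSn exprS mulN1r mulNr.
have dH := @smooth_derivable R d _ i m (z - w') sn.
have [_ h] := is_deriveZ_fun ((-1) ^+ (n + k)) (pd_reflect dH).
by rewrite [LHS]h mulrN.
Qed.

Lemma edge_kernelE e m (w : st) :
  edge_kernel chi e m w = ctime chi e m (w ord0 ord0) * Green w.
Proof.
case: e => /=; rewrite /ctime.
  rewrite /Green_mu; case: ifP => _; first by rewrite subrr mul0r.
  by rewrite mulrBl mul1r.
set t := w ord0 ord0.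
have [t0|t0] := lerP t 0.
  rewrite Green_nonpos// mulr0 /Green_dot.
  rewrite (_ : (fun m => _) = cst 0); first by rewrite derive1_cst oppr0.
  by apply/funext => m'; rewrite /Green_mu Green_nonpos// mulr0; case: ifP.
rewrite /Green_dot derive1E; case: eqVneq => [->|m0].
  rewrite mul0r; apply/eqP; rewrite oppr_eq0; apply/eqP.
  rewrite (@near_eq_derive _ _ _ _ (fun=> Green w)).
    by have [_] := is_derive_cst_fun (Green w) (0 : R) 1.
  (* At scale 0 and time t > 0: the cut-off is 1 for all m with 2 m^2 <= t. *)
  have ts : 0 < Num.sqrt (t / 2) by rewrite sqrtr_gt0 divr_gt0.
  exists (Num.sqrt (t / 2)) => // m'; rewrite /= sub0r normrN => m't.
  rewrite /Green_mu; case: eqVneq => // m'0.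
  have [_ _ _ ->] := hchi; first by rewrite mul1r.
  rewrite ler_pdivlMr ?exprn_even_gt0// -ler_pdivlMl// mulrC.
  rewrite -[leRHS]sqr_sqrtr ?divr_ge0 ?(ltW t0)// -real_normK ?num_real//.
  by rewrite ler_pXn2r ?nnegrE// ltW.
(* Away from scale 0, [Green_mu] is G - ctime EI * G. *)
have d1 := is_deriveZ_fun (- Green w) (ctime_is_derive hchi t m0).
have d2 := is_deriveD_fun (is_derive_cst_fun (Green w) m 1) d1.
have d3 : is_derive m 1 (fun m' => Green_mu chi m' w)
    (0 + - Green w * ctime chi EI' m t).
  apply: near_eq_is_derive d2; apply: filterS (nbhs_neq0 m0) => m' m'0.
  by rewrite /Green_mu /ctime (negbTE m'0); ring.
have [_ ->] := d3.
by rewrite /ctime (negbTE m0); ring.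
Qed.

Lemma reflect_continuous (F : st -> R) (z : st) : continuous F ->
  continuous (fun w : st => F (z - w)).
Proof.
move=> cF w; apply: (@continuous_for_comp _ _ _ (fun w : st => z - w) F); last exact: cF.
by apply: (@continuousB _ _ _ (fun=> z)); [exact: cst_continuous|exact: cvg_id].
Qed.

Lemma weighted_continuous e m (F : st -> R) (z : st) : continuous F ->
  continuous (fun w : st => ctime chi e m (w ord0 ord0) * F (z - w)).
Proof.
move=> cF w.
have c1 : {for w, continuous (fun w : st => ctime chi e m (w ord0 ord0))}.
  apply: (@continuous_for_comp _ _ _ (fun w : st => w ord0 ord0) (ctime chi e m)).
    exact: coord_continuous.
  exact: ctime_slice_continuous.
exact: (continuous_forM c1 (@reflect_continuous F z cF w)).
Qed.

(** The convolution without the derivative [d^a], which by [dconvE] may be put on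
    the function. *)
Definition edge_conv e A : scale_family R d := fun m z =>
  heat (fun w : st => ctime chi e m (w ord0 ord0) * A m (z - w)).

Lemma dconvE e a A m z : smooth A ->
  dconv a (edge_kernel chi e m) (A m) z = edge_conv e (fpdk a A) m z.
Proof.
move=> sA; rewrite /dconv /edge_conv /heat.
set c := (-1) ^+ _.
rewrite (_ : (fun w => edge_kernel chi e m w * pdk a (fun w' => A m (z - w')) w) =
  (fun w => Green w * (c * (ctime chi e m (w ord0 ord0) * fpdk a A m (z - w))))).
  rewrite -/(heat _) heatZ; first by rewrite mulrA -exprD addnn -signr_odd odd_double mul1r.
  exact: weighted_continuous (jcont_slice (smooth_jcont (smooth_fpdk a sA))).
by apply/funext => w; rewrite edge_kernelE pdk_reflect// -/c; ring.
Qed.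

Lemma weighted_jcont e A m0 (z0 w : st) : m0 != 0 -> jcont A ->
  {for ((m0, z0), w), continuous (fun p : (R * st) * st =>
     ctime chi e p.1.1 (p.2 ord0 ord0) * A p.1.1 (p.1.2 - p.2))}.
Proof.
move=> m00 cA; set P := ((m0, z0), w).
have cs : {for P, continuous (fun p : (R * st) * st => p.2)} by exact: continuous_snd.
have cf : {for P, continuous (fun p : (R * st) * st => p.1)} by exact: continuous_fst.
have cm : {for P, continuous (fun p : (R * st) * st => p.1.1)}.
  by apply: (continuous_for_comp cf); exact: continuous_fst.
have cz : {for P, continuous (fun p : (R * st) * st => p.1.2)}.
  by apply: (continuous_for_comp cf); exact: continuous_snd.
have ct : {for P, continuous (fun p : (R * st) * st => p.2 ord0 ord0)}.
  by apply: (continuous_for_comp (g := fun w : st => w ord0 ord0) cs);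
      exact: coord_continuous.
have cd : {for P, continuous (fun p : (R * st) * st => p.1.2 - p.2)}.
  exact: (continuousB cz cs).
have c1 := continuous_pair_comp cm ct (@ctime_continuous _ _ hchi e m0 (w ord0 ord0) m00).
have c2 := continuous_pair_comp cm cd (@cA (m0, z0 - w)).
exact: (continuous_forM c1 c2).
Qed.

(** The weight restricts the integral to times at most [2 m^2]. *)
Lemma edge_conv_le e A m z C M : jcont A -> 0 <= C -> 0 <= M ->
  (forall t, 0 <= t -> `|ctime chi e m t| <= C * (t <= 2 * m ^+ 2)%R%:R) ->
  (forall w, box w -> `|A m (z - w)| <= M) ->
  `|edge_conv e A m z| <= 30 ^+ d * (C * M) * (2 * m ^+ 2).
Proof.
move=> cA C0 M0 hC hM; apply: heat_le.
- exact: weighted_continuous (jcont_slice cA).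
- exact: mulr_ge0.
- by rewrite mulr_ge0// exprn_even_ge0.
move=> w wb; rewrite normrM mulrAC ler_pM//; last exact: hM.
by apply: hC; have /andP[] := wb ord0.
Qed.

Lemma edge_conv0 e A z : edge_conv e A 0 z = 0.
Proof.
rewrite /edge_conv (_ : (fun w => _) = fun w : st => 0 * (fun=> 0) w); last first.
  by apply/funext => w; rewrite ctime0 !mul0r.
by rewrite heatZ ?mul0r//; exact: cst_continuous.
Qed.

Lemma jcont_locally_bounded A (p0 : R * st) : jcont A ->
  exists2 M, 0 <= M & \forall p \near p0, forall w, box w -> `|A p.1 (p.2 - w)| <= M.
Proof.
move=> cA.
have cj w : box w -> {for (p0, w), continuous (fun p : (R * st) * st =>
    A p.1.1 (p.1.2 - p.2))}.
  move=> _; set P := (p0, w).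
  have cs : {for P, continuous (fun p : (R * st) * st => p.2)} by exact: continuous_snd.
  have cf : {for P, continuous (fun p : (R * st) * st => p.1)} by exact: continuous_fst.
  have cm : {for P, continuous (fun p : (R * st) * st => p.1.1)}.
    by apply: (continuous_for_comp cf); exact: continuous_fst.
  have cz : {for P, continuous (fun p : (R * st) * st => p.1.2)}.
    by apply: (continuous_for_comp cf); exact: continuous_snd.
  have cd : {for P, continuous (fun p : (R * st) * st => p.1.2 - p.2)}.
    exact: (continuousB cz cs).
  exact: (continuous_pair_comp cm cd (@cA (p0.1, p0.2 - w))).
have cA0 : continuous (fun w : st => A p0.1 (p0.2 - w)).
  exact: reflect_continuous (jcont_slice cA).
have [M M0 hM] := box_bounded cA0.
exists (M + 1); first by rewrite addr_ge0.
have := compact_uniform_close (h := fun (p : R * st) (w : st) => A p.1 (p.2 - w))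
  (@box_compact R d) cj ltr01.
apply: filterS => p hp w wb.
rewrite -[A p.1 _](subrK (A p0.1 (p0.2 - w))) addrC.
by rewrite (le_trans (ler_normD _ _))// lerD ?hM// distrC; exact: hp.
Qed.

(** For nonzero scales the weight is jointly continuous; at scale 0 it is not,
    and the value is small instead. *)
Lemma edge_conv_jcont e A : jcont A -> jcont (edge_conv e A).
Proof.
move=> cA [m0 z0]; have [->{m0}|m00] := eqVneq m0 0; last first.
  apply: (@heat_continuous_param _ _ _ (fun (p : R * st) (w : st) =>
    ctime chi e p.1 (w ord0 ord0) * A p.1 (p.2 - w)) (m0, z0)).
    by move=> p; exact: weighted_continuous (jcont_slice cA).
  by move=> w _; exact: weighted_jcont.
(* At scale 0 the weight is not continuous, but the value is O(m). *)
have [M M0 hM] := jcont_locally_bounded (0, z0) cA.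
have [C C0 hC] := ctime_le hchi e.
apply/continuous_forP => eps eps0 /=; rewrite edge_conv0.
pose K := 30 ^+ d * (C * M) * 2; have K0 : 0 <= K by rewrite !mulr_ge0.
have near1 : \forall p \near ((0 : R), z0), `|p.1| <= 1 /\ K * `|p.1| <= eps.
  have c1 : {for ((0 : R), z0), continuous (fun p : R * st =>
      p.1)} by exact: continuous_fst.
  move/continuous_forP : c1 => c1.
  have K1 : 0 < eps / (K + 1) by rewrite divr_gt0// ltr_wpDl.
  apply: filterS2 (c1 _ ltr01) (c1 _ K1) => p /=; rewrite sub0r normrN => h1 h2;
      split => //.
  apply: le_trans (_ : (K + 1) * `|p.1| <= _); first by rewrite ler_wpM2r// lerDl.
  by rewrite mulrC -ler_pdivlMr// ltr_wpDl.
apply: filterS2 hM near1 => -[m z] /= hM [m1 mK].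
rewrite sub0r normrN; have [->|m0] := eqVneq m 0; first by rewrite edge_conv0 normr0 ltW.
have := edge_conv_le cA (divr_ge0 C0 (normr_ge0 m)) M0 (fun t => hC m t m0 m1) hM.
move/le_trans; apply; apply: le_trans mK.
rewrite le_eqVlt; apply/orP; left; apply/eqP.
rewrite /K -(real_normK (num_real m)); field.
by rewrite normr_eq0.
Qed.

Lemma edge_conv_pd e A i m z : (forall z, derivable (A m) z 'e_i) ->
  jcont A -> jcont (fpd i A) ->
  is_derive z 'e_i (edge_conv e A m) (edge_conv e (fpd i A) m z).
Proof.
move=> dA cA cpA; apply/is_derive_line.
have E : (0 : R) *: 'e_i + z = z by rewrite scale0r add0r.
rewrite -{2}E.
apply: (@heat_is_derive _ _ (fun (r : R) (w : st) =>
    ctime chi e m (w ord0 ord0) * A m (r *: 'e_i + z - w))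
  (fun (r : R) (w : st) => ctime chi e m (w ord0 ord0) * fpd i A m (r *: 'e_i + z - w))).
- by move=> r; exact: weighted_continuous (jcont_slice cA).
- exact: weighted_continuous (jcont_slice cpA).
- move=> w _; pose P : R * st := (0, w); rewrite -[(0, w)]/P.
  have cs : {for P, continuous (fun p : R * st => p.2)} by exact: continuous_snd.
  have cr : {for P, continuous (fun p : R * st => p.1)} by exact: continuous_fst.
  have cl : {for P, continuous (fun p : R * st => p.1 *: 'e_i + z - p.2)}.
    have h1 := @cvgZr_tmp _ _ _ (nbhs P) (nbhs_filter P) (fun p : R * st =>
        p.1) P.1 ('e_i) cr.
    have h2 := @cvgD _ _ _ (nbhs P) (nbhs_filter P) _ _ _ _ h1 (@cst_continuous _ _ z P).
    exact: (@cvgB _ _ _ (nbhs P) (nbhs_filter P) _ _ _ _ h2 cs).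
  have c2 := continuous_for_comp cl (@jcont_slice _ _ _ m cpA _).
  have ct : {for P, continuous (fun p : R * st => p.2 ord0 ord0)}.
    by apply: (continuous_for_comp (g := fun w : st => w ord0 ord0) cs);
        exact: coord_continuous.
  have c1 := continuous_for_comp ct (@ctime_slice_continuous _ _ hchi e m _).
  exact: (continuous_forM c1 c2).
- apply: (@nearW _ (nbhs (0 : R))) => r w _; apply: is_deriveZ_fun.
  have /is_derive_line dA' := derivableP (dA (r *: 'e_i + z - w)).
  have dS : is_derive r 1 (fun r' : R => r' - r) 1.
    have := is_deriveD_fun (is_derive_id r (1 : R)) (is_derive_cst_fun (- r) r (1 : R)).
    by rewrite addr0.
  have := @is_derive1_comp _ (fun r' : R => A m (r' *: 'e_i + (r *: 'e_i + z - w)))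
    (fun r' => r' - r) r _ 1.
  rewrite subrr => /(_ _ dA' dS); rewrite mulr1 => dc.
  apply: eq_is_derive dc => r' /=; congr (A m _).
  by rewrite scalerBl !addrA subrK.
Qed.

Lemma edge_conv_reg n e A : reg n A -> reg n (edge_conv e A).
Proof.
elim: n A => [|n IH] A /[dup] rA [cA dA]; split=> //; try exact: edge_conv_jcont.
move=> i; have [dAi rAi] := dA i.
have cpA : jcont (fpd i A) by case: n rAi {IH dA rA} => [|n] [].
have dh (m : R) (z : st) := @edge_conv_pd e A i m z (dAi m) cA cpA.
split; first by move=> m z; case: (dh m z).
apply: reg_eq (IH _ rAi) => m z; by case: (dh m z).
Qed.

(** For nonzero scales this is the product rule under the integral; at scale 0
    all the terms on the right vanish. *)
Lemma edge_conv_is_derive A A' (m : R) (z : st) : jcont A -> jcont A' ->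
  (forall (m : R) (z : st), is_derive m 1 (A^~ z) (A' m z)) ->
  is_derive m 1 (fun m => edge_conv EI A m z) (edge_conv EI' A m z + edge_conv EI A' m z).
Proof.
move=> cA cA' dA; have [->{m}|m0] := eqVneq m 0.
  rewrite !edge_conv0 addr0; apply: is_derive_increment => eps eps0.
  (* At scale 0 the value is O(s^2), which is at most eps * |s| for small s. *)
  have [M M0 hM] := jcont_locally_bounded (0, z) cA.
  pose K := 30 ^+ d * 1 * M * 2; have K0 : 0 <= K by rewrite !mulr_ge0.
  have K1 : 0 < eps / (K + 1) by rewrite divr_gt0// ltr_wpDl.
  have hM0 : nbhs (0 : R) (fun s : R => forall w, box w -> `|A s (z - w)| <= M).
    have c0 : {for (0 : R), continuous (fun s : R => (s, z))}.
      exact: (cvg_pair (@cvg_id _ (nbhs (0 : R))) (@cst_continuous _ _ z (0 : R))).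
    exact: (c0 _ hM).
  have sm : nbhs (0 : R) (fun s : R => `|s| <= eps / (K + 1)).
    have /continuous_forP /(_ _ K1) := @cvg_id _ (nbhs (0 : R)).
    by apply: filterS => s; rewrite sub0r normrN.
  apply: filterS2 hM0 sm => s hs ss.
  rewrite addr0 edge_conv0 subr0 mulr0 subr0.
  apply: le_trans (edge_conv_le cA ler01 M0 (ctime_EI_le hchi s) hs) _.
  rewrite -(real_normK (num_real s)) expr2 !mulrA -/K ler_wpM2r//.
  apply: (@le_trans _ _ ((K + 1) * `|s|)); first by rewrite ler_wpM2r// lerDl.
  by rewrite mulrC -ler_pdivlMr// ltr_wpDl.
have cw e B (m' : R) : jcont B -> continuous (fun w : st =>
    ctime chi e m' (w ord0 ord0) * B m' (z - w)).
  by move=> cB; exact: weighted_continuous (jcont_slice cB).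
rewrite /edge_conv -heatD; [|exact: cw..].
apply: (@heat_is_derive _ _ (fun (m : R) (w : st) =>
    ctime chi EI m (w ord0 ord0) * A m (z - w))
  (fun (m : R) (w : st) => ctime chi EI' m (w ord0 ord0) * A m (z - w) +
              ctime chi EI m (w ord0 ord0) * A' m (z - w))).
- by move=> r; exact: cw.
- by move=> w; exact: (continuous_forD (cw EI' A m cA w) (cw EI A' m cA' w)).
- have cj e B w : jcont B -> {for (m, w), continuous (fun p : R * st =>
      ctime chi e p.1 (p.2 ord0 ord0) * B p.1 (z - p.2))}.
    move=> cB; have cf := @continuous_fst R st (m, w).
    have c1 := continuous_pair_comp cf (@cst_continuous _ _ z (m, w))
        (@cvg_id _ (nbhs (m, z))).
    exact: (continuous_pair_comp c1 (@continuous_snd R st (m, w))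
        (@weighted_jcont e B m z w m0 cB)).
  by move=> w _; exact: (continuous_forD (cj EI' A w cA) (cj EI A' w cA')).
- apply: filterS (nbhs_neq0 m0) => r r0 w _.
  exact: (is_deriveM_fun (ctime_is_derive hchi (w ord0 ord0) r0) (dA r (z - w))).
Qed.

Lemma edge_conv_smooth e A : smooth A -> smooth (edge_conv e A).
Proof. by move=> sA n; exact: edge_conv_reg. Qed.

Lemma fpd_edge_conv e A i : smooth A -> fpd i (edge_conv e A) = edge_conv e (fpd i A).
Proof.
move=> sA; apply/funext => m; apply/funext => z.
have dA (z : st) := @smooth_derivable _ _ _ i m z sA.
by case: (@edge_conv_pd e A i m z dA (smooth_jcont sA) (smooth_jcont (smooth_fpd i sA))).
Qed.

(** The product rule for one branch of a tree: the scale is differentiated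
    either in the kernel of the edge or in the function above it. *)
Lemma edge_conv_smooth_deriv A A' : smooth_deriv A A' ->
  smooth_deriv (edge_conv EI A) (fun m z => edge_conv EI' A m z + edge_conv EI A' m z).
Proof.
move=> [sA sA' dA]; split; first exact: edge_conv_smooth.
  by apply: smoothD; exact: edge_conv_smooth.
move=> n; elim: n A A' sA sA' dA => [|n IH] A A' sA sA' dA.
  split=> // m z; apply: edge_conv_is_derive; try exact: smooth_jcont.
  by have [] := dA 0%N.
split=> [m z|i].
  apply: edge_conv_is_derive; try exact: smooth_jcont.
  by have [] := dA 0%N.
rewrite fpd_edge_conv//.
rewrite (_ : fpd i (fun m z => edge_conv EI' A m z + edge_conv EI A' m z) =
  fun m z => edge_conv EI' (fpd i A) m z + edge_conv EI (fpd i A') m z).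
  apply: IH; [exact: smooth_fpd..|].
  by move=> k; have [_ /(_ i)] := dA k.+1.
have E e B m z : smooth B -> is_derive z 'e_i (edge_conv e B m) (edge_conv e (fpd i B) m z).
  move=> sB; apply: edge_conv_pd; try exact: smooth_jcont.
    by move=> z'; exact: smooth_derivable.
  by apply: smooth_jcont; exact: smooth_fpd.
apply/funext => m; apply/funext => z.
by case: (is_deriveD_fun (E EI' A m z sA) (E EI A' m z sA')).
Qed.

End EdgeConvolution.

(** * Smooth functions of jets *)

Section Jets.
Variables (R : realType) (d : nat).
Notation st := (spacetime R d).
Notation "'e_ i" := (delta_mx ord0 i : st) (at level 8, i at level 2, format "''e_' i").
Notation J := {ptws mi d -> R}.
Implicit Types (F G H : jet R d -> R) (Z : jet R d) (a b : mi d).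

Definition depends_on (S : seq (mi d)) H :=
  forall Z Z', (forall a, a \in S -> Z a = Z' a) -> H Z = H Z'.

(** Differentiability up to order [n] of functions of finitely many jet
    variables, again by recursion on the order to deal with products. *)
Fixpoint jreg n H : Prop :=
  [/\ exists S, depends_on S H,
      continuous (H : J -> R) &
      if n is n'.+1 then
        forall a, (forall Z, derivable (fun r => H (jet_upd Z a r)) (Z a) 1) /\
                  jreg n' (jetD a H)
      else True].

Definition jsmooth H := forall n, jreg n H.

Lemma jet_upd_id Z a : jet_upd Z a (Z a) = Z.
Proof. by apply/funext => b; rewrite /jet_upd; case: eqP => // ->. Qed.

Lemma jet_upd_at Z a r : jet_upd Z a r a = r.
Proof. by rewrite /jet_upd eqxx. Qed.

Lemma jet_upd_upd Z a r r' : jet_upd (jet_upd Z a r) a r' = jet_upd Z a r'.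
Proof. by apply/funext => b; rewrite /jet_upd; case: eqP. Qed.

Lemma is_derive_jetD H Z a (r : R) : (forall Z, derivable (fun r =>
    H (jet_upd Z a r)) (Z a) 1) ->
  is_derive r 1 (fun r : R => H (jet_upd Z a r)) (jetD a H (jet_upd Z a r)).
Proof.
move=> /(_ (jet_upd Z a r)); rewrite jet_upd_at => dH.
have E : (fun r' => H (jet_upd (jet_upd Z a r) a r')) = fun r' => H (jet_upd Z a r').
  by apply/funext => r'; rewrite jet_upd_upd.
rewrite E in dH; rewrite /jetD jet_upd_at E derive1E; exact: derivableP.
Qed.

Lemma is_derive_jetD_at H Z a : (forall Z, derivable (fun r => H (jet_upd Z a r))
    (Z a) 1) ->
  is_derive (Z a) 1 (fun r : R => H (jet_upd Z a r)) (jetD a H Z).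
Proof. by move=> dH; have := @is_derive_jetD H Z a (Z a) dH; rewrite jet_upd_id. Qed.

Lemma jetD_eq H a Z l : is_derive (Z a) 1 (fun r : R => H (jet_upd Z a r)) l ->
  jetD a H Z = l.
Proof. by move=> -[_ <-]; rewrite /jetD derive1E. Qed.

(** Needed for the sum over all multi-indices in [jet_del] to be finite. *)
Lemma jetD_notin S H a Z : depends_on S H -> a \notin S -> jetD a H Z = 0.
Proof.
move=> dS aS; apply: jetD_eq; apply: eq_is_derive (is_derive_cst_fun (H Z) (Z a)
    (1 : R)) => r.
by apply: dS => b bS; rewrite /jet_upd; case: eqP => // ba; rewrite -ba bS in aS.
Qed.

Lemma depends_on_jetD S H a : depends_on S H -> depends_on S (jetD a H).
Proof.
move=> dS Z Z' ZZ'; have [aS|aS] := boolP (a \in S); last by rewrite !(jetD_notin _ dS aS).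
suff E : (fun r => H (jet_upd Z a r)) = (fun r => H (jet_upd Z' a r)).
  by rewrite /jetD E ZZ'.
apply/funext => r; by apply: dS => b bS; rewrite /jet_upd; case: eqP => // _; exact: ZZ'.
Qed.

Lemma depends_onW S S' H : {subset S <= S'} -> depends_on S H -> depends_on S' H.
Proof. by move=> SS' dS Z Z' ZZ'; apply: dS => a /SS'; exact: ZZ'. Qed.

Lemma jregW n H : jreg n.+1 H -> jreg n H.
Proof.
elim: n H => [|n IH] H [dS cH dH]; split => // a.
by have [h1 h2] := dH a; split => //; exact: IH.
Qed.

Lemma jreg_cst n (c : R) : jreg n (fun=> c).
Proof.
elim: n c => [|n IH] c /=; split => //; try by [exists [::] | exact: cst_continuous].
move=> a; split=> [Z|]; first by have [] := is_derive_cst_fun c (Z a) (1 : R).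
rewrite (_ : jetD a _ = fun=> 0); first exact: IH.
by apply/funext => Z; apply: jetD_eq; exact: is_derive_cst_fun.
Qed.

Lemma jreg_coord n b : jreg n (fun Z => Z b).
Proof.
have db a Z : is_derive (Z a) 1 (fun r : R => jet_upd Z a r b) (b == a)%:R.
  rewrite /jet_upd; case: (b == a); first exact: is_derive_id.
  exact: is_derive_cst_fun.
case: n => [|n] /=; split => //; try by [exists [:: b] => Z Z'; apply; rewrite mem_head
  | exact: (@proj_continuous _ (fun=> R) b)].
move=> a; split=> [Z|]; first by have [] := db a Z.
rewrite (_ : jetD a _ = fun=> (b == a)%:R); first exact: jreg_cst.
by apply/funext => Z; exact: jetD_eq.
Qed.

Lemma depends_on2 S S' F G (op : R -> R -> R) : depends_on S F -> depends_on S' G ->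
  depends_on (S ++ S') (fun Z => op (F Z) (G Z)).
Proof.
move=> dF dG Z Z' ZZ'; congr op; [apply: dF|apply: dG] => a aS;
  by apply: ZZ'; rewrite mem_cat aS ?orbT.
Qed.

Lemma jregD n F G : jreg n F -> jreg n G -> jreg n (fun Z => F Z + G Z).
Proof.
elim: n F G => [|n IH] F G [[S dF] cF rF] [[S' dG] cG rG].
  split => //; first by exists (S ++ S'); exact: depends_on2.
  by move=> Z; exact: (continuous_forD (cF Z) (cG Z)).
split; first by exists (S ++ S'); exact: depends_on2.
  by move=> Z; exact: (continuous_forD (cF Z) (cG Z)).
move=> a; have [dF1 dF2] := rF a; have [dG1 dG2] := rG a.
have dFG Z := is_deriveD_fun (is_derive_jetD_at Z dF1) (is_derive_jetD_at Z dG1).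
split; first by move=> Z; case: (dFG Z).
rewrite (_ : jetD a _ = fun Z => jetD a F Z + jetD a G Z); first exact: IH.
by apply/funext => Z; exact: jetD_eq.
Qed.

Lemma jregM n F G : jreg n F -> jreg n G -> jreg n (fun Z => F Z * G Z).
Proof.
elim: n F G => [|n IH] F G /[dup] RF [[S dF] cF rF] /[dup] RG [[S' dG] cG rG].
  split => //; first by exists (S ++ S'); exact: depends_on2.
  by move=> Z; exact: (continuous_forM (cF Z) (cG Z)).
split; first by exists (S ++ S'); exact: depends_on2.
  by move=> Z; exact: (continuous_forM (cF Z) (cG Z)).
move=> a; have [dF1 dF2] := rF a; have [dG1 dG2] := rG a.
have dFG Z := is_deriveM_fun (is_derive_jetD_at Z dF1) (is_derive_jetD_at Z dG1).
split.
  by move=> Z; case: (dFG Z).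
rewrite (_ : jetD a _ = fun Z => jetD a F Z * G Z + F Z * jetD a G Z).
  by apply: jregD; apply: IH => //; exact: jregW.
by apply/funext => Z; apply: jetD_eq; have := dFG Z; rewrite !jet_upd_id.
Qed.

Lemma jsmooth_jetD a H : jsmooth H -> jsmooth (jetD a H).
Proof. by move=> sH n; have [_ _ /(_ a)[]] := sH n.+1. Qed.

Lemma jsmooth_sum (I : Type) (r : seq I) (F : I -> jet R d -> R) :
  (forall i, jsmooth (F i)) -> jsmooth (fun Z => \sum_(i <- r) F i Z).
Proof.
move=> sF n; elim: r => [|i r IH].
  rewrite (_ : (fun Z => _) = fun=> 0); first exact: jreg_cst.
  by apply/funext => Z; rewrite big_nil.
rewrite (_ : (fun Z => _) = fun Z => F i Z + \sum_(j <- r) F j Z).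
  by apply: jregD => //; exact: sF.
by apply/funext => Z; rewrite big_cons.
Qed.

Lemma jet_delE S i H : uniq S -> depends_on S H ->
  jet_del i H = fun Z => \sum_(a <- S) Z (a + mi_unit i) * jetD a H Z.
Proof.
move=> uS dS; apply/funext => Z; rewrite /jet_del (@fsbigE _ _ _ _ _ S _ uS) //.
  by apply: eq_bigl => a; rewrite in_setT.
by move=> a _ aS; rewrite (jetD_notin _ dS aS) mulr0.
Qed.

Lemma depends_on_undup S H : depends_on S H -> depends_on (undup S) H.
Proof. by apply: depends_onW => a; rewrite mem_undup. Qed.

Lemma jsmooth_jet_del i H : jsmooth H -> jsmooth (jet_del i H).
Proof.
move=> sH; have [[S dS] _ _] := sH 0%N.
rewrite (jet_delE _ (undup_uniq S) (depends_on_undup dS)).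
apply: jsmooth_sum => a n; apply: jregM; first exact: jreg_coord.
exact: jsmooth_jetD.
Qed.

Lemma jsmooth_jet_delk k H : jsmooth H -> jsmooth (jet_delk k H).
Proof.
move=> sH; rewrite /jet_delk; elim: (enum _) => [//|i s IH] /=.
by elim: (k i) => [//|n IHn] /=; exact: jsmooth_jet_del.
Qed.

Lemma smooth_nonlinearity_jsmooth p F : smooth_nonlinearity p F -> jsmooth F.
Proof.
move=> [dF sF].
have dS : exists S, depends_on S F.
  exists (mi_box d p.+1) => Z Z' ZZ'; apply: dF => a _ ap; apply: ZZ'.
  apply/mapP; exists [ffun i => inord (a i)]; first by rewrite mem_enum.
  apply/ffunP => i; rewrite !ffunE inordK// ltnS (leq_trans _ ap)//.
  by rewrite /mi_len (bigD1 i)//= leq_addr.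
suff H n s : jreg n (foldr (@jetD R d) F s) by move=> n; exact: (H n [::]).
have dSs : exists S, depends_on S (foldr (@jetD R d) F s).
  by elim: s => //= a s [S' dS']; exists S'; exact: depends_on_jetD.
elim: n s dSs => [|n IH] s dSs; split => //; try by case: (sF s).
move=> a; split; first by move=> Z; case: (sF s).
apply: (IH (a :: s)); have [S' dS'] := dSs.
by exists S'; exact: depends_on_jetD.
Qed.

Lemma ptws_continuous (T : topologicalType) (f : T -> jet R d) (x : T) :
  (forall a, {for x, continuous (fun t => f t a)}) ->
  {for x, continuous (f : T -> J)}.
Proof.
move=> cf; pose f' : T -> J := f.
have FF : Filter (f' @ nbhs x) by exact: fmap_filter.
suff : f' @ nbhs x --> f' x by [].
apply/cvg_sup => a U.
have -> := @nbhsE (initial_topology (@proj (mi d) (fun=> R) a)) (f' x).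
case=> B [[C oC <-] Cx] /filterS; apply; apply: (cf a C).
exact: open_nbhs_nbhs.
Qed.

(** An intermediate point between [c 0] and [c r], at which the coordinates in
    [l] have already moved: the chain rule moves one coordinate at a time. *)
Definition partial_curve (c : R -> jet R d) (l : seq (mi d)) (r : R) : jet R d :=
  fun b => if b \in l then c r b else c 0 b.

Lemma partial_curve_cons c a l r : partial_curve c (a :: l) r =
  jet_upd (partial_curve c l r) a (c r a).
Proof.
apply/funext => b; rewrite /partial_curve /jet_upd inE.
by case: eqP => [->|].
Qed.

Lemma is_derive_continuous (F : R -> R) (x l : R) : is_derive x 1 F l ->
  {for x, continuous F}.
Proof. by move=> [dF _]; apply: differentiable_continuous; exact/derivable1_diffP. Qed.

Lemma is_derive_close (F : R -> R) (l : R) : is_derive (0 : R) 1 F l ->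
  nbhs (0 : R) (fun r : R => `|F r - F 0| <= (`|l| + 1) * `|r|).
Proof.
move=> dF; have [dF1 Fl] := dF.
have cv : (fun h : R => h^-1 *: ((F \o shift 0) (h *: 1) - F 0)) @ 0^' --> l.
  by rewrite -Fl; exact: dF1.
move/cvgrPdist_le : cv => /(_ 1 ltr01) Hc.
have {}Hc : nbhs (0 : R) (fun h : R => h != 0 ->
  `|l - h^-1 *: ((F \o shift 0) (h *: 1) - F 0)| <= 1) by exact: Hc.
apply: filterS Hc => h hl.
have [->|h0] := eqVneq h 0; first by rewrite subrr normr0 mulr0.
have := hl h0; rewrite /= addr0 [h *: 1]mulr1 /GRing.scale/= => hl'.
have -> : F h - F 0 = h * (h^-1 * (F h - F 0)) by rewrite mulVKf.
rewrite normrM mulrC ler_wpM2r//.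
rewrite -[h^-1 * _](subrK l) addrC (le_trans (ler_normD _ _))// lerD2l.
by rewrite distrC.
Qed.

(** Each coordinate contributes its partial derivative at [c 0], by the mean
    value theorem and the continuity of the partial derivative. *)
Lemma chain_rule_jet (H : jet R d -> R) (c : R -> jet R d) (dc : mi d -> R) l :
  jreg 1 H -> uniq l -> (forall a, is_derive (0 : R) 1 (fun r => c r a) (dc a)) ->
  is_derive (0 : R) 1 (fun r => H (partial_curve c l r))
    (\sum_(a <- l) jetD a H (c 0) * dc a).
Proof.
move=> [_ _ dH] + dc'; elim: l => [_|a l IH] /=.
  by rewrite big_nil; exact: (is_derive_cst_fun (H (c 0)) (0 : R) (1 : R)).
move=> /andP[al ul]; rewrite big_cons addrC; have dl := IH ul.
have [dHa [_ cHa _]] := dH a.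
pose L := jetD a H (c 0).
(* D is what remains of the increment once its linear part is removed; the mean
   value theorem in the single coordinate [a] shows that it is o(r). *)
pose D r := H (partial_curve c (a :: l) r) - H (partial_curve c l r) - L * (c r a - c 0 a).
have pc0 k : partial_curve c k 0 = c 0.
  by apply/funext => b; rewrite /partial_curve; case: ifP.
have D0 : D 0 = 0 by rewrite /D !pc0 !subrr mulr0 subrr.
suff dD : is_derive (0 : R) 1 D 0.
  have := is_deriveD_fun (is_deriveD_fun dl (is_deriveZ_fun L (dc' a)))
    (is_deriveD_fun dD (is_derive_cst_fun (- (L * c 0 a)) (0 : R) (1 : R))).
  rewrite !addr0 => h; apply: eq_is_derive h => r; rewrite /D; ring.
apply: is_derive_increment => e e0.
pose M := `|dc a| + 1; have M0 : 0 < M by rewrite ltr_wpDl.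
have e' : 0 < e / M by rewrite divr_gt0.
pose g (p : R * R) := jetD a H (jet_upd (partial_curve c l p.1) a p.2).
have cg : {for (0, c 0 a), continuous g}.
  apply: (@continuous_for_comp _ _ _ (fun p : R * R =>
    jet_upd (partial_curve c l p.1) a p.2 : J) (jetD a H : J -> R)); last exact: cHa.
  apply: ptws_continuous => b; rewrite /jet_upd; case: eqP => _.
    exact: continuous_snd.
  rewrite /partial_curve; case: (b \in l); last exact: cst_continuous.
  apply: (@continuous_for_comp _ _ _ (fun p : R * R => p.1) (fun r => c r b)).
    exact: continuous_fst.
  exact: is_derive_continuous (dc' b).
have g0 : g (0, c 0 a) = L.
  rewrite /g /= pc0 /L; congr (jetD a H _); exact: jet_upd_id.
move/continuous_forP : cg => /(_ _ e') [[U V] [/= U0 [dlt /= dlt0 dV]] UV].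
have cca : nbhs (0 : R) (fun r : R => `|c 0 a - c r a| <= dlt / 2).
  have := is_derive_continuous (dc' a); move/continuous_forP; apply.
  by rewrite divr_gt0.
have close := is_derive_close (dc' a).
apply: (filterS _ (filterI U0 (filterI cca close))) => r /= [Ur [cr clr]].
rewrite addr0 D0 subr0 mulr0 subr0.
have -> : D r = (fun x => H (jet_upd (partial_curve c l r) a x)) (c r a - c 0 a + c 0 a)
    - (fun x => H (jet_upd (partial_curve c l r) a x)) (c 0 a) - (c r a - c 0 a) * L.
  rewrite /D partial_curve_cons subrK [L * _]mulrC; congr (_ - H _ - _).
  apply/funext => b; rewrite /jet_upd; case: eqP => // ->.
  by rewrite /partial_curve (negbTE al).
apply: (@le_trans _ _ (e / M * `|c r a - c 0 a|)).
  apply: (@increment_le _ (fun x => H (jet_upd (partial_curve c l r) a x))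
    (fun x => jetD a H (jet_upd (partial_curve c l r) a x)) (c 0 a) (c r a - c 0 a) L).
    by move=> x _; apply: is_derive_jetD.
  move=> x hx; rewrite -g0 distrC.
  apply: (UV (r, x)); split => //=; apply: dV => /=.
  rewrite distrC; apply: le_lt_trans hx _; rewrite distrC; apply: le_lt_trans cr _.
  by rewrite ltr_pdivrMr// ltr_pMr// ltr1n.
apply: le_trans (ler_wpM2l (ltW e') clr) _.
by rewrite mulrA divfK// gt_eqF.
Qed.

Lemma smooth_periodic_smooth (phi : st -> R) : smooth_periodic phi -> smooth (fun=> phi).
Proof.
move=> [_ sphi] n; suff H s : reg n (fun=> foldr (@pd R d) phi s) by exact: (H [::]).
elim: n s => [|n IH] s.
  split=> //; move=> p; have [cs _] := sphi s.
  exact: (continuous_for_comp (@continuous_snd R st p) (cs p.2)).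
split=> [p|i].
  have [cs _] := sphi s.
  exact: (continuous_for_comp (@continuous_snd R st p) (cs p.2)).
split; last exact: (IH (i :: s)).
by move=> m z; have [_] := sphi s; apply.
Qed.

Lemma reg_sum n (I : Type) (r : seq I) (F : I -> scale_family R d) :
  (forall i, reg n (F i)) -> reg n (fun m z => \sum_(i <- r) F i m z).
Proof.
move=> sF; elim: r => [|i r IH].
  by apply: reg_eq (@reg_cst R d n 0) => m z; rewrite big_nil.
by apply: reg_eq (regD (sF i) IH) => m z; rewrite big_cons.
Qed.

(** The index [a] of a jet variable is not merged with the direction [i] on the
    right-hand side, which avoids the symmetry of second derivatives. *)
Lemma pd_jet (H : jet R d -> R) (phi : st -> R) S i (z : st) :
  smooth_periodic phi -> jsmooth H -> uniq S -> depends_on S H ->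
  is_derive z 'e_i (fun z => H (jet_at phi z))
    (\sum_(a <- S) jetD a H (jet_at phi z) * pd i (pdk a phi) z).
Proof.
move=> sphi sH uS dS; apply/is_derive_line.
pose c (r : R) : jet R d := jet_at phi (r *: 'e_i + z).
have c0 : c 0 = jet_at phi z by rewrite /c scale0r add0r.
have dc a : is_derive (0 : R) 1 (fun r => c r a) (pd i (pdk a phi) z).
  apply/(is_derive_line (pdk a phi)).
  have := @smooth_derivable _ _ _ i 0 z (smooth_fpdk a (smooth_periodic_smooth sphi)).
  exact: derivableP.
have := @chain_rule_jet H c _ S (sH 1%N) uS dc; rewrite c0.
apply: eq_is_derive => r; apply: dS => a aS; by rewrite /partial_curve aS.
Qed.

(** By [pd_jet] a derivative of the composition is a sum of products of
    compositions of the same kind and derivatives of [phi]: induction on the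
    order. *)
Lemma smooth_jet (H : jet R d -> R) (phi : st -> R) :
  smooth_periodic phi -> jsmooth H -> smooth (fun _ z => H (jet_at phi z)).
Proof.
move=> sphi sH n.
have sk a : smooth (fun=> pdk a phi) := smooth_fpdk a (smooth_periodic_smooth sphi).
have jc G : jsmooth G -> jcont (fun (_ : R) z => G (jet_at phi z)).
  move=> sG p; have [_ cG _] := sG 0%N.
  apply: (@continuous_for_comp _ _ _ (fun p : R * st => jet_at phi p.2 : J) (G : J -> R));
    last exact: cG.
  apply: ptws_continuous => a.
  exact: (smooth_jcont (sk a)).
elim: n H sH => [|n IH] H sH; split => //; try exact: jc.
have [[S0 /depends_on_undup dS] _ _] := sH 0%N; set S := undup S0 in dS.
have dz i z := pd_jet i z sphi sH (undup_uniq S0) dS.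
move=> i; split; first by move=> m z; case: (dz i z).
apply: (@reg_eq _ _ _ (fun m z =>
    \sum_(a <- S) jetD a H (jet_at phi z) * pd i (pdk a phi) z)).
  by move=> m z; case: (dz i z).
apply: reg_sum => a; apply: regM; first by apply: IH; exact: jsmooth_jetD.
exact: (smooth_fpd i (sk a)).
Qed.

Lemma smooth_Ups_tilde p q (f g : jet R d -> R) (t : tree d) (phi phit : st -> R) :
  smooth_nonlinearity p f -> smooth_nonlinearity q g ->
  smooth_periodic phi -> smooth_periodic phit ->
  smooth (fun _ z => Ups_tilde f g t (jet_at phi z) (jet_at phit z)).
Proof.
move=> sf sg sphi sphit.
have sU l : jsmooth (Upsilon f g l).
  by case: l => /=; [exact: smooth_nonlinearity_jsmooth sf|exact: smooth_nonlinearity_jsmooth sg].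
elim/tree_nested_ind: t => s k v ch gr IH.
have sF l L : jsmooth (jet_delk k (foldr (@jetD R d) (Upsilon f g l) L)).
  apply: jsmooth_jet_delk; elim: L => [|a L IHL] /=; first exact: sU.
  exact: jsmooth_jetD.
have sch : smooth (fun (_ : R) (z : st) =>
    foldr (fun c acc => Ups_tilde f g c.2 (jet_at phi z) (jet_at phit z) * acc) 1 ch).
  elim: ch IH => [_|c ch IHch] /=; first exact: smooth_cst.
  by case=> hc /IHch; exact: smoothM hc.
apply: smoothM sch; case: v.
  have E Zt : (fun W => Ups_base f g (is_noisy s) true W Zt) = Upsilon f g (is_noisy s).
    by apply/funext => W; rewrite /Ups_base mul1r subrr mul0r addr0.
  apply: smooth_eq (smooth_jet sphi (sF (is_noisy s)
    ([seq c.1.2 | c <- ch] ++ [seq bj.1 | bj <- gr]))) => m z.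
  by rewrite E.
have E Z : (fun W => Ups_base f g (is_noisy s) false Z W) = Upsilon f g (is_noisy s).
  by apply/funext => W; rewrite /Ups_base mul0r add0r subr0 mul1r.
apply: smooth_eq (smooth_jet sphit (sF (is_noisy s)
  ([seq c.1.2 | c <- ch] ++ [seq bj.1 | bj <- gr]))) => m z.
by rewrite E.
Qed.

End Jets.

Local Close Scope classical_set_scope.
(* [down] is also an operation on sets of real numbers. *)
Local Notation down := Defs.down.

(** * Combinatorics of the extraction and of the abstract derivative *)

Section Multiindices.
Variable d : nat.
Implicit Types j k : mi d.

Lemma mi_lenD j k : mi_len (j + k) = (mi_len j + mi_len k)%N.
Proof. by rewrite /mi_len -big_split/=; apply: eq_bigr => i _; rewrite !ffunE. Qed.

Lemma mi_len0 : mi_len (0 : mi d) = 0%N.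
Proof. by rewrite /mi_len big1// => i _; rewrite !ffunE. Qed.

Lemma mi_len_sum (I : Type) (r : seq I) (F : I -> mi d) :
  mi_len (\sum_(i <- r) F i) = (\sum_(i <- r) mi_len (F i))%N.
Proof.
elim: r => [|i r IH]; first by rewrite !big_nil mi_len0.
by rewrite !big_cons mi_lenD IH.
Qed.

Lemma mi_len_eq0 j : (mi_len j == 0%N) = (j == 0).
Proof.
apply/idP/eqP => [|->]; last by rewrite mi_len0.
rewrite sum_nat_eq0 => /forallP h; apply/ffunP => i.
by rewrite ffunE; apply/eqP; exact: h.
Qed.

Lemma mi_addr_eq0l j k : j + k == 0 -> j == 0.
Proof. by rewrite -!mi_len_eq0 mi_lenD addn_eq0 => /andP[]. Qed.

Lemma mi_len_scaled j : (mi_len j <= mi_scaled j)%N.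
Proof.
rewrite /mi_len /mi_scaled big_ord_recl leq_add2r.
by rewrite mul2n -addnn leq_addr.
Qed.

Lemma mem_mi_box N j : (j \in mi_box d N) = [forall i, (j i < N)%N].
Proof.
apply/mapP/forallP => [[k _ ->] i|h]; first by rewrite ffunE.
exists [ffun i => Ordinal (h i)]; first by rewrite mem_enum.
by apply/ffunP => i; rewrite !ffunE.
Qed.

Lemma mi_box_uniq N : uniq (mi_box d N).
Proof.
rewrite map_inj_uniq ?enum_uniq// => k k' /ffunP h.
by apply/ffunP => i; apply: val_inj; have := h i; rewrite !ffunE.
Qed.

(** A multi-index outside of a box has length at least the size of the box. *)
Lemma big_mi_box (V : nmodType) D N (F : mi d -> V) : (D <= N)%N ->
  (forall j, (D <= mi_len j)%N -> F j = 0) ->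
  \sum_(j <- mi_box d N) F j = \sum_(j <- mi_box d D) F j.
Proof.
move=> DN F0; rewrite (bigID (mem (mi_box d D)))/= [X in _ + X]big1 ?addr0.
  rewrite -big_filter; apply: perm_big; apply: uniq_perm.
  - by rewrite filter_uniq// mi_box_uniq.
  - exact: mi_box_uniq.
  move=> j; rewrite mem_filter andb_idr// !mem_mi_box => /forallP h.
  by apply/forallP => i; exact: leq_trans (h i) DN.
move=> j; rewrite mem_mi_box => /forallPn [i]; rewrite -leqNgt => Dji.
by apply: F0; rewrite (leq_trans Dji)// /mi_len (bigD1 i)//= leq_addr.
Qed.

End Multiindices.

Section Decorations.
Variable d : nat.
Implicit Types t u : tree d.

(** The number of powers of [X] in a tree, also inside its grey branches. It is
    what [M_loc] and the grey branches of [Delta_r] increase. *)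
Fixpoint decoration t : nat :=
  let: Node _ k _ ch gr := t in
  (mi_len k + foldr (fun c n => decoration c.2 + n) 0 ch
   + \sum_(bj <- gr) mi_len bj.2)%N.

(** The shape of the left factors of [Delta_r]; the root is exempt from the
    convention [planted_zero]. Such a tree is mapped by [down] into the domain
    of the character. *)
Fixpoint well_planted t : bool :=
  let: Node _ _ _ ch _ := t in
  all (fun c => [&& (if c.1.1 is EI then true else false),
                    ~~ planted_zero c.2 & well_planted c.2]) ch.

Lemma decoration_mul t u :
  decoration (tree_mul t u) = (decoration t + decoration u)%N.
Proof.
case: t => s k v ch gr; case: u => s' k' v' ch' gr' /=.
rewrite mi_lenD big_cat/=; set X := foldr _ _ (ch ++ ch').
have -> : X = (foldr (fun c n => decoration c.2 + n) 0 ch +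
    foldr (fun c n => decoration c.2 + n) 0 ch')%N.
  by rewrite /X; elim: ch {X} => [//|c ch IH] /=; rewrite IH addnA.
lia.
Qed.

Lemma well_planted_mul t u : well_planted t -> well_planted u ->
  well_planted (tree_mul t u).
Proof.
by case: t => s k v ch gr; case: u => s' k' v' ch' gr' /= h1 h2; rewrite all_cat h1.
Qed.

Lemma decoration_down t : decoration (down t) = decoration t.
Proof.
elim/tree_nested_ind: t => s k v ch gr IH /=.
rewrite mi_lenD mi_len_sum big_nil addn0 addnAC; congr (_ + _ + _)%N.
by elim: ch IH => [//|c ch IHch] /= [-> /IHch ->].
Qed.

Lemma decoration_forget_Y t : decoration (forget_Y t) = decoration t.
Proof.
elim/tree_nested_ind: t => s k v ch gr IH /=; congr (_ + _ + _)%N.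
by elim: ch IH => [//|c ch IHch] /= [-> /IHch ->].
Qed.

Lemma has_greyXi_down t : has_greyXi t = false -> has_greyXi (down t) = false.
Proof.
elim/tree_nested_ind: t => s k v ch gr IH /=; case: s => //= h.
- by elim: ch IH h => [//|c ch IHch] /= [h1 h2] /norP[/negbTE/h1 -> /negbTE/IHch ->].
- by elim: ch IH h => [//|c ch IHch] /= [h1 h2] /norP[/negbTE/h1 -> /negbTE/IHch ->].
Qed.

Lemma planted_zero_down t : ~~ planted_zero t -> ~~ planted_zero (down t).
Proof.
rewrite /planted_zero !negb_or => /andP[h /negbTE/has_greyXi_down ->]; rewrite andbT.
by case: t h => s k v ch gr /=; case: s => //=; rewrite /nilp size_map;
  apply: contra => /andP[/mi_addr_eq0l -> ->].
Qed.

Lemma is_T0X_down t : well_planted t -> is_T0X (down t).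
Proof.
elim/tree_nested_ind: t => s k v ch gr IH /= h; apply/andP; split.
  by case: s.
elim: ch IH h => [//|c ch IHch] /= [h1 h2] /andP[/and3P[e pz wp] h].
by rewrite e planted_zero_down// h1// IHch.
Qed.

Lemma decoration_grey_planted (a j : mi d) : (mi_len j <= decoration (grey_planted a j))%N.
Proof. by rewrite /= big_seq1 leq_addl. Qed.

Lemma decoration_planted e a t : decoration (planted e a t) = decoration t.
Proof. by rewrite /= mi_len0 big_nil !addn0 add0n. Qed.

End Decorations.

Section TreeStatistics.
Variables (R : realType) (d : nat) (alpha kappa : R).
Hypothesis halpha : 0 < alpha <= 1.
Hypothesis hkappa : 0 < kappa.
Implicit Types t u : tree d.

(** An upper bound for minus the degree of a tree without powers of [X]. *)
Fixpoint cost t : R :=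
  let: Node s _ _ ch _ := t in
  (if s is Xi then 2 + kappa else 0)
  + foldr (fun c x => (mi_scaled c.1.2)%:R + cost c.2 + x) 0 ch.

Lemma cost_ge0 t : 0 <= cost t.
Proof.
elim/tree_nested_ind: t => s k v ch gr /= IH.
rewrite addr_ge0//; first by case: s => //; rewrite addr_ge0// ltW.
by elim: ch IH => [//|c ch IHch] /= [h1 h2]; rewrite !addr_ge0// IHch.
Qed.

Lemma cost_mul t u : cost (tree_mul t u) <= cost t + cost u.
Proof.
case: t => s k v ch gr; case: u => s' k' v' ch' gr' /=.
set X := (X in _ + X <= _); set Y := foldr _ _ ch; set Y' := foldr _ _ ch'.
have -> : X = Y + Y'.
  by rewrite /X /Y; elim: ch {X Y} => [|c ch IH] /=; rewrite ?add0r// IH addrA.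
have k0 : 0 <= 2 + kappa by rewrite addr_ge0// ltW.
clearbody Y Y'; case: s; case: s'; rewrite /=; lra.
Qed.

Lemma cost_down t : cost (down t) = cost t.
Proof.
elim/tree_nested_ind: t => s k v ch gr IH /=; congr (_ + _); first by case: s.
by elim: ch IH => [//|c ch IHch] /= [-> /IHch ->].
Qed.

(** Each power of [X] has degree at least 1. *)
Lemma deg_ge t : is_T0X t -> (decoration t)%:R - cost t <= deg alpha kappa t.
Proof.
elim/tree_nested_ind: t => s k v ch gr IH /= /and3P[hs /nilP-> h].
rewrite big_nil addn0 natrD.
have hk : (mi_len k)%:R <= (mi_scaled k)%:R :> R by rewrite ler_nat mi_len_scaled.
suff hch : (foldr (fun c n => (decoration c.2 + n)%N) 0%N ch)%:R
    - foldr (fun c x => (mi_scaled c.1.2)%:R + cost c.2 + x) 0 ch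
    <= foldr (fun c acc => deg alpha kappa c.2 + 2 - (mi_scaled c.1.2)%:R
         - (if c.1.1 is EI' then 1 else 0) + acc) 0 ch.
  move: hch hk; move: (foldr _ _ ch) (foldr _ _ ch) (foldr _ _ ch) => X Y Z.
  by have /andP[a0 _] := halpha; case: (s); lra.
elim: ch IH h => [|c ch IHch] /=; first by rewrite subrr.
move=> [h1 h2] /andP[/and3P[e _ wp] h].
have := h1 wp; have := IHch h2 h.
have -> : (if c.1.1 is EI' then 1 else 0) = 0 :> R by case: (c.1.1) e.
rewrite natrD; lra.
Qed.

Lemma ell_down_eq0 (ell : tree d -> R) t : is_character alpha kappa ell ->
  well_planted t -> cost t <= (decoration t)%:R -> (0 < decoration t)%N ->
  ell (down t) = 0.
Proof.
move=> [_ _ _ _ ell0] wp ct d0; apply: ell0; first exact: is_T0X_down.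
  move=> /(congr1 (@decoration d)); rewrite decoration_forget_Y decoration_down /=.
  by rewrite mi_len0 big_nil => dt; rewrite dt in d0.
apply: le_trans (deg_ge (is_T0X_down wp)).
by rewrite subr_ge0 cost_down decoration_down.
Qed.

End TreeStatistics.

Section FormalSums.
Variables (R : realType) (d : nat).
Implicit Types (t u l r : tree d) (Phi : tree d -> tree d -> R).

(** All the identities between formal sums of tensors are stated after pairing
    with an arbitrary function of the two factors: this forgets the order of
    the terms and merges equal ones, and nothing else. *)
Definition pairing (x : seq (R * tree d * tree d)) Phi : R :=
  \sum_(p <- x) p.1.1 * Phi p.1.2 p.2.

Lemma eq_pairing x Phi Psi : (forall l r, Phi l r = Psi l r) ->
  pairing x Phi = pairing x Psi.
Proof. by move=> PP; apply: eq_bigr => p _; rewrite PP. Qed.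

Lemma pairing0 x Phi : (forall l r, Phi l r = 0) -> pairing x Phi = 0.
Proof. by move=> P0; rewrite /pairing big1// => p _; rewrite P0 mulr0. Qed.

Lemma pairingD x Phi Psi :
  pairing x (fun l r => Phi l r + Psi l r) = pairing x Phi + pairing x Psi.
Proof. by rewrite /pairing -big_split/=; apply: eq_bigr => p _; rewrite mulrDr. Qed.

Lemma pairing_sum x (I : Type) (s : seq I) (F : I -> tree d -> tree d -> R) :
  pairing x (fun l r => \sum_(i <- s) F i l r) = \sum_(i <- s) pairing x (F i).
Proof.
by rewrite /pairing exchange_big/=; apply: eq_bigr => p _; rewrite mulr_sumr.
Qed.

Lemma pairing_cat x y Phi : pairing (x ++ y) Phi = pairing x Phi + pairing y Phi.
Proof. exact: big_cat. Qed.

Lemma pairing_tens_mul x y Phi : pairing (tens_mul x y) Phi =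
  pairing x (fun l r => pairing y (fun l' r' => Phi (tree_mul l l') (tree_mul r r'))).
Proof.
rewrite /pairing /tens_mul big_allpairs_dep/=; apply: eq_bigr => p _.
by rewrite mulr_sumr; apply: eq_bigr => q _; rewrite mulrA.
Qed.

(** [Delta_r] is multiplicative over the branches; this is the factor of one of
    them. *)
Definition Delta_branch N (c : edge * mi d * tree d) : seq (R * tree d * tree d) :=
  let: (e, a, t) := c in
  (if e is EI then
     [seq (p.1.1, planted EI a p.1.2, p.2) | p <- Delta_r R N t & ~~ planted_zero p.1.2]
   else [::]) ++
  [seq ((mi_fact j)%:R^-1, grey_planted a j, planted e (a + j) t) | j <- mi_box d N].

Definition Delta_root s k v gr : seq (R * tree d * tree d) :=
  tens_mul [:: (1, Node NoNoise k v [::] gr, tree_one d)] (Delta_noise R d s).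

Lemma Delta_rE N s k v ch gr : Delta_r R N (Node s k v ch gr) =
  foldr (fun c acc => tens_mul (Delta_branch N c) acc) (Delta_root s k v gr) ch.
Proof. by rewrite /=; elim: ch => [//|[[e a] t] ch IH] /=; rewrite IH. Qed.

Lemma pairing_Delta_branch N e a t Phi : pairing (Delta_branch N (e, a, t)) Phi =
  (if e is EI then
     pairing (Delta_r R N t) (fun l r =>
         if planted_zero l then 0 else Phi (planted EI a l) r)
   else 0) +
  \sum_(j <- mi_box d N) (mi_fact j)%:R^-1 * Phi (grey_planted a j) (planted e (a + j) t).
Proof.
rewrite /Delta_branch pairing_cat; congr (_ + _); last by rewrite /pairing big_map.
case: e; last by rewrite /pairing big_nil.
rewrite /pairing big_map big_filter big_mkcond; apply: eq_bigr => p _ /=.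
by case: (planted_zero _); rewrite /= ?mulr0.
Qed.

(** The decoration is additive under products, so a term that uses an index
    outside of the smaller box has a large decoration. *)
Lemma pairing_Delta_r_trunc D N t Phi : (D <= N)%N ->
  (forall l r, (D <= decoration l)%N -> Phi l r = 0) ->
  pairing (Delta_r R N t) Phi = pairing (Delta_r R D t) Phi.
Proof.
move=> DN; elim/tree_nested_ind: t Phi => s k v ch gr IH Phi Phi0.
rewrite !Delta_rE; elim: ch IH Phi Phi0 =>
    [//|[[e a] t] ch IHch] /= [IHt /IHch {}IHch] Phi Phi0.
rewrite !pairing_tens_mul.
under eq_pairing => l r.
  rewrite IHch; last by move=> l' r' Dl';
      rewrite Phi0// decoration_mul (leq_trans Dl')// leq_addl.
  over.
set Psi := (fun l r => _ ).
have Psi0 l r : (D <= decoration l)%N -> Psi l r = 0.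
  move=> Dl; apply: pairing0 => l' r'.
  by apply: Phi0; rewrite decoration_mul (leq_trans Dl)// leq_addr.
rewrite !pairing_Delta_branch; congr (_ + _).
  case: e => //; apply: IHt => l r Dl; case: ifP => // _.
  by apply: Psi0; rewrite decoration_planted.
apply: big_mi_box => // j Dj; rewrite Psi0 ?mulr0//.
exact: leq_trans (decoration_grey_planted _ _).
Qed.

Let branches N (ch : seq (edge * mi d * tree d)) :=
  foldr (fun c acc => [seq (p.1 * q.1, (c.1, p.2) :: q.2) | p <- M_loc R N c.2, q <- acc])
    [:: (1, [::])] ch.

Lemma M_loc_sum N s k v ch gr (Phi : tree d -> R) :
  \sum_(q <- M_loc R N (Node s k v ch gr)) q.1 * Phi q.2 =
  \sum_(j <- mi_box d N) (mi_fact j)%:R^-1 *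
    \sum_(q <- branches N ch) q.1 * Phi (Node s (k + j) v q.2 gr).
Proof.
rewrite /= big_allpairs_dep/=; apply: eq_bigr => j _.
by rewrite mulr_sumr; apply: eq_bigr => q _; rewrite mulrA.
Qed.

Lemma M_loc_trunc D N l (Phi : tree d -> R) : (D <= N)%N ->
  (forall q, (D <= decoration q)%N -> Phi q = 0) ->
  \sum_(q <- M_loc R N l) q.1 * Phi q.2 = \sum_(q <- M_loc R D l) q.1 * Phi q.2.
Proof.
move=> DN; elim/tree_nested_ind: l Phi => s k v ch gr IH Phi Phi0.
have brs (F : seq (edge * mi d * tree d) -> R) :
    (forall ch', (D <= foldr (fun c n => decoration c.2 + n) 0 ch')%N -> F ch' = 0) ->
    \sum_(q <- branches N ch) q.1 * F q.2 = \sum_(q <- branches D ch) q.1 * F q.2.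
  elim: ch IH F {Phi Phi0} => [//|c ch IHch] /= [IHc /IHch {}IHch] F F0.
  rewrite !big_allpairs_dep/=.
  transitivity (\sum_(p <- M_loc R N c.2) p.1 * \sum_(q <- branches D ch) q.1 * F ((c.1, p.2) :: q.2)).
    apply: eq_bigr => p _; rewrite -(IHch (fun ch' => F ((c.1, p.2) :: ch'))).
      by rewrite mulr_sumr; apply: eq_bigr => q _; rewrite mulrA.
    by move=> ch' Dch'; apply: F0; rewrite /= (leq_trans Dch')// leq_addl.
  rewrite (IHc (fun l => \sum_(q <- branches D ch) q.1 * F ((c.1, l) :: q.2))).
    apply: eq_bigr => p _.
    by rewrite mulr_sumr; apply: eq_bigr => q _; rewrite mulrA.
  move=> l Dl; rewrite big1// => q _.
  by rewrite F0 ?mulr0//= (leq_trans Dl)// leq_addr.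
rewrite !M_loc_sum; transitivity (\sum_(j <- mi_box d N) (mi_fact j)%:R^-1 *
    \sum_(q <- branches D ch) q.1 * Phi (Node s (k + j) v q.2 gr)).
  apply: eq_bigr => j _; congr (_ * _); apply: (brs (fun ch' => Phi (Node s (k +
      j) v ch' gr))) => ch' Dch'.
  by apply: Phi0; rewrite /= (leq_trans Dch')// -addnA addnCA leq_addr.
apply: big_mi_box => // j Dj; rewrite big1 ?mulr0// => q _.
rewrite Phi0 ?mulr0//= mi_lenD (leq_trans Dj)// -addnA -addnA addnCA leq_addr //.
Qed.

End FormalSums.

Section Terms.
Variables (R : realType) (d : nat) (kappa : R).
Hypothesis hkappa : 0 < kappa.
Implicit Types (t u : tree d).

Lemma all_tens_mul (P Q S : R * tree d * tree d -> bool) x y :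
  (forall p q, P p -> Q q -> S (p.1.1 * q.1.1, tree_mul p.1.2 q.1.2, tree_mul p.2 q.2)) ->
  all P x -> all Q y -> all S (tens_mul x y).
Proof.
move=> PQS; elim: x => [//|p x IH] /= /andP[Pp /IH {}IH] Qy.
rewrite all_cat IH// andbT all_map; apply: sub_all Qy => q Qq; exact: PQS.
Qed.

Lemma Delta_r_terms N t :
  all (fun p => well_planted p.1.2 && (cost kappa p.1.2 <= cost kappa t)) (Delta_r R N t).
Proof.
elim/tree_nested_ind: t => s k v ch gr IH; rewrite Delta_rE /=.
set C := (if s is Xi then _ else _); elim: ch IH => [_|[[e a] t] ch IHch] /=.
  rewrite /Delta_root addr0 /C; have k0 : 0 <= 2 + kappa by rewrite addr_ge0// ltW.
  by case: s {C} => /=; rewrite ?addr0 ?lexx// k0.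
move=> [IHt /IHch {}IHch].
apply: (@all_tens_mul (fun p => well_planted p.1.2 &&
    (cost kappa p.1.2 <= (mi_scaled a)%:R + cost kappa t)) _ _ _ _ _ _ IHch).
  move=> p q /andP[w1 c1] /andP[w2 c2] /=; rewrite well_planted_mul//=.
  apply: le_trans (cost_mul hkappa _ _) _; apply: le_trans (lerD c1 c2) _.
  by rewrite addrCA.
have t0 : 0 <= (mi_scaled a)%:R + cost kappa t by rewrite addr_ge0// cost_ge0.
rewrite /Delta_branch all_cat; apply/andP; split; last first.
  by rewrite all_map; apply/allP => j _ /=; rewrite addr0.
case: e => //; rewrite all_map all_filter; apply: sub_all IHt => p /andP[w c].
by apply/implyP => pz /=; rewrite pz w add0r addr0 lerD2l.
Qed.

(** What localisation keeps of a left factor [l], so that all the terms of its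
    localisation obey the bounds that hold for [l]. *)
Definition refines (l q : tree d) : bool :=
  [&& well_planted q, cost kappa q == cost kappa l, (decoration l <= decoration q)%N,
      has_greyXi q == has_greyXi l & only_grey q ==> only_grey l].

Let branches_refine (ch ch' : seq (edge * mi d * tree d)) : bool :=
  [&& all (fun c => [&& (if c.1.1 is EI then true else false),
                    ~~ planted_zero c.2 & well_planted c.2]) ch',
      foldr (fun c x => (mi_scaled c.1.2)%:R + cost kappa c.2 + x) 0 ch' ==
      foldr (fun c x => (mi_scaled c.1.2)%:R + cost kappa c.2 + x) 0 ch,
      (foldr (fun c n => decoration c.2 + n) 0 ch
        <= foldr (fun c n => decoration c.2 + n) 0 ch')%N,
      has (fun c => has_greyXi c.2) ch' == has (fun c => has_greyXi c.2) ch
    & (size ch' == size ch)].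

Lemma M_loc_terms N l : well_planted l -> all (fun q => refines l q.2) (M_loc R N l).
Proof.
elim/tree_nested_ind: l => s k v ch gr IH /= wch.
set br := foldr _ _ ch.
have hbr : all (fun q : R * seq (edge * mi d * tree d) => branches_refine ch q.2) br.
  rewrite /br; elim: ch IH wch {br} => [|c ch IHch] /=.
    by rewrite /branches_refine /= !eqxx.
  move=> [IHc /IHch {}IHch] /andP[/and3P[he pz wc] /IHch {}IHch].
  have {}IHc := IHc wc; elim: (M_loc R N c.2) IHc => [//|p x IHx] /= /andP[rp /IHx hx].
  rewrite all_cat hx andbT all_map; apply: sub_all IHch => q /=.
  case/and5P: rp => w /eqP cst dec /eqP gx og.
  case/and5P => w' /eqP cst' dec' /eqP gx' /eqP sz.
  rewrite /branches_refine /= he w w' cst cst' gx gx' sz !eqxx leq_add//= !andbT.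
  move: pz; rewrite /planted_zero !negb_or gx => /andP[ogc ->]; rewrite andbT.
  by apply: contra ogc; apply/implyP.
elim: (mi_box d N) => [//|j js IHj] /=; rewrite all_cat IHj andbT all_map.
apply: sub_all hbr => q /= /and5P[w /eqP cst dec /eqP gx /eqP sz].
rewrite /refines /= w cst gx !eqxx /=; apply/andP; split.
  by rewrite leq_add2r leq_add// mi_lenD leq_addr.
apply/implyP; rewrite /nilp sz => /and3P[-> /mi_addr_eq0l -> ->].
by [].
Qed.

End Terms.

Section AbstractDerivative.
Variables (R : realType) (d : nat).
Implicit Types (t u l r : tree d) (Phi : tree d -> tree d -> R).

(** The trees without edges [I'], on which [up] is the abstract derivative. *)
Fixpoint plain t : bool :=
  let: Node _ _ _ ch _ := t in
  all (fun c => (if c.1.1 is EI then true else false) && plain c.2) ch.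

(** The recursion over the branches inside [up], which is the product rule. *)
Fixpoint up_branches (ch : seq (edge * mi d * tree d)) :=
  match ch with
  | [::] => [::]
  | (e, a, t) :: ch' =>
      ((EI', a, t) :: ch') ::
      [seq (EI, a, u) :: ch' | u <- up t] ++ [seq (e, a, t) :: ch''
          | ch'' <- up_branches ch']
  end.

Lemma upE s k v ch gr : up (Node s k v ch gr) = [seq Node s k v ch' gr
    | ch' <- up_branches ch].
Proof. by []. Qed.

Lemma up_planted a t : up (planted EI a t) =
    planted EI' a t :: [seq planted EI a u | u <- up t].
Proof. by rewrite upE /= cats0 -map_comp. Qed.

Lemma big_up_branches_cat ch ch' (F : seq (edge * mi d * tree d) -> R) :
  \sum_(b <- up_branches (ch ++ ch')) F b =
  \sum_(b <- up_branches ch) F (b ++ ch') + \sum_(b <- up_branches ch') F (ch ++ b).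
Proof.
elim: ch F => [|[[e a] t] ch IH] F /=; first by rewrite big_nil add0r.
rewrite !big_cons !big_cat/= !big_map IH /= -!addrA; congr (_ + (_ + _)).
Qed.

Lemma big_up_mul t u (F : tree d -> R) :
  \sum_(r <- up (tree_mul t u)) F r =
  \sum_(r <- up t) F (tree_mul r u) + \sum_(r <- up u) F (tree_mul t r).
Proof.
case: t => s k v ch gr; case: u => s' k' v' ch' gr'.
rewrite [tree_mul _ _]/= !upE !big_map.
exact: (big_up_branches_cat ch ch' (fun b => F (Node _ _ _ b _))).
Qed.

(** Compares the extraction of a branch with its derivative. The edge [I'] is only
    found in the grey terms, since an extracted edge carries no derivative. *)
Lemma pairing_Delta_branch_up N a t Phi :
  (forall Psi, plain t -> \sum_(u <- up t) pairing (Delta_r R N u) Psi =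
     pairing (Delta_r R N t) (fun l r => \sum_(u <- up r) Psi l u)) -> plain t ->
  pairing (Delta_branch R N (EI', a, t)) Phi +
    \sum_(u <- up t) pairing (Delta_branch R N (EI, a, u)) Phi =
  pairing (Delta_branch R N (EI, a, t)) (fun l r => \sum_(u <- up r) Phi l u).
Proof.
move=> IH pl; rewrite [X in _ + X](eq_bigr _ (fun u _ =>
    pairing_Delta_branch N EI a u Phi)).
rewrite !pairing_Delta_branch add0r.
rewrite [X in _ = _ + X](eq_bigr (fun j => (mi_fact j)%:R^-1 *
    (Phi (grey_planted a j) (planted EI' (a + j) t) +
     \sum_(u <- up t) Phi (grey_planted a j) (planted EI (a + j) u)))); last first.
  by move=> j _; rewrite up_planted big_cons big_map.
rewrite big_split/= IH// addrCA; congr (_ + _).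
  by apply: eq_pairing => l r; case: ifP => // _; rewrite big1.
rewrite exchange_big/= -big_split/=; apply: eq_bigr => j _.
by rewrite -mulr_sumr -mulrDr.
Qed.

(** The abstract derivative acts on the part of the tree that is not extracted at
    the root. Both sides obey the product rule over the branches of the root. *)
Lemma pairing_Delta_r_up N t Phi : plain t ->
  \sum_(u <- up t) pairing (Delta_r R N u) Phi =
  pairing (Delta_r R N t) (fun l r => \sum_(u <- up r) Phi l u).
Proof.
elim/tree_nested_ind: t Phi => s k v ch gr IH Phi pl.
rewrite upE big_map Delta_rE.
under eq_bigr => b _ do rewrite Delta_rE.
elim: ch IH Phi pl => [_ Phi _|[[e a] t] ch IHch] /=.
  by rewrite big_nil; case: s => /=; rewrite /pairing /= ?big_cons ?big_nil /=
    ?big_nil ?mulr0 ?addr0.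
move=> [IHt /IHch {}IHch] Phi /andP[/andP[he plt] plch].
case: e he => // _.
rewrite big_cons big_cat/= !big_map/= pairing_tens_mul.
pose D := foldr (fun c acc => tens_mul (Delta_branch R N c) acc) (Delta_root R s k v gr).
rewrite -/(D ch).
pose Psi l u := pairing (D ch) (fun l' r' => Phi (tree_mul l l') (tree_mul u r')).
have -> : pairing (tens_mul (Delta_branch R N (EI, a, t)) (D ch))
    (fun l r => \sum_(u <- up r) Phi l u) =
  pairing (Delta_branch R N (EI, a, t)) (fun l r => \sum_(u <- up r) Psi l u) +
  \sum_(b <- up_branches ch) pairing (Delta_branch R N (EI, a, t))
     (fun l r => pairing (D b) (fun l' r' => Phi (tree_mul l l') (tree_mul r r'))).
  rewrite pairing_tens_mul -pairing_sum -pairingD; apply: eq_pairing => l r.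
  rewrite IHch// /Psi -pairing_sum -pairingD; apply: eq_pairing => l' r'.
  exact: big_up_mul.
rewrite -(@pairing_Delta_branch_up N a t Psi IHt plt) addrA; congr (_ + _ + _).
  by apply: eq_bigr => u _; rewrite pairing_tens_mul.
by apply: eq_bigr => b _; rewrite pairing_tens_mul.
Qed.

Lemma cost_up (kappa : R) t : all (fun u => cost kappa u == cost kappa t) (up t).
Proof.
elim/tree_nested_ind: t => s k v ch gr IH; rewrite upE all_map.
suff : all (fun b => foldr (fun c x => (mi_scaled c.1.2)%:R + cost kappa c.2 + x) 0 b ==
    foldr (fun c x => (mi_scaled c.1.2)%:R + cost kappa c.2 + x) 0 ch :> R)
        (up_branches ch).
  by apply: sub_all => b /= /eqP ->.
elim: ch IH => [//|[[e a] t] ch IHch] /= [IHt /IHch {}IHch].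
rewrite eqxx all_cat !all_map /=; apply/andP; split.
  by apply: sub_all IHt => u /= /eqP ->.
by apply: sub_all IHch => b /= /eqP ->.
Qed.

Lemma plain_mul t u : plain t -> plain u -> plain (tree_mul t u).
Proof. by case: t => s k v ch gr; case: u => s' k' v' ch' gr' /=;
    rewrite all_cat => -> ->. Qed.

Lemma plain_Delta_r N t : plain t -> all (fun p => plain p.2) (Delta_r R N t).
Proof.
elim/tree_nested_ind: t => s k v ch gr IH pl; rewrite Delta_rE.
elim: ch IH pl => [_ _|[[e a] t] ch IHch]; first by case: s.
move=> /= [IHt /IHch {}IHch] /andP[/andP[he plt] /IHch {}IHch].
apply: (@all_tens_mul _ _ (fun p => plain p.2) (fun p => plain p.2)) IHch => //.
  by move=> p q /=; exact: plain_mul.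
rewrite /Delta_branch all_cat; apply/andP; split; last first.
  by rewrite all_map; apply/allP => j _ /=; rewrite he plt.
case: e he => // _; rewrite all_map all_filter; apply: sub_all (IHt plt) => p h.
by apply/implyP.
Qed.

Lemma is_T0_plain t : is_T0 t -> plain t.
Proof.
move=> /andP[+ _]; elim/tree_nested_ind: t => s k v ch gr IH /= /and3P[_ _].
by elim: ch IH => [//|c ch IHch] /= [h1 h2] /andP[/and3P[-> _ /h1 ->] /(IHch h2)].
Qed.

End AbstractDerivative.

(** * The commutation relations *)

Section Evaluation.
Variables (R : realType) (d : nat) (alpha kappa : R).
Hypotheses (halpha : 0 < alpha <= 1) (hkappa : 0 < kappa).
Variables (p q : nat) (f g : jet R d -> R).
Hypotheses (hf : smooth_nonlinearity p f) (hg : smooth_nonlinearity q g).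
Variable chi : R -> R.
Hypothesis hchi : is_cutoff chi.
Variable ell : tree d -> R.
Hypothesis hell : is_character alpha kappa ell.
Variable xi : spacetime R d -> R.
Hypothesis hxi : smooth_periodic xi.
Variables phi phit : spacetime R d -> R.
Hypotheses (hphi : smooth_periodic phi) (hphit : smooth_periodic phit).
Implicit Types (t u l r : tree d).

Notation Pt m t := (Pi_times f g chi ell xi m t phi phit).
Notation Ptl m t := (Pi_tilde f g chi ell xi m t phi phit).

(** The coefficient with which a left factor of [Delta_r] enters [Pi_tilde]; it
    does not depend on the scale. *)
Definition coefficient N l : spacetime R d -> R := fun z =>
  \sum_(s <- M_loc R N l) s.1 * ell_Ups f g ell s.2 phi phit z.

Lemma coefficient_smooth N l : smooth (fun _ : R => coefficient N l).
Proof.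
apply: (@smooth_sum _ _ _ _ (fun s (_ : R) z => s.1 * ell_Ups f g ell s.2 phi phit z)) => s.
apply: smoothM; first exact: smooth_cst.
by apply: smoothM; [exact: smooth_cst|exact: smooth_Ups_tilde hf hg hphi hphit].
Qed.

Lemma eq_sum_all (I : Type) (P : pred I) (s : seq I) (F G : I -> R) : all P s ->
  (forall i, P i -> F i = G i) -> \sum_(i <- s) F i = \sum_(i <- s) G i.
Proof.
move=> + FG; elim: s => [|i s IH] /=; first by rewrite !big_nil.
by move=> /andP[Pi /IH {}IH]; rewrite !big_cons FG// IH.
Qed.

(** Only finitely many terms of the formal sums contribute: a term with more
    powers of [X] than the cost of the tree has non-negative degree, where the
    character vanishes. *)
Lemma Pi_tilde_of_trunc (P : tree d -> functional R d) t N z :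
  cost kappa t < N%:R ->
  Pi_tilde_of f g ell P t phi phit z =
  pairing (Delta_r R N t) (fun l r => coefficient N l z * P r phi phit z).
Proof.
move=> tN; rewrite /Pi_tilde_of.
pose E s := ell_Ups f g ell s phi phit z.
(* E' vanishes on all large decorations, not only on the trees that occur, so
   that the truncation lemmas apply to it. *)
pose E' s := if (decoration s < N)%N then E s else 0.
have E'0 s : (N <= decoration s)%N -> E' s = 0 by rewrite /E' ltnNge => ->.
have N0 : (0 < N)%N by rewrite -(ltr_nat R); apply: le_lt_trans tN; exact: cost_ge0.
have EE' n l : well_planted l -> cost kappa l <= cost kappa t ->
    \sum_(s <- M_loc R n l) s.1 * E s.2 = \sum_(s <- M_loc R n l) s.1 * E' s.2.
  move=> wl cl; apply: (eq_sum_all (M_loc_terms kappa n wl)) => s /and5P[ws /eqP cs _ _ _].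
  rewrite /E'; case: ltnP => // Ns; congr (_ * _); rewrite /E /ell_Ups.
  rewrite (ell_down_eq0 halpha hell ws) ?mul0r//.
    by rewrite cs (le_trans cl)// (le_trans (ltW tN))// ler_nat.
  exact: leq_trans N0 Ns.
have sumE n : (N <= n)%N ->
    \sum_(s <- Delta_r R n t) s.1.1 *
       (\sum_(s' <- M_loc R n s.1.2) s'.1 * E s'.2) * P s.2 phi phit z =
    pairing (Delta_r R N t) (fun l r =>
      (if well_planted l then \sum_(s' <- M_loc R N l) s'.1 * E' s'.2 else 0)
      * P r phi phit z).
  move=> Nn; rewrite -(@pairing_Delta_r_trunc _ _ N n)//.
    apply: (eq_sum_all (Delta_r_terms hkappa n t)) => s /andP[ws cs].
    by rewrite EE'// -mulrA (M_loc_trunc s.1.2 Nn E'0) ws.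
  move=> l r Nl; case: ifP => [wl|_]; rewrite ?mul0r//.
  rewrite (eq_sum_all (G := fun=> 0) (M_loc_terms kappa N wl)) ?big1 ?mul0r//.
  by move=> s /and5P[_ _ ls _ _]; rewrite E'0 ?mulr0// (leq_trans Nl).
have -> : pairing (Delta_r R N t) (fun l r => coefficient N l z * P r phi phit z) =
    pairing (Delta_r R N t) (fun l r =>
      (if well_planted l then \sum_(s' <- M_loc R N l) s'.1 * E' s'.2 else 0)
      * P r phi phit z).
  rewrite -(sumE N)//; apply: eq_bigr => s _.
  by rewrite mulrA.
apply: (@lim_near_cst R) => //.
by exists N => // n /= Nn; exact: sumE.
Qed.

Lemma smooth_sum_all (I : Type) (P : pred I) (s : seq I) (F : I -> scale_family R d) :
  all P s -> (forall i, P i -> smooth (F i)) ->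
  smooth (fun m z => \sum_(i <- s) F i m z).
Proof.
move=> + sF; elim: s => [_|i s IH] /=.
  by apply: smooth_eq (@smooth_cst R d 0) => m z; rewrite big_nil.
move=> /andP[/sF Fi /IH {}IH].
by apply: smooth_eq (smoothD Fi IH) => m z; rewrite big_cons.
Qed.

Lemma smooth_deriv_sum_all (I : Type) (P : pred I) (s : seq I) (F F' : I ->
    scale_family R d) :
  all P s -> (forall i, P i -> smooth_deriv (F i) (F' i)) ->
  smooth_deriv (fun m z => \sum_(i <- s) F i m z) (fun m z => \sum_(i <- s) F' i m z).
Proof.
move=> + sF; elim: s => [_|i s IH] /=.
  by apply: smooth_deriv_eq (@smooth_deriv_cst R d 0) => m z; rewrite big_nil.
move=> /andP[/sF Fi /IH {}IH].
by apply: smooth_deriv_eq (smooth_derivD Fi IH) => m z; rewrite big_cons.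
Qed.

Lemma exists_truncation (x : R) : exists N : nat, x < N%:R.
Proof. by exists (Num.trunc x).+1; exact: truncnS_gt. Qed.

Lemma noise_smooth (s : noise) :
  smooth (fun (_ : R) z => if s is Xi then xi z else 1).
Proof.
have s1 := @smooth_cst R d 1; case: s => //; exact: (smooth_periodic_smooth hxi).
Qed.

Definition branch_value m z (c : edge * mi d * tree d) : R :=
  dconv c.1.2 (edge_kernel chi c.1.1 m) (Ptl m c.2) z.

Lemma Pi_tilde_smooth_of t : (forall u, (height u <= height t)%N ->
    smooth (fun m => Pt m u)) ->
  smooth (fun m => Ptl m t).
Proof.
move=> sP; have [N tN] := exists_truncation (cost kappa t).
apply: (@smooth_eq _ _ (fun m z => \sum_(s <- Delta_r R N t)
    s.1.1 * (coefficient N s.1.2 z * Pt m s.2 z))).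
  by move=> m z; rewrite /Pi_tilde (Pi_tilde_of_trunc _ _ tN).
apply: (smooth_sum_all (height_Delta_r R N t)) => s hs.
apply: smoothM; first exact: smooth_cst.
by apply: smoothM; [exact: coefficient_smooth|exact: sP].
Qed.

Lemma branch_value_smooth c : smooth (fun m => Ptl m c.2) ->
  smooth (fun m z => branch_value m z c).
Proof.
move=> sc; apply: smooth_eq (edge_conv_smooth hchi c.1.1 (smooth_fpdk c.1.2 sc)) => m z.
by rewrite /branch_value (dconvE hchi c.1.1 c.1.2 m z sc).
Qed.

(** Induction on the height: the right factors of [Delta_r] are not higher than
    the branch they come from. *)
Lemma Pi_times_smooth t : smooth (fun m => Pt m t).
Proof.
move: {2}(height t).+1 (ltnSn (height t)) => n; elim: n t => [//|n IH] [s k v ch gr] hn.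
apply: (@smooth_eq _ _ (fun m z => (if s is Xi then xi z else 1) *
    \prod_(c <- ch) branch_value m z c)).
  by move=> m z; rewrite Pi_timesE.
apply: smoothM; first exact: noise_smooth.
elim: ch hn => [|c ch IHch] hn.
  by apply: smooth_eq (@smooth_cst R d 1) => m z; rewrite big_nil.
have [/= hc hch] : (height c.2 < n /\ height (Node s k v ch gr) < n.+1)%N.
  by move: hn => /=; rewrite ltnS geq_max => /andP[].
apply: (@smooth_eq _ _ (fun m z =>
    branch_value m z c * \prod_(c <- ch) branch_value m z c)).
  by move=> m z; rewrite big_cons.
apply: smoothM; last exact: IHch.
apply: branch_value_smooth; apply: Pi_tilde_smooth_of => u hu.
by apply: IH; apply: leq_ltn_trans hu hc.
Qed.

Lemma Pi_tilde_smooth t : smooth (fun m => Ptl m t).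
Proof. by apply: Pi_tilde_smooth_of => u _; exact: Pi_times_smooth. Qed.

Lemma Pi_tilde_smooth_deriv_of t : plain t ->
  (forall u, plain u -> (height u <= height t)%N ->
     smooth_deriv (fun m => Pt m u) (fun m z => \sum_(u' <- up u) Pt m u' z)) ->
  smooth_deriv (fun m => Ptl m t) (fun m z => \sum_(u <- up t) Ptl m u z).
Proof.
move=> pt dP; have [N tN] := exists_truncation (cost kappa t).
pose F (s : R * tree d * tree d) : scale_family R d := fun m z =>
  s.1.1 * (coefficient N s.1.2 z * Pt m s.2 z).
pose F' (s : R * tree d * tree d) : scale_family R d := fun m z =>
  s.1.1 * (coefficient N s.1.2 z * \sum_(u <- up s.2) Pt m u z).
(* A derivative move does not change the cost, hence one truncation serves for
   [t] and for all the terms of [up t]. *)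
apply: (@smooth_deriv_eq _ _ (fun m z => \sum_(s <- Delta_r R N t) F s m z)
  (fun m z => \sum_(s <- Delta_r R N t) F' s m z)).
- by move=> m z; rewrite /Pi_tilde (Pi_tilde_of_trunc _ _ tN).
- move=> m z; rewrite (eq_sum_all (cost_up kappa t)
    (G := fun u => pairing (Delta_r R N u) (fun l r => coefficient N l z * Pt m r z))).
    rewrite pairing_Delta_r_up//; apply: eq_bigr => s _.
    by rewrite /F' mulr_sumr.
  by move=> u /eqP cu; rewrite /Pi_tilde (@Pi_tilde_of_trunc _ _ N)// cu.
have PQ : all (fun s => plain s.2 && (height s.2 <= height t)%N) (Delta_r R N t).
  by rewrite all_predI plain_Delta_r// height_Delta_r.
apply: (smooth_deriv_sum_all PQ) => s /andP[ps hs].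
have dC := smooth_deriv_static (coefficient_smooth N s.1.2).
have d1 := smooth_derivM dC (dP _ ps hs).
apply: smooth_deriv_eq (smooth_derivM (@smooth_deriv_cst R d s.1.1) d1) => m z //.
by rewrite /F' !mul0r !add0r.
Qed.

Lemma edge_convD e (A B : scale_family R d) m z : smooth A -> smooth B ->
  edge_conv chi e (fun m z => A m z + B m z) m z = edge_conv chi e A m z +
      edge_conv chi e B m z.
Proof.
move=> sA sB.
have cw (C : scale_family R d) : smooth C ->
    continuous (fun w : spacetime R d => ctime chi e m (w ord0 ord0) * C m (z - w)).
  by move=> sC; exact: weighted_continuous (jcont_slice (smooth_jcont sC)).
rewrite /edge_conv -heatD; [|exact: cw..].
by congr heat; apply/funext => w; rewrite mulrDr.
Qed.

Lemma fpdkD a (A B : scale_family R d) : smooth A -> smooth B ->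
  fpdk a (fun m z => A m z + B m z) = fun m z => fpdk a A m z + fpdk a B m z.
Proof.
move=> sA sB; apply/funext => m; rewrite /fpdk /pdk.
suff [_ [_ ->]] : smooth (fun m => foldr (fun i H => iter (a i) (pd i) H) (A m)
    (enum 'I_d.+1)) /\
  smooth (fun m => foldr (fun i H => iter (a i) (pd i) H) (B m) (enum 'I_d.+1)) /\
  foldr (fun i H => iter (a i) (pd i) H) (fun z => A m z + B m z) (enum 'I_d.+1) =
  fun z => foldr (fun i H => iter (a i) (pd i) H) (A m) (enum 'I_d.+1) z +
           foldr (fun i H => iter (a i) (pd i) H) (B m) (enum 'I_d.+1) z by [].
elim: (enum _) => [//|i s [sAs [sBs IH]]] /=; rewrite IH.
elim: (a i) => [//|n [sAn [sBn IHn]]] /=.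
split; first exact: smooth_fpd sAn.
split; first exact: smooth_fpd sBn.
rewrite IHn; apply/funext => z.
have dA := is_derive_pd (@smooth_derivable _ _ _ i m z sAn).
have dB := is_derive_pd (@smooth_derivable _ _ _ i m z sBn).
by case: (is_deriveD_fun dA dB).
Qed.

(** Brings the scale derivative of a branch into the form of a sum of
    evaluations of trees. *)
Lemma edge_conv_sum_Pi_tilde e a m z (s : seq (tree d)) :
  edge_conv chi e (fpdk a (fun m z => \sum_(u <- s) Ptl m u z)) m z =
  \sum_(u <- s) branch_value m z (e, a, u).
Proof.
have sS (s' : seq (tree d)) : smooth (fun m z => \sum_(u <- s') Ptl m u z).
  by apply: smooth_sum => u; exact: Pi_tilde_smooth.
elim: s => [|u s IH].
  rewrite big_nil.
  have -> : fpdk a (fun m z => \sum_(u <- [::]) Ptl m u z) = fun _ _ => 0.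
    have h := fpdkD a (@smooth_cst R d 0) (@smooth_cst R d 0).
    have E0 : (fun (m : R) (z : spacetime R d) => \sum_(u <- [::]) Ptl m u z) =
        fun _ _ => 0.
      by apply/funext => ?; apply/funext => ?; rewrite big_nil.
    rewrite E0; apply/funext => m'; apply/funext => z'.
    have := congr1 (fun F => F m' z') h; rewrite /= addr0 => /eqP.
    by rewrite -subr_eq0 opprD addNKr oppr_eq0 => /eqP.
  have := edge_convD e m z (@smooth_cst R d 0) (@smooth_cst R d 0).
  rewrite addr0 => /eqP; by rewrite -subr_eq0 opprD addNKr oppr_eq0 => /eqP.
rewrite big_cons -IH.
have -> : (fun m z => \sum_(v <- u :: s) Ptl m v z) =
    (fun m z => Ptl m u z + \sum_(v <- s) Ptl m v z).
  by apply/funext => ?; apply/funext => ?; rewrite big_cons.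
rewrite fpdkD; [|exact: Pi_tilde_smooth|exact: sS].
rewrite edge_convD; [|apply: smooth_fpdk; exact: Pi_tilde_smooth|exact: smooth_fpdk].
by rewrite /branch_value (dconvE hchi e a m z (Pi_tilde_smooth u)).
Qed.

Lemma branch_value_smooth_deriv a t :
  smooth_deriv (fun m => Ptl m t) (fun m z => \sum_(u <- up t) Ptl m u z) ->
  smooth_deriv (fun m z => branch_value m z (EI, a, t))
    (fun m z => branch_value m z (EI', a, t) +
        \sum_(u <- up t) branch_value m z (EI, a, u)).
Proof.
move=> dt; have [st _ _] := dt.
apply: smooth_deriv_eq (edge_conv_smooth_deriv hchi (smooth_deriv_fpdk a dt)) => m z.
  by rewrite /branch_value (dconvE hchi EI a m z st).
by rewrite edge_conv_sum_Pi_tilde /branch_value (dconvE hchi EI' a m z st).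
Qed.

(** The product rule over the branches of the root, which is how [up] is
    defined, combined with the induction hypothesis above each branch. *)
Lemma Pi_times_smooth_deriv t : plain t ->
  smooth_deriv (fun m => Pt m t) (fun m z => \sum_(u <- up t) Pt m u z).
Proof.
move: {2}(height t).+1 (ltnSn (height t)) => n; elim: n t => [//|n IH] [s k v ch gr] hn pch.
suff dch : smooth_deriv (fun m z => \prod_(c <- ch) branch_value m z c)
    (fun m z => \sum_(b <- up_branches ch) \prod_(c <- b) branch_value m z c).
  apply: smooth_deriv_eq (smooth_derivM (smooth_deriv_static (noise_smooth s)) dch) => m z.
    by rewrite Pi_timesE.
  rewrite mul0r add0r mulr_sumr upE big_map; apply: eq_bigr => b _.
  by rewrite Pi_timesE.
elim: ch hn pch => [|[[e a] t] ch IHch] hn.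
  by move=> _; apply: smooth_deriv_eq (@smooth_deriv_cst R d 1) => m z; rewrite !big_nil.
move=> /= /andP[/andP[he pt] pch].
have [/= hc hch] : (height t < n /\ height (Node s k v ch gr) < n.+1)%N.
  by move: hn => /=; rewrite ltnS geq_max => /andP[].
case: e he {hn} => // _.
have dt : smooth_deriv (fun m => Ptl m t) (fun m z => \sum_(u <- up t) Ptl m u z).
  apply: Pi_tilde_smooth_deriv_of => // u pu hu.
  by apply: IH => //; exact: leq_ltn_trans hu hc.
apply: smooth_deriv_eq (smooth_derivM (branch_value_smooth_deriv a dt)
    (IHch hch pch)) => m z.
  by rewrite big_cons.
rewrite big_cons big_cat/= !big_map big_cons mulrDl mulr_suml mulr_sumr -addrA.
by congr (_ + (_ + _)); apply: eq_bigr => b _; rewrite big_cons.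
Qed.

Lemma Pi_tilde_smooth_deriv t : plain t ->
  smooth_deriv (fun m => Ptl m t) (fun m z => \sum_(u <- up t) Ptl m u z).
Proof.
by move=> pt; apply: Pi_tilde_smooth_deriv_of => // u pu _; exact: Pi_times_smooth_deriv.
Qed.

End Evaluation.

Lemma lin_ext_up_lin (R : realType) (d : nat) (P : tree d -> functional R d)
    (x : lincomb R d) phi phit z :
  lin_ext P (up_lin x) phi phit z =
  \sum_(c <- x) c.1 * \sum_(u <- up c.2) P u phi phit z.
Proof.
rewrite /lin_ext /up_lin big_flatten big_map; apply: eq_bigr => c _.
by rewrite big_map mulr_sumr.
Qed.

(** Linear extension of the relation from trees to linear combinations. *)
Lemma lin_ext_is_derive (R : realType) (d : nat) (P : R -> tree d -> functional R d)
    (x : lincomb R d) phi phit (z : spacetime R d) (mu : R) : in_span_T0 x ->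
  (forall t, plain t -> smooth_deriv (fun m => P m t phi phit)
     (fun m z => \sum_(u <- up t) P m u phi phit z)) ->
  is_derive mu 1 (fun m : R => lin_ext (P m) x phi phit z)
    (lin_ext (P mu) (up_lin x) phi phit z).
Proof.
move=> hx dP; rewrite lin_ext_up_lin /lin_ext.
elim: x hx => [_|c x IH] /=.
  rewrite big_nil; apply: eq_is_derive (is_derive_cst_fun (0 : R) mu (1 : R)) => m.
  by rewrite big_nil.
move=> /andP[/is_T0_plain pc /IH {}IH]; rewrite big_cons.
have [_ _ /(_ 0%N)[dc _]] := dP _ pc.
apply: eq_is_derive (is_deriveD_fun (is_deriveZ_fun c.1 (dc mu z)) IH) => m.
by rewrite big_cons.
Qed.

Theorem proposition4p3 (R : realType) (d : nat) (hd : (1 <= d)%N)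
  (alpha kappa : R) (halpha : 0 < alpha <= 1) (hkappa : 0 < kappa)
  (p q : nat) (hp : (p < 2)%N) (hq : (q < 2)%N)
  (f g : jet R d -> R)
  (hf : smooth_nonlinearity p f) (hg : smooth_nonlinearity q g)
  (chi : R -> R) (hchi : is_cutoff chi)
  (ell : tree d -> R) (hell : is_character alpha kappa ell)
  (xi : R -> spacetime R d -> R)
  (hxi : forall e : R, 0 < e -> smooth_periodic (xi e))
  (eps : R) (heps : 0 < eps) (mu : R) (hmu : 0 <= mu <= 1)
  (x : lincomb R d) (hx : in_span_T0 x)
  (phi phit : spacetime R d -> R)
  (hphi : smooth_periodic phi) (hphit : smooth_periodic phit)
  (z : spacetime R d) :
  is_derive mu 1
    (fun m : R => lin_ext (Pi_tilde f g chi ell (xi eps) m) x phi phit z)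
    (lin_ext (Pi_tilde f g chi ell (xi eps) mu) (up_lin x) phi phit z) /\
  is_derive mu 1
    (fun m : R => lin_ext (Pi_times f g chi ell (xi eps) m) x phi phit z)
    (lin_ext (Pi_times f g chi ell (xi eps) mu) (up_lin x) phi phit z).
Proof.
have hxie := hxi _ heps.
split; apply: lin_ext_is_derive => // t pt.
  exact: (Pi_tilde_smooth_deriv halpha hkappa hf hg hchi hell hxie hphi hphit pt).
exact: (Pi_times_smooth_deriv halpha hkappa hf hg hchi hell hxie hphi hphit pt).
Qed.
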